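(* The SYZ transforms of the Lagrangian 3-spheres $S_0$ and $S_1$ in $Y^0$ are the line bundles $\mathcal{O}_E$ and $\mathcal{O}_E(-1)$ on the exceptional locus $E\subset X^0$, respectively.
   Context: Fix real numbers $a<b<0$. Let $Y^0=\{(z,u_1,v_1,u_2,v_2)\in\mathbb{C}^\times\times\mathbb{C}^4 : u_1v_1=z-a,\ u_2v_2=z-b\}$, with symplectic form $\omega$ the restriction of the sum of the cylindrical Kähler form on $\mathbb{C}^\times$ and the Euclidean Kähler form on $\mathbb{C}^4$. The SYZ fibration is $\rho:Y^0\to B=\mathbb{R}_{>0}\times\mathbb{R}^2$, $\rho=(|z|,\tfrac12(|u_1|^2-|v_1|^2),\tfrac12(|u_2|^2-|v_2|^2))$, coordinates $(r,\lambda_1,\lambda_2)$, discriminant $\Gamma=\{(|a|,0,\lambda_2)\}\cup\{(|b|,\lambda_1,0)\}$, $B^{\mathrm{sm}}=B\setminus\Gamma$. The zero-section $L_0$ is the locus where $z,u_1,v_1,u_2,v_2$ are all real and positive. Spheres. A bounded path is a smooth path $\sigma:[0,1]\to\mathbb{C}^\times$ joining $a$ and $b$; $L_\sigma=\bigcup_t\{(\sigma(t),u_1,v_1,u_2,v_2)\in Y^0:|u_1|=|v_1|,|u_2|=|v_2|\}$ is a Lagrangian 3-sphere. A bounded path from $b$ to $a$ is strongly admissible if $|\sigma|$ is strictly increasing and $\sigma$ is transversal to $[-b,-a]$. The reference path $\sigma_0$ is the strongly admissible path from $b$ to $a$ going once clockwise around $0$ (it meets the positive real axis transversally in exactly one point).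 The winding number $w(\sigma)$ of a strongly admissible bounded path $\sigma$ from $b$ to $a$ is the winding number around $0$ (counterclockwise positive) of the loop which follows $\sigma$ and then $\sigma_0$ reversed. $S_0=L_{\sigma_0}$ (winding number $0$) and $S_1=L_{\sigma_1}$, where $\sigma_1$ is the straight segment from $b$ to $a$ (winding number $1$). Mirror. $Z=\{(u,v,w_1,w_2)\in\mathbb{C}^4:uv=(1+w_1)(1+w_2)\}$, $X=\mathrm{Tot}(\mathcal{O}_{\mathbb{P}^1}(-1)\oplus\mathcal{O}_{\mathbb{P}^1}(-1))\xrightarrow{\varphi}Z$ the crepant resolution, $X^0=X\setminus\varphi^{-1}(\{w_1w_2=0\})$, $E\cong\mathbb{P}^1\subset X^0$ the zero section, i.e. the exceptional locus (where $w_1=w_2=-1$), $\mathcal{O}_E(i)$ the degree $i$ line bundle on $E$. SYZ transform. Let $x_1=-\lambda_1$, $x_2=-\lambda_2$, $x_3$ be action coordinates on $B^{\mathrm{sm}}$, $\Lambda^\vee\subset T^*B^{\mathrm{sm}}$ the lattice generated by $dx_j$, $\xi_j$ fiber coordinates of $T^*B^{\mathrm{sm}}$, $y_j$ dual fiber coordinates on $TB^{\mathrm{sm}}$, $\Lambda\subset TB^{\mathrm{sm}}$ the dual lattice; use the fiber-preserving symplectomorphism $T^*B^{\mathrm{sm}}/\Lambda^\vee\cong\rho^{-1}(B^{\mathrm{sm}})$ taking the zero section to $L_0$. For contractible opens $U_i$ covering $B^{\mathrm{sm}}$, $X^0$ is obtained by gluing the pieces $TU_i/(TU_i\cap\Lambda)$,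 with complex coordinates $\exp2\pi(x_j+\sqrt{-1}y_j)$ (giving $w_1,w_2$ for $j=1,2$), by wall-crossing formulas $u=\zeta(1+w_1)$, $\zeta=v^{-1}(1+w_2)$ between charts with coordinates $(u,w_1,w_2)$, $(\zeta,w_1,w_2)$, $(v,w_1,w_2)$ corresponding to $r<|b|$, $|b|<r<|a|$, $r>|a|$, and extending by analytic continuation. For a Lagrangian cycle that is (the quotient by the lattice of) a translate of the conormal bundle of an integral affine subspace $S\subset B$, equipped with a flat $U(1)$-connection, the SYZ transform is the complex submanifold $C\subset X^0$ glued from the pieces $T(S\cap U_i)/(T(S\cap U_i)\cap\Lambda)$, placed in $X^0$ according to the holonomy of the connection, together with the holomorphic line bundle defined by the dual $U(1)$-connection on $C$. Here $L_\sigma$ lies over $(|b|,|a|)\times\{\vec0\}$ (away from its ends), and is equipped with the flat connection $d-\pi\sqrt{-1}(d\xi_1+d\xi_2)$; its transform is supported on $E$ and carries the connection $d+2\pi\sqrt{-1}\,\xi_3(x_3,\vec0)\,dy_3$, where the increment of the angle coordinate $\xi_3$ along $L_\sigma$ is measured relative to the reference path $\sigma_0$.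
   Formalization: ''|σ| strictly increasing'' for the reference path is taken as d|σ|/dt > 0 on [0,1]; if σ_0 is tangent to the circle |z|=|b| at b, the relative angle ξ_3 of S_1 can have a non-integer limit and its connection does not extend over E. *)

(* Defs.v *)
From Stdlib Require Import Reals ZArith.
From Coquelicot Require Import Coquelicot.

Open Scope R_scope.

(** * Smooth maps between real normed modules *)

(** Derivative of [f] at [p] in the direction [v]. *)
Definition dirR {V : NormedModule R_AbsRing} (f : V -> R) (p v : V) : R :=
  Derive (fun t : R => f (plus p (scal t v))) 0.

Definition dirC {V : NormedModule R_AbsRing} (f : V -> C) (p v : V) : C :=
  (dirR (fun q => Re (f q)) p v, dirR (fun q => Im (f q)) p v).

Fixpoint Ck {V W : NormedModule R_AbsRing} (n : nat) (U : V -> Prop) (f : V -> W)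
  : Prop :=
  match n with
  | O => forall x, U x -> continuous f x
  | S n' =>
      (forall x, U x -> ex_filterdiff f (locally x)) /\
      (forall v : V, exists g : V -> W,
          (forall x, U x ->
             is_derive (fun t : R => f (plus x (scal t v))) 0 (g x)) /\
          Ck n' U g)
  end.

(** C-infinity on [U]; only used for open [U]. *)
Definition smooth_on {V W : NormedModule R_AbsRing} (U : V -> Prop) (f : V -> W)
  : Prop := forall n, Ck n U f.

Definition is_open {V : UniformSpace} (U : V -> Prop) : Prop :=
  forall x, U x -> locally x U.

(** * Complex preliminaries *)

(** exp (x + i y) and exp (2 PI (x + i y)). *)
Definition cexp (x y : R) : C := (exp x * cos y, exp x * sin y).

Definition exp2pi (x y : R) : C := cexp (2 * PI * x) (2 * PI * y).

Definition zpow (z : C) (n : Z) : C :=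
  match n with
  | Z0 => 1%C
  | Zpos m => Cpow z (Pos.to_nat m)
  | Zneg m => Cinv (Cpow z (Pos.to_nat m))
  end.

Definition phase (z : C) : C := Cdiv z (RtoC (Cmod z)).

(** * The symplectic manifold Y^0 and its SYZ fibration *)

(** Points of, and tangent vectors to, the ambient space C x C^4. *)
Record amb : Type :=
  mkAmb { cz : C; cu1 : C; cv1 : C; cu2 : C; cv2 : C }.

Definition Y0 (a b : R) (y : amb) : Prop :=
  cz y <> 0%C /\
  (cu1 y * cv1 y = cz y - RtoC a)%C /\
  (cu2 y * cv2 y = cz y - RtoC b)%C.

(** [area V W] is the value of [dx /\ dy = (i/2) dz /\ dzbar] on [(V, W)]. *)
Definition area (V W : C) : R := Im (Cconj V * W)%C.

Definition omega (y V W : amb) : R :=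
  area (cz V) (cz W) / (Cmod (cz y)) ^ 2
  + area (cu1 V) (cu1 W) + area (cv1 V) (cv1 W)
  + area (cu2 V) (cu2 W) + area (cv2 V) (cv2 W).

(** Base points [(r, lambda_1, lambda_2)]; cotangent vectors to the base are
    triples of coefficients of [(dr, dlambda_1, dlambda_2)]. *)
Notation R3 := (R * R * R)%type.

Definition dot (p q : R3) : R :=
  fst (fst p) * fst (fst q) + snd (fst p) * snd (fst q) + snd p * snd q.

Definition rho (y : amb) : R3 :=
  (Cmod (cz y),
   / 2 * ((Cmod (cu1 y)) ^ 2 - (Cmod (cv1 y)) ^ 2),
   / 2 * ((Cmod (cu2 y)) ^ 2 - (Cmod (cv2 y)) ^ 2)).

Definition Bsm (a b : R) (p : R3) : Prop :=
  let '(r, l1, l2) := p in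
  0 < r /\ ~ (r = Rabs a /\ l1 = 0) /\ ~ (r = Rabs b /\ l2 = 0).

Definition pos_real (z : C) : Prop := 0 < Re z /\ Im z = 0.

Definition L0 (a b : R) (y : amb) : Prop :=
  Y0 a b y /\ pos_real (cz y) /\
  pos_real (cu1 y) /\ pos_real (cv1 y) /\ pos_real (cu2 y) /\ pos_real (cv2 y).

(** * Action-angle coordinates *)

(** The chamber |b| < r < |a|; it is contractible and avoids the discriminant. *)
Definition chamber (a b : R) (p : R3) : Prop :=
  Rabs b < fst (fst p) < Rabs a.

Definition grad (f : R3 -> R) (p : R3) : R3 :=
  (dirR f p (1, 0, 0), dirR f p (0, 1, 0), dirR f p (0, 0, 1)).

(** The cotangent vector [xi1 dx_1 + xi2 dx_2 + xi3 dx_3] at [p], where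
    [x_1 = - lambda_1] and [x_2 = - lambda_2]. *)
Definition cov (x3 : R3 -> R) (p : R3) (xi1 xi2 xi3 : R) : R3 :=
  let g := grad x3 p in
  (xi3 * fst (fst g), - xi1 + xi3 * snd (fst g), - xi2 + xi3 * snd g).

(** A map [T^* B^sm -> rho^{-1}(B^sm)] is given in curried form. *)
Definition uncur (Phi : R3 -> R3 -> amb) (p : R3 * R3) : amb :=
  Phi (fst p) (snd p).

Definition dPhi (Phi : R3 -> R3 -> amb) (p v : R3 * R3) : amb :=
  mkAmb (dirC (fun q => cz (uncur Phi q)) p v)
        (dirC (fun q => cu1 (uncur Phi q)) p v)
        (dirC (fun q => cv1 (uncur Phi q)) p v)
        (dirC (fun q => cu2 (uncur Phi q)) p v)
        (dirC (fun q => cv2 (uncur Phi q)) p v).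

(** [x3] completes [x_1], [x_2] to action coordinates on [V]: the periods of
    [Phi] form the lattice generated by [dx_1], [dx_2], [dx_3]. *)
Definition is_action_coord (Phi : R3 -> R3 -> amb) (V : R3 -> Prop)
  (x3 : R3 -> R) : Prop :=
  smooth_on V x3 /\
  forall p, V p -> forall al al' : R3,
    Phi p al = Phi p al' <->
    exists m1 m2 m3 : Z,
      minus al al' = cov x3 p (IZR m1) (IZR m2) (IZR m3).

(** [Phi] induces a fiber-preserving symplectomorphism from the quotient of
    [T^* B^sm] by the period lattice onto [rho^{-1}(B^sm)], taking the zero
    section to [L0].  The symplectic form of [T^* B^sm] is
    [sum_j dx_j /\ dxi_j] (equivalently [sum_i db_i /\ dalpha_i] for any
    coordinates [b_i] of the base).  The Hamiltonian flow of [lambda_j] on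
    [Y^0] has period [2 PI], so [dx_j] is a period for [omega / (2 PI)]; this
    is the origin of the factor [2 * PI]. *)
Record action_angle (a b : R) (Phi : R3 -> R3 -> amb) (x3 : R3 -> R) : Prop := {
  aa_Y0 : forall p, Bsm a b p -> forall al, Y0 a b (Phi p al);
  aa_rho : forall p, Bsm a b p -> forall al, rho (Phi p al) = p;
  aa_onto : forall y, Y0 a b y -> Bsm a b (rho y) ->
    exists al, Phi (rho y) al = y;
  aa_zero : forall p, Bsm a b p -> L0 a b (Phi p (0, 0, 0));
  aa_smooth : forall f : amb -> C,
    f = cz \/ f = cu1 \/ f = cv1 \/ f = cu2 \/ f = cv2 ->
    smooth_on (W := C_R_NormedModule)
      (fun q : R3 * R3 => Bsm a b (fst q)) (fun q => f (uncur Phi q));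
  aa_sympl : forall p : R3 * R3, Bsm a b (fst p) -> forall v w : R3 * R3,
    omega (uncur Phi p) (dPhi Phi p v) (dPhi Phi p w)
    = 2 * PI * (dot (fst v) (snd w) - dot (fst w) (snd v));
  aa_local : forall p, Bsm a b p -> exists (V : R3 -> Prop) (x : R3 -> R),
    is_open V /\ V p /\ (forall q, V q -> Bsm a b q) /\ is_action_coord Phi V x;
  aa_chamber : is_action_coord Phi (chamber a b) x3
}.

(** * Paths and Lagrangian spheres *)

Definition smooth_path (s : R -> C) : Prop :=
  forall n t, ex_derive_n (fun t => Re (s t)) n t /\
              ex_derive_n (fun t => Im (s t)) n t.

(** A smooth path on [[0,1]] is represented by a smooth extension to [R]. *)
Definition bounded_path (p q : R) (s : R -> C) : Prop :=
  smooth_path s /\ (forall t, 0 <= t <= 1 -> s t <> 0%C) /\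
  s 0 = RtoC p /\ s 1 = RtoC q.

Definition strongly_admissible (a b : R) (s : R -> C) : Prop :=
  bounded_path b a s /\
  (forall t, 0 <= t <= 1 -> 0 < Derive (fun t => Cmod (s t)) t) /\
  (forall t, 0 <= t <= 1 -> Im (s t) = 0 -> - b <= Re (s t) <= - a ->
     Derive (fun t => Im (s t)) t <> 0).

(** [th] is an argument along the path: it decreases by [2 PI] in total, and
    the path meets the positive real axis only once (transversally, by strong
    admissibility). *)
Definition reference_path (a b : R) (s : R -> C) : Prop :=
  strongly_admissible a b s /\
  (exists th : R -> R,
      (forall t, 0 <= t <= 1 -> continuous th t) /\
      (forall t, 0 <= t <= 1 ->
         s t = (RtoC (Cmod (s t)) * cexp 0 (th t))%C) /\
      th 1 - th 0 = - (2 * PI)) /\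
  (exists! t, 0 <= t <= 1 /\ pos_real (s t)).

Definition segment (p q : R) (t : R) : C := RtoC (p + t * (q - p)).

Definition Lsphere (a b : R) (s : R -> C) (y : amb) : Prop :=
  Y0 a b y /\ (exists t, 0 <= t <= 1 /\ cz y = s t) /\
  Cmod (cu1 y) = Cmod (cv1 y) /\ Cmod (cu2 y) = Cmod (cv2 y).

(** A Lagrangian cycle with the flat [U(1)]-connection
    [d - 2 PI i (hol1 dxi_1 + hol2 dxi_2)], whose holonomy along the [xi_j]
    circle is [exp (2 PI i hol_j)]. *)
Record brane : Type := mkBrane { cycle : amb -> Prop; hol1 : R; hol2 : R }.

Definition sphere_brane (a b : R) (s : R -> C) : brane :=
  mkBrane (Lsphere a b s) (/ 2) (/ 2).

(** * The mirror X^0 *)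

Inductive P1 : Type := aff (zeta : C) | infty.

(** [(s, t)] lies on the line in C^2 with homogeneous coordinate [s : t = p]. *)
Definition in_line (p : P1) (s t : C) : Prop :=
  match p with
  | aff zeta => s = (zeta * t)%C
  | infty => t = 0%C
  end.

Record Xamb : Type := mkX { xb : P1; xu : C; xv : C; xw1 : C; xw2 : C }.

(** Total space of two copies of the tautological bundle of P^1, with fiber
    coordinates [(u, 1 + w_1)] and [(1 + w_2, v)]; forgetting [xb] is the
    resolution of [u v = (1 + w_1) (1 + w_2)]. *)
Definition inX (q : Xamb) : Prop :=
  in_line (xb q) (xu q) (1 + xw1 q)%C /\ in_line (xb q) (1 + xw2 q)%C (xv q).

Definition inX0 (q : Xamb) : Prop := inX q /\ (xw1 q * xw2 q)%C <> 0%C.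

Definition onE (q : Xamb) : Prop :=
  inX q /\ xu q = 0%C /\ xv q = 0%C /\ xw1 q = (- (1))%C /\ xw2 q = (- (1))%C.

(** The chart [(zeta, w_1, w_2)] attached to the chamber, embedded by
    [u = zeta (1 + w_1)] and [zeta = v^{-1} (1 + w_2)]. *)
Definition chart (zeta w1 w2 : C) : Xamb :=
  mkX (aff zeta) (zeta * (1 + w1))%C ((1 + w2) / zeta)%C w1 w2.

(** The point of the chart with affine coordinates [x_j] and dual fiber
    coordinates [y_j]. *)
Definition chart_xy (x1 y1 x2 y2 x3 y3 : R) : Xamb :=
  chart (exp2pi x3 y3) (exp2pi x1 y1) (exp2pi x2 y2).

(** * Holomorphic line bundles on E = P^1 *)

Definition openP1 (V : P1 -> Prop) : Prop :=
  is_open (fun z : C => V (aff z)) /\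
  (V infty -> exists M : R, forall z : C, M < Cmod z -> V (aff z)).

(** Every fiber is identified with [C] by the choice of a basis vector
    (depending arbitrarily on the point), and the holomorphic structure is
    recorded by the sheaf of holomorphic sections: [L V s] says that [s] is a
    holomorphic section over the open set [V]. *)
Definition lineBundle : Type := (P1 -> Prop) -> (P1 -> C) -> Prop.

(** A fiberwise linear isomorphism is the multiplication by a nowhere zero
    function [h]; it is biholomorphic when it matches holomorphic sections. *)
Definition lb_iso (L L' : lineBundle) : Prop :=
  exists h : P1 -> C, (forall p, h p <> 0%C) /\
    forall V, openP1 V -> forall s : P1 -> C,
      L V s <-> L' V (fun p => (h p * s p)%C).

Definition Choldiff (f : C -> C) (z : C) : Prop :=
  ex_derive (K := C_AbsRing) (V := C_NormedModule) f z.

(** The function of [z] equal to [c] at the origin and to [f z] elsewhere. *)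
Definition at_zero (c : C) (f : C -> C) (z : C) : C :=
  if Ceq_dec z 0%C then c else f z.

(** O_E(k), glued from the two affine charts of P^1: a section corresponds to
    a function [f] on (part of) C^2 - 0, homogeneous of degree [k], with
    [s (aff z) = f (z, 1)] and [s infty = f (1, 0)]. *)
Definition OE (k : Z) : lineBundle := fun V s =>
  (forall z, V (aff z) -> Choldiff (fun z' => s (aff z')) z) /\
  (V infty ->
     Choldiff (at_zero (s infty) (fun e => (zpow e k * s (aff (/ e)%C))%C)) 0%C).

(** The line bundle on E with connection [nabla = d + 2 PI i F(x_3) dy_3] in a
    unitary frame [e] over [zeta = exp 2 PI (x_3 + i y_3)] in C - 0, where [F]
    is assumed to be equal to the integer [n0] near [zeta = 0] and to [ninf]
    near [zeta = infty].  There the connection is flat with trivial holonomy,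
    and the bundle is extended across the two points by the parallel frames
    [exp (- 2 PI i n y_3) e], [n = n0, ninf].  The value of a section is its
    coefficient in the frame [e] over C - 0, and in these parallel frames at
    the two remaining points.  Holomorphic sections are the solutions of
    [nabla^{0,1} s = 0], i.e. [nabla_{x_3} s + i nabla_{y_3} s = 0]. *)
Definition nabla_bundle (F : R -> R) (n0 ninf : Z) : lineBundle := fun V s =>
  (forall x y : R, V (aff (exp2pi x y)) ->
     exists sx sy : C,
       filterdiff (K := R_AbsRing)
         (U := C_R_NormedModule) (V := C_R_NormedModule)
         (fun p : C => s (aff (exp2pi (Re p) (Im p))))
         (locally (x, y))
         (fun h : C => (RtoC (Re h) * sx + RtoC (Im h) * sy)%C) /\
       (sx + Ci * (sy + RtoC (2 * PI * F x) * Ci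
                        * s (aff (exp2pi x y))))%C
       = 0%C) /\
  (V (aff 0%C) ->
     Choldiff (at_zero (s (aff 0%C)) (fun z => (zpow (phase z) n0 * s (aff z))%C))
       0%C) /\
  (V infty ->
     Choldiff (at_zero (s infty)
       (fun e => (zpow (phase e) (- ninf) * s (aff (/ e)%C))%C)) 0%C).

(** * The SYZ transform of a cycle lying over (|b|, |a|) x {0} *)

(** Over [S = (|b|, |a|) x {0}], which is the affine subspace
    [x_1 = x_2 = 0] of the chamber, [L] is the translate of the conormal bundle
    of [S] given by [xi_3 = f], [f] being viewed as a function of [r]. *)
Definition conormal_translate (a b : R) (Phi : R3 -> R3 -> amb) (x3 : R3 -> R)
  (L : amb -> Prop) (f : R -> R) : Prop :=
  (forall r, Rabs b < r < Rabs a -> continuous f r) /\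
  (forall r, Rabs b < r < Rabs a ->
     forall y, rho y = (r, 0, 0) ->
       (L y <-> exists xi1 xi2 : R,
           y = Phi (r, 0, 0) (cov x3 (r, 0, 0) xi1 xi2 (f r)))).

(** The submanifold glued from the pieces of [TS] modulo the lattice: here it
    lies in a single chart, [y_1] and [y_2] being fixed by the holonomy. *)
Definition syz_piece (a b : R) (x3 : R3 -> R) (S : brane) (q : Xamb) : Prop :=
  exists r y3 : R, Rabs b < r < Rabs a /\
    q = chart_xy 0 (hol1 S) 0 (hol2 S) (x3 (r, 0, 0)) y3.

(** Analytic continuation within the chart (C - 0)^3 of a curve contained in
    curves [w_1, w_2 = const]. *)
Definition continuation (A : Xamb -> Prop) (q : Xamb) : Prop :=
  exists zeta zeta' w1 w2 : C, zeta <> 0%C /\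
    A (chart zeta' w1 w2) /\ q = chart zeta w1 w2.

Definition closureX (A : Xamb -> Prop) (q : Xamb) : Prop :=
  forall (V : P1 -> Prop) (eps : R), openP1 V -> V (xb q) -> 0 < eps ->
    exists q', A q' /\ V (xb q') /\
      Cmod (xu q' - xu q)%C < eps /\ Cmod (xv q' - xv q)%C < eps /\
      Cmod (xw1 q' - xw1 q)%C < eps /\ Cmod (xw2 q' - xw2 q)%C < eps.

(** The line bundle of a transform supported on E is given on P^1, a point [p]
    of which is the point [(p, 0, 0, -1, -1)] of E. *)
Record transform : Type :=
  mkTransform { supp : Xamb -> Prop; bundle : lineBundle }.

(** [T] is the SYZ transform of [S], the angle [xi_3] being measured relative
    to the cycle over the path [s0]: on the annulus [xm < x_3 < xM] over the
    chamber the connection is [d + 2 PI i xi_3(x_3) dy_3], and it is flat on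
    the two complementary discs of E. *)
Definition is_syz_transform (a b : R) (Phi : R3 -> R3 -> amb) (x3 : R3 -> R)
  (s0 : R -> C) (S : brane) (T : transform) : Prop :=
  (forall q, supp T q <->
     inX0 q /\ closureX (continuation (syz_piece a b x3 S)) q) /\
  exists (f f0 : R -> R) (xm xM : R) (F : R -> R) (n0 ninf : Z),
    conormal_translate a b Phi x3 (cycle S) f /\
    conormal_translate a b Phi x3 (Lsphere a b s0) f0 /\
    (forall x, xm < x < xM <->
       exists r, Rabs b < r < Rabs a /\ x = x3 (r, 0, 0)) /\
    (forall r, Rabs b < r < Rabs a -> F (x3 (r, 0, 0)) = f r - f0 r) /\
    (forall x, continuous F x) /\
    (forall x, x <= xm -> F x = IZR n0) /\
    (forall x, xM <= x -> F x = IZR ninf) /\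
    bundle T = nabla_bundle F n0 ninf.

(** The SYZ transform of [S] exists and is the line bundle [M] on E. *)
Definition syz_transform_is (a b : R) (Phi : R3 -> R3 -> amb) (x3 : R3 -> R)
  (s0 : R -> C) (S : brane) (M : lineBundle) : Prop :=
  (exists T, is_syz_transform a b Phi x3 s0 S T) /\
  forall T, is_syz_transform a b Phi x3 s0 S T ->
    (forall q, supp T q <-> onE q) /\ lb_iso (bundle T) M.

(* Main.v *)
Require Import Defs.
From Stdlib Require Import Reals Ranalysis5 ZArith Lra Lia.
From Corelib Require Import ssreflect.
From Coquelicot Require Import Coquelicot.
Open Scope R_scope.

(** Put B(r, phi) for [flow_time] and T(r) = B(r, 2 PI) for [period].

    Over a point (r, 0, 0) with |b| < r < |a| the SYZ fiber is a 3-torus,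
    swept out by the 2-torus that rotates each pair (u_j, v_j) and by the
    circle |z| = r.  Pairing a vertical derivative of [Phi] with [omega] against
    all lifts of base vectors determines it ([vertical_dPhi]): the covectors
    dlambda_j rotate (u_j, v_j) at constant speed, and dr turns z
    counterclockwise with angular velocity 2 PI / (r W(z)), where W is the
    density of the symplectic form of the reduced space, the z-plane.  So the
    multiple of dr that turns z from the zero section, z > 0, by an angle phi is
    the integral B(r, phi) of r W / (2 PI) ([angle_flow]), and a full turn takes
    T(r).  The period lattice forces dx_3 / dr = e T(r) with a constant sign e
    ([x3_slope_period], [x3_slope_sign]).

    The sphere over a path s meets this fiber in the single 2-torus orbit with
    z = s(t), |s(t)| = r.  If theta is a continuous argument along s, it is
    therefore the translate xi_3 = f(r) exactly when e f(r) and
    B(r, theta) / T(r) differ by an integer ([conormal_translate_lift]).  At the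
    ends of the chamber W acquires a non-integrable pole at the angle PI, so T
    tends to infinity, while the path, being radially monotone, deviates from
    the negative axis by an angle of the order of the distance to the end,
    during which B changes by a bounded amount.  As B(r, phi) / T(r) is exactly
    phi / (2 PI) when phi is an odd multiple of PI, it tends to theta / (2 PI)
    at both ends ([path_lift]).  Subtracting the reference path gives a function
    F with integral values at the ends of the x_3-interval, which differ by the
    winding number w of s relative to the reference path.  The interval is
    bounded because the singularities of T are integrable ([x3_extends]).
    Replacing x_3 by its opposite also changes the sign of xi_3 and exchanges
    the two ends, so the sign e does not affect the outcome.

    On the mirror side, let G' = 2 PI F.  A section is holomorphic for
    d + 2 PI i F dy_3 when exp(-G) times it is a holomorphic function of zeta,
    and multiplication by zeta^n0 exp(-G) identifies the bundle with
    O(n0 - ninf), n0 and ninf being the values of F at the two ends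
    ([nabla_bundle_OE]).  So the transform over s is O(-w)
    ([syz_transform_of_path]); w is 0 for the reference path and 1 for the
    segment. *)

(** * Complex exponentials and polar form *)

Lemma Cmod_minus_sym z w : Cmod (z - w)%C = Cmod (w - z)%C.
Proof. replace (w - z)%C with (- (z - w))%C by ring. symmetry; apply Cmod_opp. Qed.

Lemma Cmod_sqr z : Cmod z ^ 2 = Re z ^ 2 + Im z ^ 2.
Proof.
unfold Cmod. rewrite pow2_sqrt; [reflexivity|].
generalize (pow2_ge_0 (fst z)) (pow2_ge_0 (snd z)); lra.
Qed.

Lemma Im_le_Cmod z : Rabs (Im z) <= Cmod z.
Proof. eapply Rle_trans; [apply Rmax_r | apply Rmax_Cmod]. Qed.

Lemma Cmod_le_Re_Im z : Cmod z <= Rabs (Re z) + Rabs (Im z).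
Proof.
assert (E : z = (RtoC (Re z) + Ci * RtoC (Im z))%C)
  by (apply injective_projections; simpl; unfold Re, Im; ring).
rewrite {1}E. eapply Rle_trans; [apply Cmod_triangle|].
rewrite Cmod_mult Cmod_Ci Rmult_1_l !Cmod_R. apply Rle_refl.
Qed.

Lemma cexp_neq_0 x y : cexp x y <> 0%C.
Proof.
unfold cexp. intro E. injection E; intros E2 E1.
generalize (exp_pos x) (sin2_cos2 y); unfold Rsqr; intros H1 H2.
apply Rmult_integral in E1; apply Rmult_integral in E2.
destruct E1 as [E1|E1], E2 as [E2|E2]; try lra.
rewrite E1 E2 in H2; lra.
Qed.

Lemma cexp_mult x y x' y' : (cexp x y * cexp x' y')%C = cexp (x + x') (y + y').
Proof.
unfold cexp. rewrite exp_plus cos_plus sin_plus.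
apply injective_projections; simpl; ring.
Qed.

Lemma cexp_0 : cexp 0 0 = 1%C.
Proof.
unfold cexp; rewrite exp_0 cos_0 sin_0. apply injective_projections; simpl; ring.
Qed.

Lemma cexp_inv x y : Cinv (cexp x y) = cexp (- x) (- y).
Proof.
assert (E : (cexp x y * cexp (- x) (- y) = 1)%C).
{ rewrite cexp_mult. rewrite !Rplus_opp_r. apply cexp_0. }
rewrite -(Cmult_1_r (/ cexp x y)%C) -E Cmult_assoc Cinv_l; try apply cexp_neq_0.
now rewrite Cmult_1_l.
Qed.

Lemma Cmod_cexp x y : Cmod (cexp x y) = exp x.
Proof.
unfold cexp, Cmod; simpl.
replace (_ + _) with ((exp x) ^ 2 * (sin y ^ 2 + cos y ^ 2)) by ring.
generalize (sin2_cos2 y); unfold Rsqr; intros H.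
replace (sin y ^ 2 + cos y ^ 2) with 1 by lra.
rewrite Rmult_1_r. apply sqrt_pow2. left; apply exp_pos.
Qed.

Lemma cexp_period x y (n : Z) : cexp x (y + 2 * PI * IZR n) = cexp x y.
Proof.
assert (N : forall (k : nat) t, cexp x (t + 2 * INR k * PI) = cexp x t).
{ intros k t; unfold cexp. now rewrite cos_period sin_period. }
destruct (Z.le_ge_cases 0 n) as [Hn|Hn].
- rewrite -(N (Z.to_nat n) y) INR_IZR_INZ Z2Nat.id; [f_equal; ring | exact Hn].
- rewrite -(N (Z.to_nat (- n)) (y + _)) INR_IZR_INZ Z2Nat.id; [|lia].
  rewrite opp_IZR. f_equal; ring.
Qed.

Lemma zpow_cexp x y n : zpow (cexp x y) n = cexp (IZR n * x) (IZR n * y).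
Proof.
assert (P : forall k : nat, Cpow (cexp x y) k = cexp (INR k * x) (INR k * y)).
{ induction k as [|k IH].
  - simpl. rewrite !Rmult_0_l. symmetry; apply cexp_0.
  - change (Cpow (cexp x y) (S k)) with (cexp x y * Cpow (cexp x y) k)%C.
    rewrite IH cexp_mult S_INR. f_equal; ring. }
destruct n as [|p|p]; simpl.
- rewrite !Rmult_0_l. symmetry; apply cexp_0.
- rewrite P INR_IZR_INZ positive_nat_Z. reflexivity.
- rewrite P INR_IZR_INZ positive_nat_Z cexp_inv.
  replace (Zneg p) with (- Zpos p)%Z by reflexivity. rewrite opp_IZR.
  f_equal; ring.
Qed.

Lemma phase_cexp x y : phase (cexp x y) = cexp 0 y.
Proof.
unfold phase. rewrite Cmod_cexp.
assert (H := exp_pos x). rewrite -[in RtoC _](Rplus_0_r (exp x)).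
assert (E : RtoC (exp x + 0) = cexp x 0).
{ unfold cexp; rewrite cos_0 sin_0. apply injective_projections; simpl; ring. }
rewrite E. unfold Cdiv. rewrite cexp_inv cexp_mult. f_equal; ring.
Qed.

Lemma unit_angle c s : c ^ 2 + s ^ 2 = 1 -> exists t, - PI <= t <= PI /\ c = cos t /\ s = sin t.
Proof.
intros H.
assert (Hc : -1 <= c <= 1) by nra.
destruct (acos_bound c) as [B1 B2].
destruct (Rle_dec 0 s) as [Hs|Hs].
- exists (acos c). split; [lra|]. rewrite cos_acos; [|lra].
  split; [reflexivity|]. rewrite sin_acos; [|lra].
  rewrite -(sqrt_Rsqr s Hs). f_equal. unfold Rsqr; lra.
- exists (- acos c). split; [lra|]. rewrite cos_neg sin_neg cos_acos; [|lra].
  split; [reflexivity|]. rewrite sin_acos; [|lra].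
  assert (Hs' : 0 <= - s) by lra.
  replace s with (- - s) by ring. f_equal.
  rewrite -(sqrt_Rsqr (- s) Hs'). f_equal. unfold Rsqr; lra.
Qed.

Lemma polar (z : C) : z <> 0%C -> exists t, - PI <= t <= PI /\ z = cexp (ln (Cmod z)) t.
Proof.
intros Hz. assert (P := proj1 (Cmod_gt_0 z) Hz). assert (S := Cmod_sqr z).
destruct (unit_angle (Re z / Cmod z) (Im z / Cmod z)) as [t [B [Ec Es]]].
{ field_simplify; [|lra]. rewrite S. field. rewrite -S. nra. }
exists t. split; [exact B|]. unfold cexp. rewrite exp_ln; [|exact P].
rewrite -Ec -Es. apply injective_projections; unfold Re, Im; simpl; field; lra.
Qed.

Lemma polar_exp2pi (z : C) : z <> 0%C -> exists y, z = exp2pi (ln (Cmod z) / (2 * PI)) y.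
Proof.
intros Hz. destruct (polar z Hz) as [t [_ E]]. exists (t / (2 * PI)).
unfold exp2pi. rewrite {1}E. assert (H := PI_RGT_0). f_equal; field; lra.
Qed.

(** * Real and complex differentials of functions of a complex variable *)

(** [fx] and [fy] are the partial derivatives.  The Cauchy-Riemann equations
    read [fy = Ci * fx] ([Choldiff_rdiff]), so that holomorphy can be tested on
    the same estimates as real differentiability. *)
Definition rdiff (f : C -> C) (z fx fy : C) : Prop :=
  forall eps : R, 0 < eps -> exists d : R, 0 < d /\ forall h : C, Cmod h < d ->
    Cmod (f (z + h) - f z - (RtoC (Re h) * fx + RtoC (Im h) * fy))%C <= eps * Cmod h.

Lemma locally_Cmod (z : C) (P : C -> Prop) :
  locally (T := C_UniformSpace) z P <->
  exists d, 0 < d /\ forall w, Cmod (w - z)%C < d -> P w.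
Proof.
split.
- intros H. apply locally_C in H. destruct H as [d Hd].
  exists d; split; [apply cond_pos|]. exact Hd.
- intros [d [Hd H]]. apply locally_C. exists (mkposreal d Hd). exact H.
Qed.

Lemma norm_C_R (x : C) : Cmod x = norm (V := C_R_NormedModule) x.
Proof. apply Cmod_norm. Qed.

Lemma rdiff_filterdiff f z fx fy :
  rdiff f z fx fy <->
  filterdiff (K := R_AbsRing) (U := C_R_NormedModule) (V := C_R_NormedModule)
    f (locally z) (fun h : C => (RtoC (Re h) * fx + RtoC (Im h) * fy)%C).
Proof.
split.
- intros H. split.
  + split.
    * intros x y. change (plus x y) with (x + y)%C. apply injective_projections;
        unfold Re, Im; simpl; unfold plus; simpl; ring.
    * intros k x. apply injective_projections;
        unfold Re, Im; simpl; unfold scal; simpl; unfold mult; simpl; ring.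
    * exists (Cmod fx + Cmod fy + 1). split.
      { generalize (Cmod_ge_0 fx) (Cmod_ge_0 fy); lra. }
      intros x. rewrite -!norm_C_R.
      eapply Rle_trans; [apply Cmod_triangle|]. rewrite !Cmod_mult !Cmod_R.
      generalize (re_le_Cmod x) (Im_le_Cmod x) (Cmod_ge_0 fx) (Cmod_ge_0 fy)
        (Cmod_ge_0 x) (Rabs_pos (Re x)) (Rabs_pos (Im x)). nra.
  + intros x Hx.
    apply (is_filter_lim_locally_unique (V := C_R_NormedModule)) in Hx. subst x.
    intros eps. destruct (H eps (cond_pos eps)) as [d [Hd Hh]].
    apply locally_Cmod. exists d; split; [exact Hd|]. intros w Hw.
    specialize (Hh (w - z)%C Hw).
    replace (z + (w - z))%C with w in Hh by ring. rewrite -!norm_C_R. exact Hh.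
- intros [_ H] eps Heps.
  specialize (H z (fun P HP => HP) (mkposreal eps Heps)).
  apply locally_Cmod in H. destruct H as [d [Hd H]]. exists d; split; [exact Hd|].
  intros h Hh. specialize (H (z + h)%C).
  replace (z + h - z)%C with h in H by ring. specialize (H Hh).
  rewrite -!norm_C_R in H.
  change (minus (z + h)%C z) with (z + h - z)%C in H.
  replace (z + h - z)%C with h in H by ring. exact H.
Qed.

Lemma Choldiff_rdiff f z : Choldiff f z <-> exists l, rdiff f z l (Ci * l)%C.
Proof.
assert (E : forall h l : C, (RtoC (Re h) * l + RtoC (Im h) * (Ci * l) = h * l)%C).
{ intros h l. apply injective_projections; unfold Re, Im; simpl; ring. }
split.
- intros [l [_ H]]. exists l. intros eps Heps.
  specialize (H z (fun P HP => HP) (mkposreal eps Heps)).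
  apply locally_C, locally_Cmod in H. destruct H as [d [Hd H]].
  exists d; split; [exact Hd|].
  intros h Hh. specialize (H (z + h)%C).
  replace (z + h - z)%C with h in H by ring. specialize (H Hh).
  rewrite E.
  change (Cmod (f (z + h) - f z - (z + h - z) * l)%C <= eps * Cmod (z + h - z)%C) in H.
  replace (z + h - z)%C with h in H by ring. exact H.
- intros [l H]. exists l. split; [apply is_linear_scal_l|].
  intros x Hx. apply (is_filter_lim_locally_unique (V := AbsRing_NormedModule C_AbsRing)) in Hx.
  subst x. intros eps. destruct (H eps (cond_pos eps)) as [d [Hd Hh]].
  apply locally_C, locally_Cmod. exists d; split; [exact Hd|]. intros w Hw.
  specialize (Hh (w - z)%C Hw). rewrite E in Hh.
  replace (z + (w - z))%C with w in Hh by ring. exact Hh.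
Qed.

Lemma rdiff_ext_loc f g z fx fy :
  (exists d, 0 < d /\ forall w, Cmod (w - z)%C < d -> f w = g w) ->
  rdiff f z fx fy -> rdiff g z fx fy.
Proof.
intros [d0 [Hd0 E]] H eps Heps. destruct (H eps Heps) as [d [Hd Hh]].
exists (Rmin d d0); split; [now apply Rmin_pos|].
intros h H'. rewrite -!E.
- apply Hh. eapply Rlt_le_trans; [exact H'|apply Rmin_l].
- replace (z - z)%C with (RtoC 0) by ring. now rewrite Cmod_0.
- replace (z + h - z)%C with h by ring. eapply Rlt_le_trans; [exact H'|apply Rmin_r].
Qed.

Lemma Choldiff_ext_loc f g z :
  (exists d, 0 < d /\ forall w, Cmod (w - z)%C < d -> f w = g w) ->
  Choldiff f z -> Choldiff g z.
Proof.
intros E H. apply Choldiff_rdiff. apply Choldiff_rdiff in H. destruct H as [l H].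
exists l. exact (rdiff_ext_loc f g z _ _ E H).
Qed.

Lemma rdiff_lip f z fx fy : rdiff f z fx fy ->
  exists K d, 0 < K /\ 0 < d /\ forall h, Cmod h < d -> Cmod (f (z + h) - f z)%C <= K * Cmod h.
Proof.
intros H. destruct (H 1 Rlt_0_1) as [d [Hd Hh]].
exists (1 + Cmod fx + Cmod fy), d.
assert (Px := Cmod_ge_0 fx); assert (Py := Cmod_ge_0 fy).
split; [lra|]. split; [exact Hd|]. intros h H'. specialize (Hh h H').
replace (f (z + h) - f z)%C with
  ((f (z + h) - f z - (RtoC (Re h) * fx + RtoC (Im h) * fy))
   + (RtoC (Re h) * fx + RtoC (Im h) * fy))%C by ring.
eapply Rle_trans; [apply Cmod_triangle|].
assert (L : Cmod (RtoC (Re h) * fx + RtoC (Im h) * fy)%C <= (Cmod fx + Cmod fy) * Cmod h).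
{ eapply Rle_trans; [apply Cmod_triangle|]. rewrite !Cmod_mult !Cmod_R.
  generalize (re_le_Cmod h) (Im_le_Cmod h). nra. }
lra.
Qed.

Lemma rdiff_plus f g z fx fy gx gy :
  rdiff f z fx fy -> rdiff g z gx gy ->
  rdiff (fun w => f w + g w)%C z (fx + gx)%C (fy + gy)%C.
Proof.
intros Hf Hg eps Heps.
destruct (Hf (eps / 2)) as [d1 [Hd1 H1]]; [lra|].
destruct (Hg (eps / 2)) as [d2 [Hd2 H2]]; [lra|].
exists (Rmin d1 d2); split; [now apply Rmin_pos|]. intros h Hh.
specialize (H1 h (Rlt_le_trans _ _ _ Hh (Rmin_l _ _))).
specialize (H2 h (Rlt_le_trans _ _ _ Hh (Rmin_r _ _))).
match goal with |- Cmod ?x <= _ => replace x with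
 ((f (z + h) - f z - (RtoC (Re h) * fx + RtoC (Im h) * fy)) +
  (g (z + h) - g z - (RtoC (Re h) * gx + RtoC (Im h) * gy)))%C by ring end.
eapply Rle_trans; [apply Cmod_triangle|]. lra.
Qed.

Lemma rdiff_mult f g z fx fy gx gy :
  rdiff f z fx fy -> rdiff g z gx gy ->
  rdiff (fun w => f w * g w)%C z (fx * g z + f z * gx)%C (fy * g z + f z * gy)%C.
Proof.
intros Hf Hg eps Heps.
destruct (rdiff_lip _ _ _ _ Hf) as [K1 [d3 [HK1 [Hd3 L1]]]].
destruct (rdiff_lip _ _ _ _ Hg) as [K2 [d4 [HK2 [Hd4 L2]]]].
set (A := Cmod (f z) + 1). set (B := Cmod (g z) + 1).
assert (HA : 0 < A) by (unfold A; generalize (Cmod_ge_0 (f z)); lra).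
assert (HB : 0 < B) by (unfold B; generalize (Cmod_ge_0 (g z)); lra).
destruct (Hf (eps / 3 / B)) as [d1 [Hd1 H1]]; [repeat apply Rdiv_lt_0_compat; lra|].
destruct (Hg (eps / 3 / A)) as [d2 [Hd2 H2]]; [repeat apply Rdiv_lt_0_compat; lra|].
assert (Hd5 : 0 < eps / 3 / (K1 * K2)).
{ repeat apply Rdiv_lt_0_compat; try lra. nra. }
exists (Rmin (Rmin d1 d2) (Rmin (Rmin d3 d4) (eps / 3 / (K1 * K2)))).
split; [repeat apply Rmin_pos; assumption|]. intros h Hh.
assert (M : Cmod h < d1 /\ Cmod h < d2 /\ Cmod h < d3 /\ Cmod h < d4 /\
  Cmod h < eps / 3 / (K1 * K2)).
{ revert Hh. unfold Rmin; repeat destruct Rle_dec; lra. }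
destruct M as [M1 [M2 [M3 [M4 M5]]]].
specialize (H1 h M1). specialize (H2 h M2). specialize (L1 h M3). specialize (L2 h M4).
match goal with |- Cmod ?x <= _ => replace x with
 ((f (z + h) - f z - (RtoC (Re h) * fx + RtoC (Im h) * fy)) * g z +
  f z * (g (z + h) - g z - (RtoC (Re h) * gx + RtoC (Im h) * gy)) +
  (f (z + h) - f z) * (g (z + h) - g z))%C by ring end.
eapply Rle_trans; [apply Cmod_triangle|].
eapply Rle_trans; [apply Rplus_le_compat_r, Cmod_triangle|]. rewrite !Cmod_mult.
assert (P := Cmod_ge_0 h).
set (X := Cmod (f (z + h) - f z - _)%C) in *.
set (Y := Cmod (g (z + h) - g z - _)%C) in *.
set (U := Cmod (f (z + h) - f z)%C) in *.
set (V := Cmod (g (z + h) - g z)%C) in *.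
assert (PX : 0 <= X) by apply Cmod_ge_0. assert (PY : 0 <= Y) by apply Cmod_ge_0.
assert (PU : 0 <= U) by apply Cmod_ge_0. assert (PV : 0 <= V) by apply Cmod_ge_0.
assert (T1 : X * Cmod (g z) <= eps / 3 * Cmod h).
{ apply Rle_trans with (X * B); [apply Rmult_le_compat_l; [lra|unfold B; lra]|].
  apply Rle_trans with (eps / 3 / B * Cmod h * B); [apply Rmult_le_compat_r; lra|].
  apply Req_le. field. lra. }
assert (T2 : Cmod (f z) * Y <= eps / 3 * Cmod h).
{ apply Rle_trans with (A * Y); [apply Rmult_le_compat_r; [lra|unfold A; lra]|].
  apply Rle_trans with (A * (eps / 3 / A * Cmod h)); [apply Rmult_le_compat_l; lra|].
  apply Req_le. field. lra. }
assert (T3 : U * V <= eps / 3 * Cmod h).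
{ apply Rle_trans with ((K1 * Cmod h) * (K2 * Cmod h)); [apply Rmult_le_compat; lra|].
  replace (K1 * Cmod h * (K2 * Cmod h)) with (K1 * K2 * Cmod h * Cmod h) by ring.
  apply Rmult_le_compat_r; [lra|].
  apply Rle_trans with (K1 * K2 * (eps / 3 / (K1 * K2))).
  - apply Rmult_le_compat_l; nra.
  - apply Req_le. field. lra. }
lra.
Qed.

Lemma is_derive_eps (f : R -> R) x l : is_derive f x l ->
  forall eps, 0 < eps -> exists d, 0 < d /\ forall h, Rabs h < d ->
    Rabs (f (x + h) - f x - h * l) <= eps * Rabs h.
Proof.
intros [_ H] eps Heps. specialize (H x (fun P HP => HP) (mkposreal eps Heps)).
destruct H as [d Hd]. exists d; split; [apply cond_pos|]. intros h Hh.
assert (Eh : minus (x + h) x = h).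
{ unfold minus, plus, opp; simpl; ring. }
specialize (Hd (x + h)). 
assert (B : ball x d (x + h)).
{ change (Rabs (minus (x + h) x) < d). now rewrite Eh. }
specialize (Hd B). simpl in Hd. rewrite Eh in Hd. exact Hd.
Qed.

Lemma rdiff_Re (f : R -> R) z l : is_derive f (Re z) l ->
  rdiff (fun w => RtoC (f (Re w))) z (RtoC l) 0%C.
Proof.
intros H eps Heps. destruct (is_derive_eps _ _ _ H eps Heps) as [d [Hd Hh]].
exists d; split; [exact Hd|]. intros h H'.
assert (R := re_le_Cmod h). specialize (Hh (Re h) (Rle_lt_trans _ _ _ R H')).
replace (RtoC (f (Re (z + h)%C)) - RtoC (f (Re z)) - (RtoC (Re h) * RtoC l + RtoC (Im h) * 0))%C
  with (RtoC (f (Re z + Re h) - f (Re z) - Re h * l)).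
- rewrite Cmod_R. eapply Rle_trans; [exact Hh|]. apply Rmult_le_compat_l; lra.
- apply injective_projections; simpl; unfold Re, Im; simpl; ring.
Qed.

Lemma rdiff_Im (f : R -> R) z l : is_derive f (Im z) l ->
  rdiff (fun w => RtoC (f (Im w))) z 0%C (RtoC l).
Proof.
intros H eps Heps. destruct (is_derive_eps _ _ _ H eps Heps) as [d [Hd Hh]].
exists d; split; [exact Hd|]. intros h H'.
assert (R := Im_le_Cmod h). specialize (Hh (Im h) (Rle_lt_trans _ _ _ R H')).
replace (RtoC (f (Im (z + h)%C)) - RtoC (f (Im z)) - (RtoC (Re h) * 0 + RtoC (Im h) * RtoC l))%C
  with (RtoC (f (Im z + Im h) - f (Im z) - Im h * l)).
- rewrite Cmod_R. eapply Rle_trans; [exact Hh|]. apply Rmult_le_compat_l; lra.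
- apply injective_projections; simpl; unfold Re, Im; simpl; ring.
Qed.

Lemma rdiff_const c z : rdiff (fun _ => c) z 0%C 0%C.
Proof.
intros eps Heps. exists 1; split; [lra|]. intros h _.
replace (c - c - (RtoC (Re h) * 0 + RtoC (Im h) * 0))%C with (RtoC 0) by ring.
rewrite Cmod_0. generalize (Cmod_ge_0 h); nra.
Qed.

Lemma rdiff_cexp (A : R -> R) (k : R) z l : is_derive A (Re z) l ->
  rdiff (fun w => cexp (A (Re w)) (k * Im w)) z
    (RtoC l * cexp (A (Re z)) (k * Im z))%C (Ci * RtoC k * cexp (A (Re z)) (k * Im z))%C.
Proof.
intros HA.
assert (H1 := rdiff_Re (fun x => exp (A x)) z (l * exp (A (Re z)))).
assert (H2 := rdiff_Im (fun y => cos (k * y)) z (- k * sin (k * Im z))).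
assert (H3 := rdiff_Im (fun y => sin (k * y)) z (k * cos (k * Im z))).
assert (D1 : is_derive (fun x => exp (A x)) (Re z) (l * exp (A (Re z)))).
{ apply (is_derive_comp exp A); [apply is_derive_exp | exact HA]. }
specialize (H1 D1).
assert (D2 : is_derive (fun y => cos (k * y)) (Im z) (- k * sin (k * Im z))).
{ auto_derive; [exact I|ring]. }
assert (D3 : is_derive (fun y => sin (k * y)) (Im z) (k * cos (k * Im z))).
{ auto_derive; [exact I|ring]. }
specialize (H2 D2); specialize (H3 D3).
assert (H := rdiff_mult _ _ _ _ _ _ _ H1
  (rdiff_plus _ _ _ _ _ _ _ H2 (rdiff_mult _ _ _ _ _ _ _ (rdiff_const Ci z) H3))).
assert (E : forall w : C, (RtoC (exp (A (Re w))) * (RtoC (cos (k * Im w)) + Ci * RtoC (sin (k * Im w)))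
  = cexp (A (Re w)) (k * Im w))%C).
{ intros w; unfold cexp; apply injective_projections; simpl; ring. }
match type of H with rdiff _ _ ?x ?y =>
  replace (RtoC l * cexp (A (Re z)) (k * Im z))%C with x;
  [replace (Ci * RtoC k * cexp (A (Re z)) (k * Im z))%C with y|] end.
- eapply rdiff_ext_loc; [|exact H]. exists 1; split; [lra|]. intros w _. apply E.
- unfold cexp; apply injective_projections; simpl; ring.
- unfold cexp; apply injective_projections; simpl; ring.
Qed.

Definition Cdiff (f : C -> C) (z l : C) : Prop :=
  forall eps : R, 0 < eps -> exists d : R, 0 < d /\ forall h : C, Cmod h < d ->
    Cmod (f (z + h) - f z - h * l)%C <= eps * Cmod h.

Lemma rdiff_Cdiff f z l : rdiff f z l (Ci * l)%C <-> Cdiff f z l.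
Proof.
assert (E : forall h : C, (RtoC (Re h) * l + RtoC (Im h) * (Ci * l) = h * l)%C).
{ intros h. apply injective_projections; unfold Re, Im; simpl; ring. }
split; intros H eps Heps; destruct (H eps Heps) as [d [Hd Hh]]; exists d;
 (split; [exact Hd|]); intros h H'; specialize (Hh h H'); rewrite E in Hh || rewrite E; exact Hh.
Qed.

Lemma Choldiff_Cdiff f z : Choldiff f z <-> exists l, Cdiff f z l.
Proof.
split; intros H.
- apply Choldiff_rdiff in H. destruct H as [l H]; exists l; now apply rdiff_Cdiff.
- apply Choldiff_rdiff. destruct H as [l H]; exists l; now apply rdiff_Cdiff.
Qed.

Lemma Cdiff_comp k e p l m : Cdiff k (e p) l -> Cdiff e p m ->
  Cdiff (fun q => k (e q)) p (m * l)%C.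
Proof.
intros Hk He eps Heps.
destruct (rdiff_lip _ _ _ _ (proj2 (rdiff_Cdiff _ _ _) He)) as [K [d1 [HK [Hd1 L]]]].
assert (Pl := Cmod_ge_0 l).
destruct (Hk (eps / 2 / K)) as [d2 [Hd2 H2]]; [repeat apply Rdiv_lt_0_compat; lra|].
destruct (He (eps / 2 / (Cmod l + 1))) as [d3 [Hd3 H3]]; [repeat apply Rdiv_lt_0_compat; lra|].
exists (Rmin d1 (Rmin d3 (d2 / K))).
split; [repeat apply Rmin_pos; try assumption; now apply Rdiv_lt_0_compat|].
intros h Hh.
assert (M : Cmod h < d1 /\ Cmod h < d3 /\ Cmod h < d2 / K).
{ revert Hh. unfold Rmin; repeat destruct Rle_dec; lra. }
destruct M as [M1 [M3 M2]]. specialize (L h M1). specialize (H3 h M3).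
set (eta := (e (p + h) - e p)%C) in *.
assert (Heta : Cmod eta < d2).
{ eapply Rle_lt_trans; [exact L|].
  apply Rlt_le_trans with (K * (d2 / K)); [now apply Rmult_lt_compat_l|].
  apply Req_le; field; lra. }
specialize (H2 eta Heta).
replace (e p + eta)%C with (e (p + h)%C) in H2 by (unfold eta; ring).
match goal with |- Cmod ?x <= _ => replace x with
  ((k (e (p + h)) - k (e p) - eta * l) + (eta - h * m) * l)%C by ring end.
eapply Rle_trans; [apply Cmod_triangle|]. rewrite Cmod_mult.
assert (Ph := Cmod_ge_0 h).
assert (T1 : eps / 2 / K * Cmod eta <= eps / 2 * Cmod h).
{ apply Rle_trans with (eps / 2 / K * (K * Cmod h)).
  - apply Rmult_le_compat_l; [|lra]. left; repeat apply Rdiv_lt_0_compat; lra.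
  - apply Req_le; field; lra. }
assert (T2 : Cmod (eta - h * m)%C * Cmod l <= eps / 2 * Cmod h).
{ apply Rle_trans with (eps / 2 / (Cmod l + 1) * Cmod h * (Cmod l + 1)).
  - apply Rmult_le_compat; try lra; apply Cmod_ge_0.
  - apply Req_le; field; lra. }
lra.
Qed.

(** Continuity of the right inverse [l] suffices: the differential of [e] is
    invertible, so increments of [l] are bounded by those of its argument. *)
Lemma Cdiff_inverse e l p m :
  Cdiff e p m -> m <> 0%C ->
  (exists d, 0 < d /\ forall h, Cmod h < d -> e (l (e p + h)%C) = (e p + h)%C) ->
  l (e p) = p ->
  (forall eps, 0 < eps -> exists d, 0 < d /\ forall h, Cmod h < d ->
     Cmod (l (e p + h)%C - p)%C < eps) ->
  Cdiff l (e p) (/ m)%C.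
Proof.
intros He Hm [d1 [Hd1 H1]] Hp Hc eps Heps.
assert (Pm := proj1 (Cmod_gt_0 m) Hm).
set (e1 := Rmin (Cmod m / 2) (eps * Cmod m ^ 2 / 2)).
assert (He1 : 0 < e1). { apply Rmin_pos; [lra|]. assert (0 < Cmod m ^ 2) by (apply pow_lt; lra). nra. }
assert (B1 : e1 <= Cmod m / 2) by apply Rmin_l.
assert (B2 : e1 <= eps * Cmod m ^ 2 / 2) by apply Rmin_r.
destruct (He e1 He1) as [d2 [Hd2 H2]].
destruct (Hc d2 Hd2) as [d3 [Hd3 H3]].
exists (Rmin d1 d3); split; [now apply Rmin_pos|]. intros h Hh.
specialize (H1 h (Rlt_le_trans _ _ _ Hh (Rmin_l _ _))).
specialize (H3 h (Rlt_le_trans _ _ _ Hh (Rmin_r _ _))).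
rewrite Hp. set (eta := (l (e p + h) - p)%C) in *.
specialize (H2 eta H3).
replace (p + eta)%C with (l (e p + h)%C) in H2 by (unfold eta; ring).
rewrite H1 in H2. replace (e p + h - e p - eta * m)%C with (h - eta * m)%C in H2 by ring.
replace (eta - h * / m)%C with (- (h - eta * m) * / m)%C by (field; exact Hm).
rewrite Cmod_mult Cmod_opp Cmod_inv; [|exact Hm].
assert (T : Cmod eta * Cmod m <= 2 * Cmod h).
{ assert (Cmod (eta * m)%C <= Cmod h + Cmod (h - eta * m)%C).
  { assert (T := Cmod_triangle h (- (h - eta * m))%C). rewrite Cmod_opp in T.
    now replace (h + - (h - eta * m))%C with (eta * m)%C in T by ring. }
  rewrite Cmod_mult in H.
  assert (e1 * Cmod eta <= Cmod m / 2 * Cmod eta) by (apply Rmult_le_compat_r; [apply Cmod_ge_0|lra]).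
  lra. }
apply Rmult_le_reg_r with (Cmod m); [exact Pm|].
rewrite Rmult_assoc Rinv_l; [|lra]. rewrite Rmult_1_r.
eapply Rle_trans; [exact H2|].
apply Rmult_le_reg_r with (Cmod m); [exact Pm|].
assert (Ph := Cmod_ge_0 h).
apply Rle_trans with (e1 * (2 * Cmod h)).
- rewrite Rmult_assoc. apply Rmult_le_compat_l; lra.
- apply Rle_trans with (eps * Cmod m ^ 2 / 2 * (2 * Cmod h)); [|apply Req_le; field].
  apply Rmult_le_compat_r; lra.
Qed.

Lemma cexp_log w : 0 < Re w -> cexp (ln (Cmod w)) (atan (Im w / Re w)) = w.
Proof.
intros Hw. assert (Hz : w <> 0%C). { intros E; rewrite E in Hw; simpl in Hw; lra. }
assert (P := proj1 (Cmod_gt_0 w) Hz).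
unfold cexp. rewrite exp_ln; [|exact P]. rewrite cos_atan sin_atan.
assert (E : sqrt (1 + (Im w / Re w)²) = Cmod w / Re w).
{ rewrite -(sqrt_Rsqr (Cmod w / Re w)); [|left; now apply Rdiv_lt_0_compat].
  f_equal. unfold Rsqr. generalize (Cmod_sqr w). intros S.
  field_simplify; [|lra|lra]. f_equal. lra. }
rewrite E. apply injective_projections; unfold Re, Im in *; simpl; field; lra.
Qed.

Lemma ln_le_minus_1 x : 0 < x -> ln x <= x - 1.
Proof.
intros H. generalize (exp_ineq1_le (ln x)). rewrite exp_ln; lra.
Qed.

(** Only continuity of the logarithm is shown here; its holomorphy follows from
    [Cdiff_inverse]. *)
Lemma local_log (p : C) : exists l : C -> C,
  (exists d, 0 < d /\ forall h, Cmod h < d ->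
     exp2pi (Re (l (exp2pi (Re p) (Im p) + h)%C)) (Im (l (exp2pi (Re p) (Im p) + h)%C))
     = (exp2pi (Re p) (Im p) + h)%C) /\
  l (exp2pi (Re p) (Im p)) = p /\
  (forall eps, 0 < eps -> exists d, 0 < d /\ forall h, Cmod h < d ->
     Cmod (l (exp2pi (Re p) (Im p) + h)%C - p)%C < eps).
Proof.
set (z0 := exp2pi (Re p) (Im p)).
assert (Hz0 : z0 <> 0%C) by apply cexp_neq_0.
assert (Pz0 := proj1 (Cmod_gt_0 z0) Hz0).
assert (Ppi := PI_RGT_0).
set (l := fun z : C => (p + ((ln (Cmod (z / z0)%C) / (2 * PI))%R,
   (atan (Im (z / z0)%C / Re (z / z0)%C) / (2 * PI))%R))%C).
assert (W : forall h, ((z0 + h) / z0 = 1 + h / z0)%C) by (intros; field; exact Hz0).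
assert (Near : forall h eta, eta <= 1 / 2 -> Cmod h < eta * Cmod z0 ->
   exists w, ((z0 + h) / z0)%C = w /\ 1 - eta < Cmod w < 1 + eta /\
     1 - eta < Re w /\ Rabs (Im w) < eta).
{ intros h eta He Hh. exists (1 + h / z0)%C. split; [apply W|].
  assert (B : Cmod (h / z0)%C < eta).
  { unfold Cdiv. rewrite Cmod_mult Cmod_inv; [|exact Hz0].
    apply Rmult_lt_reg_r with (Cmod z0); [exact Pz0|].
    rewrite Rmult_assoc Rinv_l; lra. }
  set (k := (h / z0)%C) in *.
  assert (B1 := re_le_Cmod k). assert (B2 := Im_le_Cmod k).
  assert (B3 := Cmod_triangle 1 k). rewrite Cmod_1 in B3.
  assert (B4 := Cmod_triangle (1 + k) (- k)). rewrite Cmod_opp in B4.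
  replace (1 + k + - k)%C with (RtoC 1) in B4 by ring. rewrite Cmod_1 in B4.
  unfold Re, Im in *; simpl in *.
  repeat split; try lra.
  - revert B1; unfold Rabs; destruct Rcase_abs; lra.
  - rewrite Rplus_0_l. lra. }
exists l. split; [|split].
- exists (1 / 2 * Cmod z0); split; [lra|]. intros h Hh.
  destruct (Near h (1 / 2) ltac:(lra) Hh) as [w [Ew [_ [Bw _]]]].
  unfold l. rewrite Ew. unfold exp2pi. simpl.
  replace (2 * PI * (fst p + ln (Cmod w) / (2 * PI))) with (2 * PI * Re p + ln (Cmod w))
    by (unfold Re; field; lra).
  replace (2 * PI * (snd p + atan (Im w / Re w) / (2 * PI))) with
    (2 * PI * Im p + atan (Im w / Re w)) by (unfold Im; field; lra).
  rewrite -cexp_mult cexp_log; [|lra]. 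
  change (z0 * w = z0 + h)%C. rewrite -Ew. field. exact Hz0.
- unfold l. replace (z0 / z0)%C with (RtoC 1) by (field; exact Hz0).
  rewrite Cmod_1 ln_1. simpl. replace (0 / 1) with 0 by field. rewrite atan_0.
  replace (0 / (2 * PI)) with 0 by (field; lra).
  apply injective_projections; simpl; ring.
- intros eps Heps.
  destruct (derivable_continuous_pt atan 0 (derivable_pt_atan 0) (eps / 2)) as [d [Hd Ha]]; [lra|].
  simpl in Ha; unfold Rdist in Ha.
  set (eta := Rmin (1 / 2) (Rmin (eps / 2) (d / 2))).
  assert (E1 : eta <= 1 / 2) by apply Rmin_l.
  assert (E2 : eta <= eps / 2) by (eapply Rle_trans; [apply Rmin_r|apply Rmin_l]).
  assert (E3 : eta <= d / 2) by (eapply Rle_trans; [apply Rmin_r|apply Rmin_r]).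
  assert (E0 : 0 < eta) by (repeat apply Rmin_pos; lra).
  exists (eta * Cmod z0); split; [nra|]. intros h Hh.
  destruct (Near h eta E1 Hh) as [w [Ew [Bw [Bw1 Bw2]]]].
  unfold l. rewrite Ew.
  match goal with |- Cmod ?x < _ => replace x with
    ((ln (Cmod w) / (2 * PI), atan (Im w / Re w) / (2 * PI)) : C)
    by (apply injective_projections; simpl; ring) end.
  eapply Rle_lt_trans; [apply Cmod_le_Re_Im|]. simpl.
  assert (L1 : Rabs (ln (Cmod w)) <= 2 * eta).
  { assert (U := ln_le_minus_1 (Cmod w)). assert (V := ln_le_minus_1 (/ Cmod w)).
    rewrite ln_Rinv in V; [|lra].
    assert (/ Cmod w - 1 <= 2 * eta).
    { apply Rmult_le_reg_r with (Cmod w); [lra|]. rewrite Rmult_minus_distr_r Rinv_l; [nra|lra]. }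
    assert (0 < / Cmod w) by (apply Rinv_0_lt_compat; lra).
    apply Rabs_le; lra. }
  assert (L2 : Rabs (atan (Im w / Re w)) < eps / 2).
  { destruct (Req_dec (Im w / Re w) 0) as [Z|Z].
    - rewrite Z atan_0 Rabs_R0. lra.
    - specialize (Ha (Im w / Re w)). rewrite atan_0 !Rminus_0_r in Ha. apply Ha.
      split; [split; [exact I|auto]|].
      unfold Rdiv. rewrite Rabs_mult Rabs_inv (Rabs_pos_eq (Re w)); [|lra].
      apply Rmult_lt_reg_r with (Re w); [lra|]. rewrite Rmult_assoc Rinv_l; [nra|lra]. }
  unfold Rdiv. rewrite !Rabs_mult Rabs_inv (Rabs_pos_eq (2 * PI)); [|lra].
  assert (P2 : / (2 * PI) < / 4).
  { apply Rinv_lt_contravar; generalize PI2_1; nra. }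
  assert (0 < / (2 * PI)) by (apply Rinv_0_lt_compat; lra).
  assert (Rabs (ln (Cmod w)) * / (2 * PI) <= (2 * eta) * / 4).
  { apply Rmult_le_compat; try lra. apply Rabs_pos. }
  assert (Rabs (atan (Im w / Re w)) * / (2 * PI) <= (eps / 2) * / 4).
  { apply Rmult_le_compat; try lra. apply Rabs_pos. }
  lra.
Qed.

Lemma Cdiff_exp2pi p : Cdiff (fun q => exp2pi (Re q) (Im q)) p
   (RtoC (2 * PI) * exp2pi (Re p) (Im p))%C.
Proof.
apply rdiff_Cdiff. unfold exp2pi.
assert (H := rdiff_cexp (fun x => 2 * PI * x) (2 * PI) p (2 * PI)).
replace (Ci * (RtoC (2 * PI) * cexp (2 * PI * Re p) (2 * PI * Im p)))%C
  with (Ci * RtoC (2 * PI) * cexp (2 * PI * Re p) (2 * PI * Im p))%C by ring.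
apply H. auto_derive; [exact I|ring].
Qed.

(** Holomorphy in [zeta] can be tested in the coordinate [x + i y], in which the
    connection is written. *)
Lemma Choldiff_exp2pi (k : C -> C) (x y : R) :
  Choldiff k (exp2pi x y) <-> Choldiff (fun q => k (exp2pi (Re q) (Im q))) (x, y).
Proof.
assert (He := Cdiff_exp2pi (x, y)). simpl in He.
split; intros H; apply Choldiff_Cdiff in H; destruct H as [l H].
- apply Choldiff_Cdiff. eexists. exact (Cdiff_comp k _ (x, y) _ _ H He).
- destruct (local_log (x, y)) as [lg [H1 [H2 H3]]]. simpl in H1, H2, H3.
  assert (Hm : (RtoC (2 * PI) * exp2pi x y <> 0)%C).
  { apply Cmult_neq_0; [|apply cexp_neq_0]. intros E; injection E; generalize PI_RGT_0; lra. }
  assert (Hl := Cdiff_inverse _ lg _ _ He Hm H1 H2 H3).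
  rewrite -H2 in H. assert (Hc := Cdiff_comp _ lg (exp2pi x y) _ _ H Hl). simpl in Hc.
  apply Choldiff_ext_loc with (f := fun q => k (exp2pi (Re (lg q)) (Im (lg q)))).
  + destruct H1 as [d [Hd H1]]. exists d; split; [exact Hd|]. intros w Hw.
    specialize (H1 (w - exp2pi x y)%C Hw).
    replace (exp2pi x y + (w - exp2pi x y))%C with w in H1 by ring. now rewrite H1.
  + apply Choldiff_Cdiff. eexists; exact Hc.
Qed.

(** * The line bundle of a connection that is flat near both poles *)

Lemma ex_RInt_cont (f : R -> R) a b : (forall x, continuous f x) -> ex_RInt f a b.
Proof. intros H. apply (ex_RInt_continuous (V := R_CompleteNormedModule)). intros; apply H. Qed.

Lemma is_derive_primitive (f : R -> R) a x : (forall x, continuous f x) ->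
  is_derive (fun y => RInt f a y) x (f x).
Proof.
intros H. apply (is_derive_RInt f _ a).
- apply filter_forall. intros y. apply (RInt_correct (V := R_CompleteNormedModule)).
  now apply ex_RInt_cont.
- apply H.
Qed.

(** The constant of integration is chosen so that [exp (- G)] compensates
    [|zeta|^n0] near [zeta = 0]; near infinity it then compensates
    [|zeta|^ninf] only up to the factor [exp (- c)]. *)
Lemma connection_potential (F : R -> R) (xm xM : R) (n0 ninf : Z) :
  (forall x, continuous F x) ->
  (forall x, x <= xm -> F x = IZR n0) -> (forall x, xM <= x -> F x = IZR ninf) ->
  exists (G : R -> R) (c : R),
    (forall x, is_derive G x (2 * PI * F x)) /\
    (forall x, x <= xm -> G x = 2 * PI * IZR n0 * x) /\
    (forall x, xM <= x -> G x = 2 * PI * IZR ninf * x + c).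
Proof.
intros HF H0 Hinf.
set (G := fun x => 2 * PI * IZR n0 * xm + 2 * PI * RInt F xm x).
assert (Const : forall n p q, (forall x, Rmin p q < x < Rmax p q -> F x = IZR n) ->
   RInt F p q = (q - p) * IZR n).
{ intros n p q H. transitivity (RInt (fun _ => IZR n) p q).
  - apply RInt_ext. exact H.
  - now rewrite RInt_const. }
exists G, (G xM - 2 * PI * IZR ninf * xM). split; [|split].
- intros x. unfold G.
  assert (D := is_derive_primitive F xm x HF).
  apply (is_derive_ext (fun t => plus (2 * PI * IZR n0 * xm) (scal (2 * PI) (RInt F xm t)))).
  { intros t. reflexivity. }
  replace (2 * PI * F x) with (plus 0 (scal (2 * PI) (F x)))
    by (unfold plus, scal; simpl; unfold mult; simpl; ring).
  apply (is_derive_plus (fun _ => _) _ x 0); [apply @is_derive_const|].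
  now apply is_derive_scal.
- intros x Hx. unfold G. rewrite (Const n0); [ring|].
  intros y. rewrite Rmin_right ?Rmax_left; try lra. intros Hy; apply H0; lra.
- intros x Hx. unfold G.
  rewrite -(RInt_Chasles F xm xM x); try now apply ex_RInt_cont.
  unfold plus; simpl. rewrite (Const ninf xM x); [ring|].
  intros y. rewrite Rmin_left ?Rmax_right; try lra. intros Hy; apply Hinf; lra.
Qed.

Lemma Cmod_exp2pi x y : Cmod (exp2pi x y) = exp (2 * PI * x).
Proof. apply Cmod_cexp. Qed.

Lemma ln_Cmod_exp2pi x y : ln (Cmod (exp2pi x y)) / (2 * PI) = x.
Proof. rewrite Cmod_exp2pi ln_exp. field. generalize PI_RGT_0; lra. Qed.

Lemma RtoC_exp t : RtoC (exp t) = cexp t 0.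
Proof. unfold cexp. rewrite cos_0 sin_0. apply injective_projections; simpl; ring. Qed.

Lemma Choldiff_scal (c : C) f z : c <> 0%C -> Choldiff f z <-> Choldiff (fun w => c * f w)%C z.
Proof.
intros Hc. assert (K : forall (d : C) g, Choldiff g z -> Choldiff (fun w => d * g w)%C z).
{ intros d g H. apply Choldiff_rdiff in H. destruct H as [l H]. apply Choldiff_rdiff.
  exists (d * l)%C. generalize (rdiff_mult _ _ _ _ _ _ _ (rdiff_const d z) H).
  replace (0 * g z + d * l)%C with (d * l)%C by ring.
  replace (0 * g z + d * (Ci * l))%C with (Ci * (d * l))%C by ring. easy. }
split; intros H; [now apply K|].
apply Choldiff_ext_loc with (f := fun w => (/ c * (c * f w))%C); [|now apply K].
exists 1; split; [lra|]. intros w _. field. exact Hc.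
Qed.

Lemma Choldiff_congr f g z :
  (exists d, 0 < d /\ forall w, Cmod (w - z)%C < d -> f w = g w) ->
  Choldiff f z <-> Choldiff g z.
Proof.
intros H; split; apply Choldiff_ext_loc; [exact H|].
destruct H as [d [Hd H]]; exists d; split; [exact Hd|]. intros w Hw. symmetry; now apply H.
Qed.

Lemma at_zero_0 c f : at_zero c f 0%C = c.
Proof. unfold at_zero. now destruct Ceq_dec. Qed.

Lemma at_zero_neq c f (z : C) : z <> 0%C -> at_zero c f z = f z.
Proof. intros H. unfold at_zero. now destruct Ceq_dec. Qed.

Lemma exp2pi_small (w : C) x0 : w <> 0%C -> Cmod (w - 0)%C < exp (2 * PI * x0) ->
  exists x y, w = exp2pi x y /\ x <= x0.
Proof.
intros Hw H. destruct (polar_exp2pi w Hw) as [y E].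
set (x := ln (Cmod w) / (2 * PI)) in *. exists x, y; split; [exact E|].
replace (w - 0)%C with w in H by ring. rewrite E Cmod_exp2pi in H.
apply exp_lt_inv in H. generalize PI_RGT_0; nra.
Qed.

Lemma Cinv_exp2pi x y : (/ exp2pi x y)%C = exp2pi (- x) (- y).
Proof. unfold exp2pi. rewrite cexp_inv. f_equal; ring. Qed.

Lemma zpow_exp2pi x y n : zpow (exp2pi x y) n = exp2pi (IZR n * x) (IZR n * y).
Proof. unfold exp2pi. rewrite zpow_cexp. f_equal; ring. Qed.

Lemma zpow_phase_exp2pi x y n : zpow (phase (exp2pi x y)) n = exp2pi 0 (IZR n * y).
Proof. unfold exp2pi. rewrite phase_cexp zpow_cexp. f_equal; ring. Qed.

(** Multiplication by [zeta^n0 exp (- G)] turns solutions of the (0,1)-part of the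
    connection into holomorphic functions.  Near 0 this factor is the phase of
    [zeta] to the power [n0], hence the comparison with the parallel frame; near
    infinity it is a constant multiple of [zeta^(n0 - ninf)] times the phase to the
    power [ninf]. *)
Lemma nabla_bundle_OE (F : R -> R) (xm xM : R) (n0 ninf : Z) :
  (forall x, continuous F x) ->
  (forall x, x <= xm -> F x = IZR n0) -> (forall x, xM <= x -> F x = IZR ninf) ->
  lb_iso (nabla_bundle F n0 ninf) (OE (n0 - ninf)).
Proof.
intros HF H0 Hinf.
destruct (connection_potential F xm xM n0 ninf HF H0 Hinf) as [G [c [DG [G0 Ginf]]]].
set (h := fun p => match p with
  | aff z => at_zero (RtoC 1)
      (fun z => zpow z n0 * RtoC (exp (- G (ln (Cmod z) / (2 * PI))%R)%R))%C z
  | infty => RtoC (exp (- c)) end).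
assert (hE : forall x y, h (aff (exp2pi x y)) =
   cexp (2 * PI * IZR n0 * x - G x) (2 * PI * IZR n0 * y)).
{ intros x y. unfold h. rewrite at_zero_neq; [|apply cexp_neq_0].
  rewrite ln_Cmod_exp2pi zpow_exp2pi RtoC_exp. unfold exp2pi. rewrite cexp_mult.
  f_equal; ring. }
assert (hne : forall p, h p <> 0%C).
{ intros [z|].
  - destruct (Ceq_dec z 0%C) as [E|E].
    + unfold h. rewrite E at_zero_0. intros E1; injection E1; lra.
    + destruct (polar_exp2pi z E) as [y Ez]. rewrite Ez hE. apply cexp_neq_0.
  - simpl. rewrite RtoC_exp. apply cexp_neq_0. }
exists h. split; [exact hne|]. intros V _ s.
assert (Interior : forall x y,
  (exists sx sy : C,
       filterdiff (K := R_AbsRing) (U := C_R_NormedModule) (V := C_R_NormedModule)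
         (fun p : C => s (aff (exp2pi (Re p) (Im p)))) (locally (x, y))
         (fun h : C => (RtoC (Re h) * sx + RtoC (Im h) * sy)%C) /\
       (sx + Ci * (sy + RtoC (2 * PI * F x) * Ci * s (aff (exp2pi x y))))%C = 0%C) <->
  Choldiff (fun z => (h (aff z) * s (aff z))%C) (exp2pi x y)).
{ clearbody h. intros x y. rewrite Choldiff_exp2pi.
  set (g := fun p : C => s (aff (exp2pi (Re p) (Im p)))).
  set (A := fun x => 2 * PI * IZR n0 * x - G x).
  assert (DA : is_derive A x (2 * PI * IZR n0 - 2 * PI * F x)).
  { unfold A. apply (is_derive_minus (fun x => 2 * PI * IZR n0 * x) G); [|apply DG].
    auto_derive; [exact I|ring]. }
  assert (DN : is_derive (fun x => - A x) x (- (2 * PI * IZR n0 - 2 * PI * F x))).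
  { apply (is_derive_opp A). exact DA. }
  set (k := 2 * PI * IZR n0) in *.
  assert (E1 := rdiff_cexp A k (x, y) _ DA). assert (E2 := rdiff_cexp _ (- k) (x, y) _ DN).
  simpl in E1, E2.
  change (s (aff (exp2pi x y))) with (g (x, y)).
  split.
  - intros [sx [sy [D Eq]]]. apply rdiff_filterdiff in D.
    apply Choldiff_rdiff. assert (P := rdiff_mult _ _ _ _ _ _ _ E1 D). eexists.
    eapply rdiff_ext_loc; [exists 1; split; [lra|] |].
    { intros w _. rewrite hE. fold (A (Re w)). fold (g w). reflexivity. }
    match type of P with rdiff _ _ ?X ?Y =>
      assert (CR : Y = (Ci * X)%C); [|rewrite CR in P; exact P] end.
    simpl. set (E := cexp (A x) (k * y)). set (gv := g (x, y)) in *. change (g (x, y)) with gv.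
    replace sx with (- (Ci * (sy + RtoC (2 * PI * F x) * Ci * gv)))%C.
    2: { replace sx with ((sx + Ci * (sy + RtoC (2 * PI * F x) * Ci * gv))
        - Ci * (sy + RtoC (2 * PI * F x) * Ci * gv))%C by ring. rewrite Eq; ring. }
    apply injective_projections; simpl; ring.
  - intros H. apply Choldiff_rdiff in H. destruct H as [l H].
    assert (P := rdiff_mult _ _ _ _ _ _ _ E2 H). simpl in P.
    rewrite hE in P. fold (g (x, y)) in P. fold (A x) in P.
    eexists; eexists. split.
    { apply rdiff_filterdiff. eapply rdiff_ext_loc; [|exact P].
      exists 1; split; [lra|]. intros w _. rewrite hE. fold (A (Re w)). fold (g w).
      rewrite Cmult_assoc cexp_mult.
      replace (- A (Re w) + A (Re w)) with 0 by ring.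
      replace (- k * Im w + k * Im w) with 0 by ring. rewrite cexp_0. ring. }
    simpl.
    assert (I1 : (cexp (- A x) (- k * y) * cexp (A x) (k * y) = 1)%C).
    { rewrite cexp_mult.
      replace (- A x + A x) with 0 by ring.
      replace (- k * y + k * y) with 0 by ring. apply cexp_0. }
    set (E := cexp (- A x) (- k * y)) in *. set (E' := cexp (A x) (k * y)) in *.
    set (gv := g (x, y)).
    assert (I2 : forall a, (a * E * (E' * gv) = a * gv)%C).
    { intros a. transitivity (a * ((E * E') * gv))%C; [ring|]. rewrite I1; ring. }
    change (s (aff (exp2pi x y))) with gv. change (g (x, y)) with gv. rewrite !I2. apply injective_projections; simpl; ring. }
assert (Zero : Choldiff (at_zero (s (aff 0%C)) (fun z => (zpow (phase z) n0 * s (aff z))%C)) 0%C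
   <-> Choldiff (fun z => (h (aff z) * s (aff z))%C) 0%C).
{ apply Choldiff_congr. exists (exp (2 * PI * xm)). split; [apply exp_pos|].
  intros w Hw. destruct (Ceq_dec w 0%C) as [E|E].
  - rewrite E at_zero_0. unfold h. rewrite at_zero_0. ring.
  - rewrite at_zero_neq; [|exact E]. destruct (exp2pi_small w xm E Hw) as [x [y [Ew Hx]]].
    rewrite Ew hE zpow_phase_exp2pi (G0 x Hx). unfold exp2pi.
    f_equal. f_equal; ring. }
assert (Infty : Choldiff (at_zero (s infty)
       (fun e => (zpow (phase e) (- ninf) * s (aff (/ e)%C))%C)) 0%C <->
   Choldiff (at_zero (h infty * s infty)%C
       (fun e => (zpow e (n0 - ninf) * (h (aff (/ e)) * s (aff (/ e))))%C)) 0%C).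
{ rewrite (Choldiff_scal (h infty) _ _ (hne infty)).
  apply Choldiff_congr. exists (exp (2 * PI * - xM)). split; [apply exp_pos|].
  intros w Hw. destruct (Ceq_dec w 0%C) as [E|E].
  - now rewrite E !at_zero_0.
  - rewrite !at_zero_neq; try exact E. destruct (exp2pi_small w (- xM) E Hw) as [x [y [Ew Hx]]].
    rewrite Ew Cinv_exp2pi hE zpow_phase_exp2pi zpow_exp2pi Ginf; [|lra].
    unfold h. rewrite RtoC_exp. unfold exp2pi. rewrite !Cmult_assoc !cexp_mult.
    f_equal. rewrite minus_IZR opp_IZR. f_equal; ring. }
unfold nabla_bundle, OE. split.
- intros [N1 [N2 N3]]. split.
  + intros z Hz. destruct (Ceq_dec z 0%C) as [E|E].
    * rewrite E in Hz |- *. apply Zero, N2, Hz.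
    * destruct (polar_exp2pi z E) as [y Ez]. rewrite Ez in Hz |- *.
      apply Interior, N1, Hz.
  + intros Hi. apply Infty, N3, Hi.
- intros [O1 O2]. split; [|split].
  + intros x y Hxy. apply Interior, O1, Hxy.
  + intros Hz. apply Zero, O1, Hz.
  + intros Hi. apply Infty, O2, Hi.
Qed.

(** * The support of the transform *)

Lemma exp2pi_half : exp2pi 0 (/ 2) = (- (1))%C.
Proof.
unfold exp2pi, cexp. replace (2 * PI * 0) with 0 by ring. replace (2 * PI * / 2) with PI by field.
rewrite exp_0 cos_PI sin_PI. apply injective_projections; simpl; ring.
Qed.

Lemma Cmod_le_eps_0 (z c : C) : (forall eps, 0 < eps -> Cmod (c - z)%C < eps) -> z = c.
Proof.
intros H. destruct (Ceq_dec (c - z)%C 0%C) as [E|E].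
- replace z with (c - (c - z))%C by ring. rewrite E. ring.
- apply Cmod_gt_0 in E. specialize (H _ E). lra.
Qed.

Lemma onE_point p : onE (mkX p 0%C 0%C (- (1))%C (- (1))%C).
Proof.
unfold onE, inX; simpl. repeat split; destruct p; simpl; ring.
Qed.

Lemma onE_inv q : onE q -> q = mkX (xb q) 0%C 0%C (- (1))%C (- (1))%C.
Proof. destruct q; unfold onE; simpl. intros [_ [-> [-> [-> ->]]]]. reflexivity. Qed.

Lemma chart_minus_1 (zeta : C) : zeta <> 0%C ->
  chart zeta (- (1))%C (- (1))%C = mkX (aff zeta) 0%C 0%C (- (1))%C (- (1))%C.
Proof. intros H. unfold chart. f_equal; field; exact H. Qed.

Lemma continuation_syz_piece a b x3 S q : Rabs b < Rabs a -> hol1 S = / 2 -> hol2 S = / 2 ->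
  continuation (syz_piece a b x3 S) q <->
  exists zeta : C, zeta <> 0%C /\ q = mkX (aff zeta) 0%C 0%C (- (1))%C (- (1))%C.
Proof.
intros Hab E1 E2. split.
- intros [zeta [zeta' [w1 [w2 [Hz [[r [y3 [_ E]]] Eq]]]]]].
  rewrite E1 E2 in E. unfold chart_xy in E. rewrite exp2pi_half in E.
  assert (W1 := f_equal xw1 E). assert (W2 := f_equal xw2 E). simpl in W1, W2.
  exists zeta. split; [exact Hz|]. rewrite -chart_minus_1; [|exact Hz]. now rewrite Eq W1 W2.
- intros [zeta [Hz Eq]]. set (r := (Rabs b + Rabs a) / 2).
  exists zeta, (exp2pi (x3 (r, 0, 0)) 0), (- (1))%C, (- (1))%C. split; [exact Hz|].
  split; [|now rewrite chart_minus_1].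
  exists r, 0. split; [unfold r; lra|]. rewrite E1 E2. unfold chart_xy. now rewrite exp2pi_half.
Qed.

(** The holonomy -1 along both circles puts [w_1 = w_2 = -1], so the piece lies
    on [E] minus its two poles; the closure adds the poles. *)
Lemma syz_support a b x3 S q : Rabs b < Rabs a -> hol1 S = / 2 -> hol2 S = / 2 ->
  inX0 q /\ closureX (continuation (syz_piece a b x3 S)) q <-> onE q.
Proof.
intros Hab E1 E2. assert (K := fun q => continuation_syz_piece a b x3 S q Hab E1 E2).
split.
- intros [_ H].
  assert (P : forall eps, 0 < eps -> Cmod (0 - xu q)%C < eps /\ Cmod (0 - xv q)%C < eps /\
     Cmod (- (1) - xw1 q)%C < eps /\ Cmod (- (1) - xw2 q)%C < eps).
  { intros eps Heps. destruct (H (fun _ => True) eps) as [q' [Hq' [_ D]]]; auto.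
    - split; [intros z _; now apply filter_forall|]. intros _; now exists 0.
    - apply K in Hq'. destruct Hq' as [zeta [_ ->]]. exact D. }
  assert (Eu : xu q = 0%C) by (apply Cmod_le_eps_0; apply P).
  assert (Ev : xv q = 0%C) by (apply Cmod_le_eps_0; apply P).
  assert (Ew1 : xw1 q = (- (1))%C) by (apply Cmod_le_eps_0; apply P).
  assert (Ew2 : xw2 q = (- (1))%C) by (apply Cmod_le_eps_0; apply P).
  destruct q as [p u v w1 w2]; simpl in *; subst. apply onE_point.
- intros HE. assert (Eq := onE_inv q HE). split.
  + split; [apply HE|]. rewrite Eq; simpl. replace (- (1) * - (1))%C with (RtoC 1) by ring.
    intros E; injection E; lra.
  + intros V eps HV Hq Heps.
    assert (N : exists zeta : C, zeta <> 0%C /\ V (aff zeta)).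
    { destruct HV as [HV HVi]. destruct (xb q) as [zeta|].
      - destruct (Ceq_dec zeta 0%C) as [E|E]; [|now exists zeta].
        specialize (HV _ Hq). apply locally_Cmod in HV. destruct HV as [d [Hd HV]].
        exists (RtoC (d / 2)). split; [intros E'; injection E'; lra|].
        apply HV. rewrite E. replace (RtoC (d / 2) - 0)%C with (RtoC (d / 2)) by ring.
        rewrite Cmod_R Rabs_pos_eq; lra.
      - destruct (HVi Hq) as [M HM]. exists (RtoC (Rabs M + 1)). split.
        + intros E'; injection E'. generalize (Rabs_pos M); lra.
        + apply HM. rewrite Cmod_R Rabs_pos_eq; generalize (Rabs_pos M) (Rle_abs M); lra. }
    destruct N as [zeta [Hz HVz]].
    exists (mkX (aff zeta) 0%C 0%C (- (1))%C (- (1))%C).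
    split; [apply K; now exists zeta|]. rewrite Eq; simpl.
    assert (Z : forall c : C, Cmod (c - c)%C < eps).
    { intros c. replace (c - c)%C with (RtoC 0) by ring. now rewrite Cmod_0. }
    repeat split; try exact HVz; apply Z.
Qed.

(** * Curves in the complex plane *)

Definition Cder (g : R -> C) (t : R) (d : C) : Prop :=
  is_derive (fun s => Re (g s)) t (Re d) /\ is_derive (fun s => Im (g s)) t (Im d).

Lemma is_derive_val (f : R -> R) x l l' : is_derive f x l -> l = l' -> is_derive f x l'.
Proof. now intros H <-. Qed.

Lemma is_derive_mulR (f g : R -> R) x l m : is_derive f x l -> is_derive g x m ->
  is_derive (fun t => f t * g t) x (l * g x + f x * m).
Proof. intros Hf Hg. apply (is_derive_mult f g x l m Hf Hg). intros; apply Rmult_comm. Qed.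

Lemma is_derive_minR (f g : R -> R) x l m : is_derive f x l -> is_derive g x m ->
  is_derive (fun t => f t - g t) x (l - m).
Proof. intros Hf Hg. apply (is_derive_minus f g x l m Hf Hg). Qed.

Lemma is_derive_addR (f g : R -> R) x l m : is_derive f x l -> is_derive g x m ->
  is_derive (fun t => f t + g t) x (l + m).
Proof. intros Hf Hg. apply (is_derive_plus f g x l m Hf Hg). Qed.

Lemma is_derive_inj (f : R -> R) x l m : is_derive f x l -> is_derive f x m -> l = m.
Proof. intros Hf Hg. apply is_derive_unique in Hf. apply is_derive_unique in Hg. congruence. Qed.

Lemma Cder_mult f g t df dg : Cder f t df -> Cder g t dg ->
  Cder (fun s => f s * g s)%C t (df * g t + f t * dg)%C.
Proof.
intros [f1 f2] [g1 g2]. split.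
- eapply is_derive_val.
  + exact (is_derive_minR _ _ _ _ _ (is_derive_mulR _ _ _ _ _ f1 g1) (is_derive_mulR _ _ _ _ _ f2 g2)).
  + unfold Re, Im; simpl; ring.
- eapply is_derive_val.
  + exact (is_derive_addR _ _ _ _ _ (is_derive_mulR _ _ _ _ _ f1 g2) (is_derive_mulR _ _ _ _ _ f2 g1)).
  + unfold Re, Im; simpl; ring.
Qed.

Lemma Cder_unique f t d d' : Cder f t d -> Cder f t d' -> d = d'.
Proof.
intros [H1 H2] [H1' H2']. apply injective_projections.
- exact (is_derive_inj _ _ _ _ H1 H1').
- exact (is_derive_inj _ _ _ _ H2 H2').
Qed.

Lemma Cder_ext_loc f g t d : locally t (fun s => f s = g s) -> Cder f t d -> Cder g t d.
Proof.
intros E [H1 H2]. split; [eapply is_derive_ext_loc; [|exact H1]|eapply is_derive_ext_loc; [|exact H2]];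
 apply: filter_imp E; intros s ->; reflexivity.
Qed.

Lemma Cder_ext f g t d : (forall s, f s = g s) -> Cder f t d -> Cder g t d.
Proof. intros E. apply Cder_ext_loc. now apply filter_forall. Qed.

Lemma Cder_minus_const f c t d : Cder f t d -> Cder (fun s => f s - c)%C t d.
Proof.
intros [H1 H2]. split.
- eapply is_derive_val.
  + exact (is_derive_minR _ (fun _ => Re c) _ _ _ H1 (is_derive_const _ _)).
  + unfold zero; simpl; ring.
- eapply is_derive_val.
  + exact (is_derive_minR _ (fun _ => Im c) _ _ _ H2 (is_derive_const _ _)).
  + unfold zero; simpl; ring.
Qed.

Lemma Cder_Cmod_sqr f t d : Cder f t d ->
  is_derive (fun s => Cmod (f s) ^ 2) t (2 * Re (Cconj (f t) * d)%C).
Proof.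
intros [H1 H2].
apply (is_derive_ext (fun s => Re (f s) * Re (f s) + Im (f s) * Im (f s))).
{ intros s. rewrite Cmod_sqr. simpl. unfold Re, Im. ring. }
eapply is_derive_val.
- exact (is_derive_addR _ _ _ _ _ (is_derive_mulR _ _ _ _ _ H1 H1) (is_derive_mulR _ _ _ _ _ H2 H2)).
- unfold Re, Im; simpl; ring.
Qed.

Lemma is_derive_0_const (f : R -> R) : (forall t, is_derive f t 0) -> forall x y, f x = f y.
Proof.
intros H x y. destruct (Rtotal_order x y) as [L|[E|L]].
- apply (eq_is_derive f x y); [intros; apply H | exact L].
- now rewrite E.
- symmetry; apply (eq_is_derive f y x); [intros; apply H | exact L].
Qed.

Lemma Cder_0_const f : (forall t, Cder f t 0%C) -> forall x y, f x = f y.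
Proof.
intros H x y. apply injective_projections.
- apply (is_derive_0_const (fun t => Re (f t))). intros t; apply H.
- apply (is_derive_0_const (fun t => Im (f t))). intros t; apply H.
Qed.

Lemma Cder_cexp th t l : is_derive th t l ->
  Cder (fun s => cexp 0 (th s)) t (Ci * cexp 0 (th t) * RtoC l)%C.
Proof.
intros H.
assert (D1 : is_derive (fun s => cos (th s)) t (- sin (th t) * l)).
{ eapply is_derive_val; [apply (is_derive_comp cos th _ _ _ (is_derive_cos _) H)|].
  unfold scal; simpl; unfold mult; simpl; ring. }
assert (D2 : is_derive (fun s => sin (th s)) t (cos (th t) * l)).
{ eapply is_derive_val; [apply (is_derive_comp sin th _ _ _ (is_derive_sin _) H)|].
  unfold scal; simpl; unfold mult; simpl; ring. }
unfold cexp. rewrite exp_0. split; unfold Re, Im; simpl.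
- eapply is_derive_ext; [intros s; symmetry; apply Rmult_1_l|].
  eapply is_derive_val; [exact D1|simpl; ring].
- eapply is_derive_ext; [intros s; symmetry; apply Rmult_1_l|].
  eapply is_derive_val; [exact D2|simpl; ring].
Qed.

(** Multiplying by the inverse rotation gives a curve with zero velocity; this
    integrates the flow without a uniqueness theorem for differential
    equations. *)
Lemma rotation_flow g tau th :
  (forall t, Cder g t (Ci * RtoC (tau t) * g t)%C) -> (forall t, is_derive th t (tau t)) ->
  th 0 = 0 -> forall t, g t = (g 0 * cexp 0 (th t))%C.
Proof.
intros Hg Hth H0 t.
assert (K : forall s, Cder (fun s => g s * cexp 0 (- th s))%C s 0%C).
{ intros s.
  assert (D := Cder_mult _ _ _ _ _ (Hg s)
    (Cder_cexp (fun s => - th s) s (- tau s) (is_derive_opp th s _ (Hth s)))).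
  match type of D with Cder _ _ ?x => replace (RtoC 0) with x; [exact D|] end.
  apply injective_projections; simpl; ring. }
assert (E := Cder_0_const _ K t 0). simpl in E. rewrite H0 Ropp_0 cexp_0 Cmult_1_r in E.
rewrite -E -Cmult_assoc cexp_mult. replace (0 + 0) with 0 by ring.
replace (- th t + th t) with 0 by ring. rewrite cexp_0. ring.
Qed.

(** * The vertical derivative of the action-angle map *)

(** The contribution of one conic [u v = z - c] to the symplectic form on two
    tangent vectors [V], [W], where |u| = |v| and [V] preserves the moment
    |u|^2 - |v|^2.  Writing [Vu = k u] and [Vv = k' v], [k] and [k'] have equal
    real parts, and the sum splits into the pull-back of a form on the z-plane
    and the pairing of the rotation speed of [V] with the moment of [W]. *)
Lemma conic_tangent_area (u v Vu Vv Wu Wv Vz Wz : C) (m : R) :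
  0 < m -> Cmod u ^ 2 = m -> Cmod v ^ 2 = m ->
  (Vu * v + u * Vv = Vz)%C -> (Wu * v + u * Wv = Wz)%C ->
  Re (Cconj u * Vu)%C = Re (Cconj v * Vv)%C ->
  area Vu Wu + area Vv Wv =
  area Vz Wz / (2 * m)
  - (Im (Cconj u * Vu)%C - Im (Cconj v * Vv)%C) / (2 * m)
    * (Re (Cconj u * Wu)%C - Re (Cconj v * Wv)%C).
Proof.
intros Hm Hu Hv HV HW HR.
assert (Hu0 : u <> 0%C). { intros E. rewrite E Cmod_0 in Hu. lra. }
assert (Hv0 : v <> 0%C). { intros E. rewrite E Cmod_0 in Hv. lra. }
rewrite Cmod_sqr in Hu. rewrite Cmod_sqr in Hv.
replace Vu with (u * (Vu / u))%C in * by (field; exact Hu0).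
replace Vv with (v * (Vv / v))%C in * by (field; exact Hv0).
replace Wu with (u * (Wu / u))%C in * by (field; exact Hu0).
replace Wv with (v * (Wv / v))%C in * by (field; exact Hv0).
set (k := (Vu / u)%C) in *. set (k' := (Vv / v)%C) in *.
set (l := (Wu / u)%C) in *. set (l' := (Wv / v)%C) in *.
rewrite -HV -HW. unfold area. clear HV HW. clearbody k k' l l'.
destruct u as [ux uy], v as [vx vy], k as [p q], k' as [p' q'], l as [P Q], l' as [P' Q'].
unfold Re, Im in *; simpl in *.
assert (E : m * p = m * p').
{ transitivity ((ux ^ 2 + uy ^ 2) * p); [rewrite -Hu; ring|].
  transitivity ((vx ^ 2 + vy ^ 2) * p'); [|rewrite -Hv; ring].
  transitivity (ux * (ux * p - uy * q) - - uy * (ux * q + uy * p)); [ring|].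
  rewrite HR. ring. }
assert (Ep : p' = p). { apply Rmult_eq_reg_l with m; lra. } subst p'. clear HR E.
transitivity ((ux ^ 2 + uy ^ 2) * (p * Q - q * P) + (vx ^ 2 + vy ^ 2) * (p * Q' - q' * P')); [ring|].
replace (ux * (ux * q + uy * p) + - uy * (ux * p - uy * q) -
  (vx * (vx * q' + vy * p) + - vy * (vx * p - vy * q')))
 with ((ux ^ 2 + uy ^ 2) * q - (vx ^ 2 + vy ^ 2) * q') by ring.
replace (ux * (ux * P - uy * Q) - - uy * (ux * Q + uy * P) -
   (vx * (vx * P' - vy * Q') - - vy * (vx * Q' + vy * P')))
 with ((ux ^ 2 + uy ^ 2) * P - (vx ^ 2 + vy ^ 2) * P') by ring.
match goal with |- _ = ?X / _ - _ => replace X with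
  ((ux ^ 2 + uy ^ 2) * (vx ^ 2 + vy ^ 2) * (2 * p * (Q + Q') - (q + q') * (P + P'))) by ring end.
simpl in Hu, Hv. simpl. rewrite Hu Hv. field. lra.
Qed.

(** The equations that arise from derivatives are stated in the normed module
    [R], whose operations hide the field structure that [ring] needs. *)
Ltac Rring := repeat (progress (unfold minus, opp, plus, scal, mult; simpl)); match goal with |- @eq _ ?x ?y => change (@eq R x y) end; ring.

Definition coord (f : amb -> C) : Prop :=
  f = cz \/ f = cu1 \/ f = cv1 \/ f = cu2 \/ f = cv2.

Lemma chamber_Bsm a b p : chamber a b p -> Bsm a b p.
Proof.
destruct p as [[r l1] l2]. unfold chamber, Bsm; simpl. intros H.
generalize (Rabs_pos b); intros. repeat split; try lra; intros [E _]; lra.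
Qed.

Lemma is_derive_pair_Cder (g : R -> C) (t : R) (d : C) :
  is_derive (V := C_R_NormedModule) g t d -> Cder g t d.
Proof.
intros H. split.
- apply (filterdiff_comp g (fst : C_R_NormedModule -> R_NormedModule) _
    (fst : C_R_NormedModule -> R_NormedModule) H).
  apply filterdiff_linear. apply (is_linear_fst (U := R_NormedModule) (V := R_NormedModule)).
- apply (filterdiff_comp g (snd : C_R_NormedModule -> R_NormedModule) _
    (snd : C_R_NormedModule -> R_NormedModule) H).
  apply filterdiff_linear. apply (is_linear_snd (U := R_NormedModule) (V := R_NormedModule)).
Qed.

Lemma dPhi_coord (Phi : R3 -> R3 -> amb) f p v : coord f ->
  f (dPhi Phi p v) = dirC (fun q => f (uncur Phi q)) p v.
Proof. now intros [->|[->|[->|[->| ->]]]]. Qed.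

Lemma dPhi_Cder a b Phi x3 (f : amb -> C) (p v : R3 * R3) :
  action_angle a b Phi x3 -> Bsm a b (fst p) -> coord f ->
  Cder (fun t => f (uncur Phi (plus p (scal t v)))) 0 (f (dPhi Phi p v)).
Proof.
intros HP Hp Hf. destruct (aa_smooth _ _ _ _ HP f Hf 1%nat) as [_ H].
destruct (H v) as [g [Hg _]]. specialize (Hg p Hp). apply is_derive_pair_Cder in Hg.
rewrite dPhi_coord; [|exact Hf].
replace (dirC (fun q => f (uncur Phi q)) p v) with (g p); [exact Hg|].
destruct Hg as [H1 H2]. apply injective_projections; symmetry; apply is_derive_unique; assumption.
Qed.

Lemma rho_r y r l1 l2 : rho y = (r, l1, l2) -> Cmod (cz y) = r.
Proof. intros H; now injection H. Qed.

(** Differentiating the equations of [Y0] and the identity [rho (Phi p al) = p]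
    along a line. *)
Lemma dPhi_tangent a b Phi x3 r l1 l2 al (v : R3 * R3) :
  action_angle a b Phi x3 -> chamber a b (r, l1, l2) ->
  let y := Phi (r, l1, l2) al in
  let V := dPhi Phi ((r, l1, l2), al) v in
  (cu1 V * cv1 y + cu1 y * cv1 V = cz V)%C /\ (cu2 V * cv2 y + cu2 y * cv2 V = cz V)%C /\
  Re (Cconj (cz y) * cz V)%C = r * fst (fst (fst v)) /\
  Re (Cconj (cu1 y) * cu1 V)%C - Re (Cconj (cv1 y) * cv1 V)%C = snd (fst (fst v)) /\
  Re (Cconj (cu2 y) * cu2 V)%C - Re (Cconj (cv2 y) * cv2 V)%C = snd (fst v).
Proof.
intros HP Hch y V. set (p := ((r, l1, l2), al) : R3 * R3).
assert (Hp : Bsm a b (fst p)) by now apply chamber_Bsm.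
set (Y := fun t : R => uncur Phi (plus p (scal t v))).
assert (EY : Y 0 = y).
{ unfold Y, uncur, y. f_equal.
  - change (plus (r, l1, l2) (scal 0 (fst v)) = (r, l1, l2)).
    destruct v as [[[v1 v2] v3] w]. apply injective_projections; [apply injective_projections|];
      Rring.
  - change (plus al (scal 0 (snd v)) = al).
    destruct v as [w [[v1 v2] v3]]. destruct al as [[a1 a2] a3].
    apply injective_projections; [apply injective_projections|];
      Rring. }
assert (Dz := dPhi_Cder a b Phi x3 cz p v HP Hp ltac:(unfold coord; tauto)).
assert (Du1 := dPhi_Cder a b Phi x3 cu1 p v HP Hp ltac:(unfold coord; tauto)).
assert (Dv1 := dPhi_Cder a b Phi x3 cv1 p v HP Hp ltac:(unfold coord; tauto)).
assert (Du2 := dPhi_Cder a b Phi x3 cu2 p v HP Hp ltac:(unfold coord; tauto)).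
assert (Dv2 := dPhi_Cder a b Phi x3 cv2 p v HP Hp ltac:(unfold coord; tauto)).
fold V in Dz, Du1, Dv1, Du2, Dv2.
set (r' := fst (fst (fst v))). set (l1' := snd (fst (fst v))). set (l2' := snd (fst v)).
assert (Near : locally 0 (fun t => Bsm a b (fst (plus p (scal t v))))).
{ unfold chamber in Hch; simpl in Hch.
  assert (Pos : 0 < Rmin (r - Rabs b) (Rabs a - r) / (Rabs r' + 1)).
  { apply Rdiv_lt_0_compat; [apply Rmin_pos; lra|]. generalize (Rabs_pos r'); lra. }
  exists (mkposreal _ Pos). intros t Ht.
  change (Rabs (t - 0) < Rmin (r - Rabs b) (Rabs a - r) / (Rabs r' + 1)) in Ht.
  rewrite Rminus_0_r in Ht.
  apply chamber_Bsm. unfold chamber. change (Rabs b < r + t * r' < Rabs a).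
  assert (Q : Rabs (t * r') < Rmin (r - Rabs b) (Rabs a - r)).
  { rewrite Rabs_mult. apply Rle_lt_trans with (Rabs t * (Rabs r' + 1)).
    - apply Rmult_le_compat_l; [apply Rabs_pos|lra].
    - generalize (Rabs_pos r'); intros.
      apply Rmult_lt_compat_r with (r := Rabs r' + 1) in Ht; [|lra].
      unfold Rdiv in Ht. rewrite Rmult_assoc Rinv_l in Ht; lra. }
  apply Rabs_def2 in Q. generalize (Rmin_l (r - Rabs b) (Rabs a - r)) (Rmin_r (r - Rabs b) (Rabs a - r)). lra. }
assert (NY : locally 0 (fun t => Y0 a b (Y t))).
{ apply: filter_imp Near. intros t Ht. now apply (aa_Y0 _ _ _ _ HP). }
assert (NR : locally 0 (fun t => rho (Y t) = (r + t * r', l1 + t * l1', l2 + t * l2'))).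
{ apply: filter_imp Near. intros t Ht. rewrite /Y /uncur (aa_rho _ _ _ _ HP); [reflexivity|exact Ht]. }
assert (Conic : forall (u v w : amb -> C) (c : C) Vu Vv Vz, 
   Cder (fun t => u (Y t)) 0 Vu -> Cder (fun t => v (Y t)) 0 Vv -> Cder (fun t => w (Y t)) 0 Vz ->
   locally 0 (fun t => u (Y t) * v (Y t) = w (Y t) - c)%C ->
   (Vu * v y + u y * Vv = Vz)%C).
{ intros u v' w c Vu Vv Vz Hu Hv Hw E. rewrite -EY.
  apply (Cder_unique (fun t => w (Y t) - c)%C 0); [|now apply Cder_minus_const].
  apply Cder_ext_loc with (1 := E). exact (Cder_mult _ _ _ _ _ Hu Hv). }
assert (Moment : forall (u v : amb -> C) (l l' : R) Vu Vv,
   Cder (fun t => u (Y t)) 0 Vu -> Cder (fun t => v (Y t)) 0 Vv ->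
   locally 0 (fun t => / 2 * (Cmod (u (Y t)) ^ 2 - Cmod (v (Y t)) ^ 2) = l + t * l') ->
   Re (Cconj (u y) * Vu)%C - Re (Cconj (v y) * Vv)%C = l').
{ intros u v' l l' Vu Vv Hu Hv E. rewrite -EY.
  assert (D := is_derive_minR _ _ _ _ _ (Cder_Cmod_sqr _ _ _ Hu) (Cder_Cmod_sqr _ _ _ Hv)).
  assert (D2 : is_derive (fun t => 2 * (l + t * l')) 0 (2 * l')).
  { auto_derive; [exact I|Rring]. }
  apply (is_derive_ext_loc _ (fun t => 2 * (l + t * l'))) in D.
  - generalize (is_derive_inj _ _ _ _ D D2). lra.
  - apply: filter_imp E. intros t <-. match goal with |- @eq _ ?x ?y => change (@eq R x y) end; field. }
split; [|split; [|split; [|split]]].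
- apply (Conic cu1 cv1 cz (RtoC a)); try assumption. apply: filter_imp NY. intros t Ht; apply Ht.
- apply (Conic cu2 cv2 cz (RtoC b)); try assumption. apply: filter_imp NY. intros t Ht; apply Ht.
- assert (D : is_derive (fun t => Cmod (cz (Y t)) ^ 2) 0 (2 * Re (Cconj (cz (Y 0)) * cz V)%C))
    by exact (Cder_Cmod_sqr _ _ _ Dz).
  rewrite EY in D.
  assert (D2 : is_derive (fun t => (r + t * r') ^ 2) 0 (2 * r * r')).
  { auto_derive; [exact I|Rring]. }
  apply (is_derive_ext_loc _ (fun t => (r + t * r') ^ 2)) in D.
  + generalize (is_derive_inj _ _ _ _ D D2). lra.
  + apply: filter_imp NR. intros t Ht. now rewrite -(rho_r _ _ _ _ Ht).
- apply (Moment cu1 cv1 l1 l1'); try assumption. apply: filter_imp NR. intros t Ht.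
  now injection Ht.
- apply (Moment cu2 cv2 l2 l2'); try assumption. apply: filter_imp NR. intros t Ht.
  now injection Ht.
Qed.

(** The density of the reduced symplectic form at (lambda_1, lambda_2) = (0, 0),
    with respect to the area form of the z-plane. *)
Definition density (a b : R) (z : C) : R :=
  / (Cmod z) ^ 2 + / (2 * Cmod (z - RtoC a)%C) + / (2 * Cmod (z - RtoC b)%C).

Lemma Cmod_minus_ge (z : C) c : Rabs (Cmod z - Rabs c) <= Cmod (z - RtoC c)%C.
Proof.
apply Rabs_le. split.
- assert (H := Cmod_triangle (RtoC c - z)%C z).
  replace (RtoC c - z + z)%C with (RtoC c) in H by ring.
  rewrite Cmod_R Cmod_minus_sym in H. lra.
- assert (H := Cmod_triangle (z - RtoC c)%C (RtoC c)).
  replace (z - RtoC c + RtoC c)%C with z in H by ring.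
  rewrite Cmod_R in H. lra.
Qed.

Lemma density_pos a b (z : C) : z <> 0%C -> z <> RtoC a -> z <> RtoC b -> 0 < density a b z.
Proof.
intros H Ha Hb. unfold density.
assert (0 < Cmod z) by now apply Cmod_gt_0.
assert (forall c : C, z <> c -> 0 < Cmod (z - c)%C).
{ intros c Hc. apply Cmod_gt_0. intros E. apply Hc.
  replace z with ((z - c) + c)%C by ring. rewrite E; ring. }
assert (U1 := H1 _ Ha). assert (U2 := H1 _ Hb).
assert (0 < / (Cmod z) ^ 2) by (apply Rinv_0_lt_compat, pow_lt; lra).
assert (0 < / (2 * Cmod (z - RtoC a)%C)) by (apply Rinv_0_lt_compat; lra).
assert (0 < / (2 * Cmod (z - RtoC b)%C)) by (apply Rinv_0_lt_compat; lra).
lra.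
Qed.

Lemma fiber_moduli a b y r : Y0 a b y -> rho y = (r, 0, 0) ->
  Cmod (cu1 y) ^ 2 = Cmod (cz y - RtoC a)%C /\ Cmod (cv1 y) ^ 2 = Cmod (cz y - RtoC a)%C /\
  Cmod (cu2 y) ^ 2 = Cmod (cz y - RtoC b)%C /\ Cmod (cv2 y) ^ 2 = Cmod (cz y - RtoC b)%C.
Proof.
intros [_ [E1 E2]] H. injection H; intros H2 H1 _.
rewrite -E1 -E2 !Cmod_mult.
assert (K : forall x y, 0 <= x -> 0 <= y -> / 2 * (x ^ 2 - y ^ 2) = 0 -> x = y).
{ intros x y' Hx Hy E. nra. }
assert (M1 := K _ _ (Cmod_ge_0 _) (Cmod_ge_0 _) H1).
assert (M2 := K _ _ (Cmod_ge_0 _) (Cmod_ge_0 _) H2).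
rewrite M1 M2. repeat split; ring.
Qed.

Lemma Cconj_mult_self z : (Cconj z * z = RtoC (Cmod z ^ 2))%C.
Proof. rewrite Cmod_sqr. apply injective_projections; unfold Re, Im; simpl; ring. Qed.

(** [omega] pairs a vertical vector with any lift of a base vector to a number
    prescribed by [aa_sympl]; taking the three coordinate directions of the base
    yields the speed of [z] and the two rotation speeds. *)
Lemma vertical_dPhi a b Phi x3 r al (e1 e2 e3 : R) :
  action_angle a b Phi x3 -> chamber a b (r, 0, 0) ->
  let y := Phi (r, 0, 0) al in
  let V := dPhi Phi ((r, 0, 0), al) ((0, 0, 0), (e1, e2, e3)) in
  (cz V = Ci * RtoC (2 * PI * e1 / (r * density a b (cz y))) * cz y)%C /\
  (e1 = 0 -> cu1 V = Ci * RtoC (2 * PI * e2) * cu1 y /\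
    cv1 V = Ci * RtoC (2 * PI * - e2) * cv1 y /\
    cu2 V = Ci * RtoC (2 * PI * e3) * cu2 y /\
    cv2 V = Ci * RtoC (2 * PI * - e3) * cv2 y)%C.
Proof.
intros HP Hch y V.
assert (HB := chamber_Bsm _ _ _ Hch).
assert (Hr : Rabs b < r < Rabs a) by exact Hch.
assert (Hr0 : 0 < r) by (generalize (Rabs_pos b); lra).
assert (Hy : Y0 a b y) by now apply (aa_Y0 _ _ _ _ HP).
assert (Ry : rho y = (r, 0, 0)) by now apply (aa_rho _ _ _ _ HP).
destruct (fiber_moduli a b y r Hy Ry) as [Mu1 [Mv1 [Mu2 Mv2]]].
assert (Mz := rho_r _ _ _ _ Ry).
assert (Pa : 0 < Cmod (cz y - RtoC a)%C).
{ generalize (Cmod_minus_ge (cz y) a). rewrite Mz. unfold Rabs at 1; destruct Rcase_abs; lra. }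
assert (Pb : 0 < Cmod (cz y - RtoC b)%C).
{ generalize (Cmod_minus_ge (cz y) b). rewrite Mz. unfold Rabs at 1; destruct Rcase_abs; lra. }
set (ma := Cmod (cz y - RtoC a)%C) in *. set (mb := Cmod (cz y - RtoC b)%C) in *.
destruct (dPhi_tangent a b Phi x3 r 0 0 al ((0, 0, 0), (e1, e2, e3)) HP Hch)
  as [TV1 [TV2 [TVr [TVm1 TVm2]]]].
fold y V in TV1, TV2, TVr, TVm1, TVm2. cbn [fst snd] in TVr, TVm1, TVm2.
(* pairing of V with dPhi of the base vector (w1, w2, w3) *)
assert (Pair : forall w1 w2 w3,
  - Im (Cconj (cz y) * cz V)%C / r * w1 * (/ r ^ 2 + / (2 * ma) + / (2 * mb))
  - (Im (Cconj (cu1 y) * cu1 V)%C - Im (Cconj (cv1 y) * cv1 V)%C) / (2 * ma) * w2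
  - (Im (Cconj (cu2 y) * cu2 V)%C - Im (Cconj (cv2 y) * cv2 V)%C) / (2 * mb) * w3
  = - (2 * PI) * (w1 * e1 + w2 * e2 + w3 * e3)).
{ intros w1 w2 w3.
  set (w := ((w1, w2, w3), (0, 0, 0)) : R3 * R3).
  destruct (dPhi_tangent a b Phi x3 r 0 0 al w HP Hch) as [TW1 [TW2 [TWr [TWm1 TWm2]]]].
  set (W := dPhi Phi (r, 0, 0, al) w) in *. fold y in TW1, TW2, TWr, TWm1, TWm2.
  change (fst (fst (fst w))) with w1 in TWr. change (snd (fst (fst w))) with w2 in TWm1.
  change (snd (fst w)) with w3 in TWm2.
  assert (S := aa_sympl _ _ _ _ HP ((r, 0, 0), al) HB ((0, 0, 0), (e1, e2, e3)) w).
  change (uncur Phi (r, 0, 0, al)) with y in S. fold V W in S. unfold omega in S.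
  assert (A1 := conic_tangent_area _ _ _ _ _ _ _ _ ma Pa Mu1 Mv1 TV1 TW1 ltac:(lra)).
  assert (A2 := conic_tangent_area _ _ _ _ _ _ _ _ mb Pb Mu2 Mv2 TV2 TW2 ltac:(lra)).
  assert (Az : area (cz V) (cz W) = - Im (Cconj (cz y) * cz V)%C / r * w1).
  { apply Rmult_eq_reg_l with (r ^ 2); [|nra].
    replace (r ^ 2 * (- Im (Cconj (cz y) * cz V)%C / r * w1))
      with (- Im (Cconj (cz y) * cz V)%C * (r * w1)) by (field; lra).
    rewrite -TWr -Mz Cmod_sqr. clear - TVr.
    destruct (cz y) as [zx zy], (cz V) as [Vx Vy], (cz W) as [Wx Wy].
    unfold area, Re, Im in *; simpl in *.
    assert (Q : zx * Vx = - zy * Vy) by lra.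
    transitivity ((zx * Vx) * zx * Wy - (zy * - zy) * Vx * Wy - zx * zx * Vy * Wx - zy * (zy * Vy) * Wx); [ring|].
    transitivity (- (zx * Vy) * (zx * Wx) - (zx * Vy) * zy * Wy + (zy * Vx) * zx * Wx + zy * Vx * zy * Wy); [|ring].
    rewrite Q. replace (zx * zx * Vy * Wx) with (zx * zx * Vy * Wx) by ring.
    replace (zy * Vx * zx * Wx) with (zy * (zx * Vx) * Wx) by ring. rewrite Q. ring. }
  rewrite Mz in S. rewrite Rplus_assoc in S.
  replace (area (cz V) (cz W) / r ^ 2 + area (cu1 V) (cu1 W) + area (cv1 V) (cv1 W) +
    (area (cu2 V) (cu2 W) + area (cv2 V) (cv2 W))) with
    (area (cz V) (cz W) / r ^ 2 + (area (cu1 V) (cu1 W) + area (cv1 V) (cv1 W)) +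
    (area (cu2 V) (cu2 W) + area (cv2 V) (cv2 W))) in S by ring.
  rewrite A1 A2 Az TWm1 TWm2 in S. unfold dot, w in S. cbn [fst snd] in S.
  match type of S with ?L = _ => transitivity L; [field; lra|rewrite S; ring] end. }
assert (Er := Pair 1 0 0). assert (El1 := Pair 0 1 0). assert (El2 := Pair 0 0 1).
clear Pair.
assert (El1' : Im (Cconj (cu1 y) * cu1 V)%C - Im (Cconj (cv1 y) * cv1 V)%C = 4 * PI * e2 * ma).
{ apply Rmult_eq_reg_r with (/ (2 * ma)); [|apply Rgt_not_eq, Rinv_0_lt_compat; lra].
  replace (4 * PI * e2 * ma * / (2 * ma)) with (2 * PI * e2) by (field; lra).
  unfold Rdiv in El1. lra. }
assert (El2' : Im (Cconj (cu2 y) * cu2 V)%C - Im (Cconj (cv2 y) * cv2 V)%C = 4 * PI * e3 * mb).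
{ apply Rmult_eq_reg_r with (/ (2 * mb)); [|apply Rgt_not_eq, Rinv_0_lt_compat; lra].
  replace (4 * PI * e3 * mb * / (2 * mb)) with (2 * PI * e3) by (field; lra).
  unfold Rdiv in El2. lra. }
assert (Hz0 : cz y <> 0%C) by (apply Cmod_gt_0; lra).
assert (Vz : (cz V = Ci * RtoC (2 * PI * e1 / (r * density a b (cz y))) * cz y)%C).
{ assert (Dp : density a b (cz y) = / r ^ 2 + / (2 * ma) + / (2 * mb)) by (unfold density; now rewrite Mz).
  set (D := density a b (cz y)) in *.
  assert (PD : 0 < D).
  { rewrite Dp. assert (0 < / r ^ 2) by (apply Rinv_0_lt_compat, pow_lt; lra).
    assert (0 < / (2 * ma)) by (apply Rinv_0_lt_compat; lra).
    assert (0 < / (2 * mb)) by (apply Rinv_0_lt_compat; lra). lra. }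
  assert (EI : Im (Cconj (cz y) * cz V)%C = r ^ 2 * (2 * PI * e1 / (r * D))).
  { rewrite -Dp in Er. apply Rmult_eq_reg_r with (D / r); [|apply Rgt_not_eq, Rdiv_lt_0_compat; lra].
    transitivity (2 * PI * e1); [unfold Rdiv in Er |- *; lra|field; lra]. }
  set (tau := 2 * PI * e1 / (r * D)) in *.
  assert (Ec : (Cconj (cz y) * cz V = Cconj (cz y) * (Ci * RtoC tau * cz y))%C).
  { replace (Cconj (cz y) * (Ci * RtoC tau * cz y))%C with (Ci * RtoC tau * (Cconj (cz y) * cz y))%C by ring.
    rewrite Cconj_mult_self Mz. apply injective_projections.
    - transitivity 0; [unfold Re in TVr; lra|]. simpl. ring.
    - transitivity (r ^ 2 * tau); [exact EI|]. simpl; ring. }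
  assert (Hc : Cconj (cz y) <> 0%C).
  { intros E. apply Hz0. rewrite -(Cconj_conj (cz y)) E. apply injective_projections; simpl; ring. }
  replace (cz V) with (/ Cconj (cz y) * (Cconj (cz y) * cz V))%C by (field; exact Hc).
  rewrite Ec. field. exact Hc. }
split; [exact Vz|]. intros He1.
assert (Vz0 : cz V = 0%C).
{ rewrite Vz He1. replace (2 * PI * 0 / (r * density a b (cz y))) with 0 by (unfold Rdiv; ring). ring. }
rewrite Vz0 in TV1, TV2.
assert (Rot : forall (u v Vu Vv : C) m e, 0 < m -> Cmod u ^ 2 = m -> Cmod v ^ 2 = m ->
  (Vu * v + u * Vv = 0)%C -> Re (Cconj u * Vu)%C - Re (Cconj v * Vv)%C = 0 ->
  Im (Cconj u * Vu)%C - Im (Cconj v * Vv)%C = 4 * PI * e * m ->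
  (Vu = Ci * RtoC (2 * PI * e) * u /\ Vv = Ci * RtoC (2 * PI * - e) * v)%C).
{ intros u v Vu Vv m e Hm Hu Hv HV HR HI.
  assert (Hu0 : u <> 0%C). { intros E. rewrite E Cmod_0 in Hu. lra. }
  assert (Hv0 : v <> 0%C). { intros E. rewrite E Cmod_0 in Hv. lra. }
  set (k := (Vu / u)%C).
  assert (EVu : Vu = (k * u)%C) by (unfold k; field; exact Hu0).
  assert (EVv : Vv = (- k * v)%C).
  { replace Vv with (((Vu * v + u * Vv) - Vu * v) / u)%C by (field; exact Hu0).
    rewrite HV. unfold k. field. exact Hu0. }
  rewrite EVu EVv in HR, HI |- *.
  replace (Cconj u * (k * u))%C with (k * (Cconj u * u))%C in HR, HI by ring.
  replace (Cconj v * (- k * v))%C with (- k * (Cconj v * v))%C in HR, HI by ring.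
  rewrite !Cconj_mult_self Hu Hv in HR, HI.
  assert (Ek : k = (Ci * RtoC (2 * PI * e))%C).
  { destruct k as [k1 k2]. unfold Re, Im in HR, HI; simpl in HR, HI.
    apply injective_projections; simpl; apply Rmult_eq_reg_r with m; lra. }
  rewrite Ek. split; [ring|]. replace (2 * PI * - e) with (- (2 * PI * e)) by ring.
  rewrite RtoC_opp. ring. }
destruct (Rot _ _ _ _ ma e2 Pa Mu1 Mv1 TV1 TVm1 El1') as [R1 R2].
destruct (Rot _ _ _ _ mb e3 Pb Mu2 Mv2 TV2 TVm2 El2') as [R3 R4].
now repeat split.
Qed.

(** * Fibers as torus orbits *)

Lemma Cder_shift g s d : Cder g 0 d -> Cder (fun t => g (t - s)) s d.
Proof.
intros [H1 H2].
assert (D : is_derive (fun t => t - s) s 1) by (auto_derive; [exact I|Rring]).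
split.
- eapply is_derive_val.
  + apply (is_derive_comp (fun t => Re (g t)) (fun t => t - s) s (Re d) 1); [|exact D].
    now replace (s - s) with 0 by ring.
  + Rring.
- eapply is_derive_val.
  + apply (is_derive_comp (fun t => Im (g t)) (fun t => t - s) s (Im d) 1); [|exact D].
    now replace (s - s) with 0 by ring.
  + Rring.
Qed.

Lemma fiber_line a b Phi x3 f r a1 a2 a3 e1 e2 e3 s :
  action_angle a b Phi x3 -> chamber a b (r, 0, 0) -> coord f ->
  Cder (fun t => f (Phi (r, 0, 0) (a1 + t * e1, a2 + t * e2, a3 + t * e3))) s
    (f (dPhi Phi ((r, 0, 0), (a1 + s * e1, a2 + s * e2, a3 + s * e3))
        ((0, 0, 0), (e1, e2, e3)))).
Proof.
intros HP Hch Hf.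
assert (D := Cder_shift _ s _ (dPhi_Cder a b Phi x3 f
  ((r, 0, 0), (a1 + s * e1, a2 + s * e2, a3 + s * e3)) ((0, 0, 0), (e1, e2, e3))
  HP (chamber_Bsm _ _ _ Hch) Hf)).
eapply Cder_ext; [|exact D]. intros t. unfold uncur. f_equal. f_equal.
- apply injective_projections; [apply injective_projections|]; Rring.
- apply injective_projections; [apply injective_projections|]; Rring.
Qed.

Lemma torus_orbit a b Phi x3 r s c1 c2 :
  action_angle a b Phi x3 -> chamber a b (r, 0, 0) ->
  let y := Phi (r, 0, 0) (s, 0, 0) in
  Phi (r, 0, 0) (s, c1, c2) =
  mkAmb (cz y) (cu1 y * cexp 0 (2 * PI * c1)) (cv1 y * cexp 0 (2 * PI * - c1))
    (cu2 y * cexp 0 (2 * PI * c2)) (cv2 y * cexp 0 (2 * PI * - c2)).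
Proof.
intros HP Hch y.
set (Y := fun t => Phi (r, 0, 0) (s + t * 0, 0 + t * c1, 0 + t * c2)).
assert (E0 : Y 0 = y) by (unfold Y, y; do 2 f_equal; [f_equal|]; ring).
assert (E1 : Y 1 = Phi (r, 0, 0) (s, c1, c2)) by (unfold Y; do 2 f_equal; [f_equal|]; ring).
assert (V := fun t => vertical_dPhi a b Phi x3 r (s + t * 0, 0 + t * c1, 0 + t * c2) 0 c1 c2 HP Hch).
assert (Rot : forall (f : amb -> C) (c : R), coord f ->
  (forall t : R, f (dPhi Phi ((r, 0, 0), (s + t * 0, 0 + t * c1, 0 + t * c2)) ((0, 0, 0), (0, c1, c2)))
    = (Ci * RtoC (2 * PI * c) * f (Y t))%C) ->
  f (Y 1) = (f y * cexp 0 (2 * PI * c))%C).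
{ intros f c Hf H. rewrite -E0.
  rewrite (rotation_flow (fun t => f (Y t)) (fun _ => 2 * PI * c) (fun t => t * (2 * PI * c))
    _ _ _ 1); [now rewrite Rmult_1_l| | |apply Rmult_0_l].
  - intros t. rewrite -H. now apply (fiber_line a b Phi x3).
  - intros t. auto_derive; [exact I|Rring]. }
rewrite -E1.
assert (Hz : cz (Y 1) = cz y).
{ rewrite (Rot cz 0); [| unfold coord; tauto |].
  - rewrite Rmult_0_r cexp_0. ring.
  - intros t. rewrite (proj1 (V t)). fold (Y t). f_equal. f_equal. f_equal. unfold Rdiv. ring. }
rewrite -Hz -(Rot cu1 c1) -?(Rot cv1 (- c1)) -?(Rot cu2 c2) -?(Rot cv2 (- c2));
  try (unfold coord; tauto); try (intros t; apply (proj2 (V t) eq_refl)).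
now destruct (Y 1).
Qed.

(** Two points of a fiber with the same [z] have the same products [u_j v_j] and
    the same moduli, hence differ by a rotation of each pair (u_j, v_j). *)
Lemma fiber_orbit a b Phi x3 r s y :
  action_angle a b Phi x3 -> chamber a b (r, 0, 0) -> Y0 a b y -> rho y = (r, 0, 0) ->
  (exists c1 c2, y = Phi (r, 0, 0) (s, c1, c2)) <-> cz y = cz (Phi (r, 0, 0) (s, 0, 0)).
Proof.
intros HP Hch Hy Ry. split.
- intros [c1 [c2 ->]]. now rewrite (torus_orbit a b Phi x3 r s c1 c2 HP Hch).
- intros Ez. set (y0 := Phi (r, 0, 0) (s, 0, 0)) in *.
  assert (HB := chamber_Bsm _ _ _ Hch).
  assert (Hy0 : Y0 a b y0) by now apply (aa_Y0 _ _ _ _ HP).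
  assert (Ry0 : rho y0 = (r, 0, 0)) by now apply (aa_rho _ _ _ _ HP).
  destruct (fiber_moduli a b y r Hy Ry) as [Mu1 [_ [Mu2 _]]].
  destruct (fiber_moduli a b y0 r Hy0 Ry0) as [Nu1 [_ [Nu2 _]]].
  destruct Hy as [_ [P1 P2]]. destruct Hy0 as [_ [Q1 Q2]].
  rewrite -Ez in Nu1, Nu2, Q1, Q2.
  assert (Mz := rho_r _ _ _ _ Ry).
  assert (Hr : Rabs b < r < Rabs a) by exact Hch.
  assert (Pa : 0 < Cmod (cz y - RtoC a)%C).
  { generalize (Cmod_minus_ge (cz y) a). rewrite Mz. unfold Rabs at 1; destruct Rcase_abs; lra. }
  assert (Pb : 0 < Cmod (cz y - RtoC b)%C).
  { generalize (Cmod_minus_ge (cz y) b). rewrite Mz. unfold Rabs at 1; destruct Rcase_abs; lra. }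
  assert (K : forall (u v u0 v0 c : C), 0 < Cmod c -> (u * v)%C = c -> (u0 * v0)%C = c ->
    Cmod u ^ 2 = Cmod c -> Cmod u0 ^ 2 = Cmod c ->
    exists e, u = (u0 * cexp 0 (2 * PI * e))%C /\ v = (v0 * cexp 0 (2 * PI * - e))%C).
  { intros u v u0 v0 c Hc E E' Hu Hu0.
    assert (U : u <> 0%C). { intros Z; rewrite Z Cmod_0 in Hu; lra. }
    assert (U0 : u0 <> 0%C). { intros Z; rewrite Z Cmod_0 in Hu0; lra. }
    assert (Q : (u / u0)%C <> 0%C).
    { intros Z. apply U. replace u with (u / u0 * u0)%C by (field; exact U0). rewrite Z; ring. }
    destruct (polar _ Q) as [t [_ Et]].
    assert (M : Cmod (u / u0)%C = 1).
    { unfold Cdiv. rewrite Cmod_mult Cmod_inv; [|exact U0].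
      assert (0 < Cmod u0) by now apply Cmod_gt_0. assert (0 <= Cmod u) by apply Cmod_ge_0.
      assert (Cmod u = Cmod u0) by nra. rewrite H1. field. lra. }
    rewrite M ln_1 in Et.
    exists (t / (2 * PI)). replace (2 * PI * (t / (2 * PI))) with t by (field; generalize PI_RGT_0; lra).
    replace (2 * PI * - (t / (2 * PI))) with (- t) by (field; generalize PI_RGT_0; lra).
    assert (Eu : u = (u0 * cexp 0 t)%C) by (rewrite -Et; field; exact U0).
    split; [exact Eu|].
    replace v with ((u * v) / u)%C by (field; exact U).
    replace v0 with ((u0 * v0) / u0)%C by (field; exact U0).
    rewrite E E' Eu. rewrite -{2}Ropp_0 -cexp_inv. field. split; [apply cexp_neq_0|exact U0]. }
  destruct (K _ _ _ _ _ Pa P1 Q1 Mu1 Nu1) as [c1 [R1 R2]].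
  destruct (K _ _ _ _ _ Pb P2 Q2 Mu2 Nu2) as [c2 [R3 R4]].
  exists c1, c2. rewrite (torus_orbit a b Phi x3 r s c1 c2 HP Hch). fold y0.
  rewrite -R1 -R2 -R3 -R4 -Ez. now destruct y.
Qed.

(** * The time needed to turn by a given angle *)

Definition pt (r phi : R) : C := (RtoC r * cexp 0 phi)%C.

Lemma Cmod_pt r phi : 0 <= r -> Cmod (pt r phi) = r.
Proof. intros H. unfold pt. rewrite Cmod_mult Cmod_cexp exp_0 Cmod_R Rabs_pos_eq; lra. Qed.

(** The squared distance between [pt r phi] and the real point [c]. *)
Definition dist2 (c r phi : R) : R := r ^ 2 - 2 * c * r * cos phi + c ^ 2.

Lemma Cmod_pt_minus c r phi : Cmod (pt r phi - RtoC c)%C = sqrt (dist2 c r phi).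
Proof.
rewrite -(sqrt_pow2 (Cmod _)); [|apply Cmod_ge_0]. f_equal. rewrite Cmod_sqr.
unfold pt, cexp, dist2. rewrite exp_0. unfold Re, Im; simpl.
generalize (sin2_cos2 phi); unfold Rsqr; intros H.
replace (sin phi) with (sin phi) by ring.
transitivity (r * r * (sin phi * sin phi + cos phi * cos phi) - 2 * c * r * cos phi + c * c); [ring|].
rewrite H. ring.
Qed.

Lemma dist2_ge c r phi : 0 <= r -> (r - Rabs c) ^ 2 <= dist2 c r phi.
Proof.
intros H. unfold dist2. destruct (COS_bound phi) as [B1 B2].
assert (K : c * cos phi <= Rabs c) by (unfold Rabs; destruct Rcase_abs; nra).
assert (S : Rabs c ^ 2 = c ^ 2) by (rewrite pow2_abs; reflexivity).
assert (r * (c * cos phi) <= r * Rabs c) by (apply Rmult_le_compat_l; lra).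
replace ((r - Rabs c) ^ 2) with (r ^ 2 - 2 * (r * Rabs c) + Rabs c ^ 2) by ring. rewrite S. lra.
Qed.

Lemma dist2_pos c r phi : 0 <= r -> r <> Rabs c -> 0 < dist2 c r phi.
Proof.
intros H Hc. eapply Rlt_le_trans; [|now apply dist2_ge].
assert (r - Rabs c <> 0) by lra. nra.
Qed.

(** The inverse of the angular velocity of the flow, i.e. [r / (2 * PI)] times
    [density] at [pt r phi] ([weight_density]). *)
Definition weight (a b r phi : R) : R :=
  r / (2 * PI) * (/ r ^ 2 + / (2 * sqrt (dist2 a r phi)) + / (2 * sqrt (dist2 b r phi))).

Lemma weight_density a b r phi : 0 <= r -> weight a b r phi = r / (2 * PI) * density a b (pt r phi).
Proof. intros H. unfold weight, density. now rewrite Cmod_pt // !Cmod_pt_minus. Qed.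

Lemma weight_continuous a b r phi : 0 < r -> r <> Rabs a -> r <> Rabs b ->
  continuous (weight a b r) phi.
Proof.
intros Hr Ha Hb. apply (ex_derive_continuous (weight a b r) phi).
assert (Pa := dist2_pos a r phi (Rlt_le _ _ Hr) Ha).
assert (Pb := dist2_pos b r phi (Rlt_le _ _ Hr) Hb).
unfold weight, dist2, Rminus in *. auto_derive.
assert (Sa := sqrt_lt_R0 _ Pa). assert (Sb := sqrt_lt_R0 _ Pb).
simpl in *. repeat split; lra.
Qed.

(** The circle of radius [r] avoids [a] and [b], whatever their signs. *)
Definition regular (a b r : R) : Prop := 0 < r /\ r <> Rabs a /\ r <> Rabs b.

Lemma chamber_regular a b r : Rabs b < r < Rabs a -> regular a b r.
Proof. intros H; unfold regular; generalize (Rabs_pos b); repeat split; lra. Qed.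

Lemma weight_lower a b r phi : regular a b r -> / (2 * PI * r) <= weight a b r phi.
Proof.
intros [Hr [Ha Hb]].
assert (Pa := sqrt_lt_R0 _ (dist2_pos a r phi (Rlt_le _ _ Hr) Ha)).
assert (Pb := sqrt_lt_R0 _ (dist2_pos b r phi (Rlt_le _ _ Hr) Hb)).
unfold weight. set (x := sqrt (dist2 a r phi)) in *. set (y := sqrt (dist2 b r phi)) in *.
assert (0 < / (2 * x)) by (apply Rinv_0_lt_compat; lra).
assert (0 < / (2 * y)) by (apply Rinv_0_lt_compat; lra).
assert (Ppi := PI_RGT_0).
assert (0 < r / (2 * PI)) by (apply Rdiv_lt_0_compat; lra).
apply Rle_trans with (r / (2 * PI) * (/ r ^ 2)); [apply Req_le; field; lra|].
apply Rmult_le_compat_l; lra.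
Qed.

Lemma weight_pos a b r phi : regular a b r -> 0 < weight a b r phi.
Proof.
intros H. eapply Rlt_le_trans; [|now apply weight_lower].
apply Rinv_0_lt_compat. destruct H. generalize PI_RGT_0. nra.
Qed.

Definition flow_time (a b r phi : R) : R := RInt (weight a b r) 0 phi.

Lemma is_derive_flow_time a b r phi : regular a b r ->
  is_derive (flow_time a b r) phi (weight a b r phi).
Proof.
intros [Hr [Ha Hb]]. unfold flow_time.
assert (C : forall x, continuous (weight a b r) x) by (intros; now apply weight_continuous).
apply (is_derive_RInt (weight a b r) _ 0); [|apply C].
apply filter_forall. intros y. apply (RInt_correct (V := R_CompleteNormedModule)).
apply (ex_RInt_continuous (V := R_CompleteNormedModule)). intros; apply C.
Qed.

Lemma flow_time_0 a b r : flow_time a b r 0 = 0.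
Proof. unfold flow_time. now rewrite RInt_point. Qed.

Lemma flow_time_incr a b r x y : regular a b r -> x < y -> flow_time a b r x < flow_time a b r y.
Proof.
intros H L.
apply (incr_function (flow_time a b r) m_infty p_infty (weight a b r)); try exact I; try exact L.
- intros z _ _. now apply is_derive_flow_time.
- intros z _ _. now apply weight_pos.
Qed.

Lemma flow_time_inj a b r x y : regular a b r -> flow_time a b r x = flow_time a b r y -> x = y.
Proof.
intros H E. destruct (Rtotal_order x y) as [L|[L|L]]; [|exact L|];
 generalize (flow_time_incr a b r _ _ H L); lra.
Qed.

Definition period (a b r : R) : R := flow_time a b r (2 * PI).

Lemma period_pos a b r : regular a b r -> 0 < period a b r.
Proof.
intros H. rewrite -(flow_time_0 a b r). apply flow_time_incr; [exact H|].
generalize PI_RGT_0; lra.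
Qed.

Lemma flow_time_2PI a b r phi : regular a b r ->
  flow_time a b r (phi + 2 * PI) = flow_time a b r phi + period a b r.
Proof.
intros H.
assert (D : forall t, is_derive (fun s => flow_time a b r (s + 2 * PI) - flow_time a b r s) t 0).
{ intros t. eapply is_derive_val.
  - apply is_derive_minR; [|now apply is_derive_flow_time].
    apply (is_derive_comp (flow_time a b r) (fun s => s + 2 * PI)).
    + now apply is_derive_flow_time.
    + instantiate (1 := 1). auto_derive; [exact I|Rring].
  - unfold weight, dist2. rewrite (cos_plus t) cos_2PI sin_2PI.
    replace (cos t * 1 - sin t * 0) with (cos t) by ring. Rring. }
assert (E := is_derive_0_const _ D phi 0). simpl in E.
rewrite flow_time_0 Rplus_0_l in E. unfold period. lra.
Qed.

Lemma flow_time_period a b r phi (k : Z) : regular a b r ->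
  flow_time a b r (phi + 2 * PI * IZR k) = flow_time a b r phi + IZR k * period a b r.
Proof.
intros H.
assert (N : forall (n : nat) t, flow_time a b r (t + 2 * PI * INR n) =
   flow_time a b r t + INR n * period a b r).
{ induction n as [|n IH]; intros t.
  - simpl. rewrite !Rmult_0_r Rmult_0_l !Rplus_0_r. reflexivity.
  - rewrite S_INR. replace (t + 2 * PI * (INR n + 1)) with ((t + 2 * PI * INR n) + 2 * PI) by ring.
    rewrite flow_time_2PI // IH. ring. }
destruct (Z.le_ge_cases 0 k) as [Hk|Hk].
- rewrite -(Z2Nat.id k Hk) -INR_IZR_INZ. apply N.
- assert (E := N (Z.to_nat (- k)) (phi + 2 * PI * IZR k)).
  rewrite INR_IZR_INZ Z2Nat.id in E; [|lia]. rewrite opp_IZR in E.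
  replace (phi + 2 * PI * IZR k + 2 * PI * - IZR k) with phi in E by ring. lra.
Qed.

(** The weight is even and 2 PI-periodic in the angle, so half a turn takes half
    a period. *)
Lemma flow_time_PI a b r (k : Z) : regular a b r ->
  flow_time a b r (PI + 2 * PI * IZR k) = (IZR k + / 2) * period a b r.
Proof.
intros H. rewrite flow_time_period //.
assert (D : forall t, is_derive (fun s => flow_time a b r s + flow_time a b r (- s)) t 0).
{ intros t. eapply is_derive_val.
  - apply is_derive_addR; [now apply is_derive_flow_time|].
    apply (is_derive_comp (flow_time a b r) (fun s => - s)).
    + now apply is_derive_flow_time.
    + instantiate (1 := -1). auto_derive; [exact I|Rring].
  - unfold weight, dist2. rewrite cos_neg. Rring. }
assert (E := is_derive_0_const _ D PI 0). simpl in E. rewrite Ropp_0 flow_time_0 in E.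
assert (E2 := flow_time_2PI a b r (- PI) H). replace (- PI + 2 * PI) with PI in E2 by ring.
lra.
Qed.

Lemma cos_eq_1 x : cos x = 1 -> exists k : Z, x = 2 * PI * IZR k.
Proof.
intros H. assert (S : sin (x / 2) = 0).
{ assert (E := cos_2a_sin (x / 2)). replace (2 * (x / 2)) with x in E by field. nra. }
destruct (sin_eq_0_0 _ S) as [k Hk]. exists k. lra.
Qed.

Lemma pt_inj r phi psi : 0 < r -> pt r phi = pt r psi ->
  exists k : Z, phi = psi + 2 * PI * IZR k.
Proof.
intros Hr E.
assert (E1 : cexp 0 phi = cexp 0 psi).
{ unfold pt in E. assert (Hr0 : RtoC r <> 0%C) by (intros Z; injection Z; lra).
  replace (cexp 0 phi) with (/ RtoC r * (RtoC r * cexp 0 phi))%C by (field; exact Hr0).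
  rewrite E. field. exact Hr0. }
assert (E2 : cexp 0 (phi - psi) = 1%C).
{ replace (phi - psi) with (phi + - psi) by ring. rewrite -{1}(Rplus_0_r 0) -cexp_mult E1 cexp_mult.
  rewrite Rplus_0_r Rplus_opp_r. apply cexp_0. }
unfold cexp in E2. rewrite exp_0 !Rmult_1_l in E2. injection E2; intros _ C.
destruct (cos_eq_1 _ C) as [k Hk]. exists k. lra.
Qed.

Lemma pt_period r phi (k : Z) : pt r (phi + 2 * PI * IZR k) = pt r phi.
Proof. unfold pt. now rewrite cexp_period. Qed.

Lemma is_derive_continuous (f : R -> R) x l : is_derive f x l -> continuous f x.
Proof. intros H. apply (ex_derive_continuous f x). now exists l. Qed.

Lemma Cder_continuous_Cmod f t d : Cder f t d -> continuous (fun s => Cmod (f s)) t.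
Proof.
intros H. apply Cder_Cmod_sqr, is_derive_continuous in H.
apply (continuous_ext (fun s => sqrt (Cmod (f s) ^ 2))).
{ intros s. apply sqrt_pow2, Cmod_ge_0. }
apply (continuous_comp (fun s => Cmod (f s) ^ 2) sqrt _ H). apply continuous_sqrt.
Qed.

Lemma continuous_invR (f : R -> R) x : continuous f x -> f x <> 0 -> continuous (fun t => / f t) x.
Proof. intros H H0. apply (continuous_comp f Rinv x H). now apply continuous_Rinv. Qed.

Lemma density_continuous a b (g : R -> C) t d : Cder g t d ->
  g t <> 0%C -> g t <> RtoC a -> g t <> RtoC b -> continuous (fun s => density a b (g s)) t.
Proof.
intros H H0 Ha Hb. unfold density.
assert (N : forall c : C, g t <> c -> Cmod (g t - c)%C <> 0).
{ intros c Hc E. apply Hc. apply Cmod_eq_0 in E.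
  replace (g t) with ((g t - c) + c)%C by ring. rewrite E; ring. }
apply (continuous_plus (fun s => / Cmod (g s) ^ 2 + / (2 * Cmod (g s - RtoC a)%C))
   (fun s => / (2 * Cmod (g s - RtoC b)%C))).
- apply (continuous_plus (fun s => / Cmod (g s) ^ 2) (fun s => / (2 * Cmod (g s - RtoC a)%C))).
  + apply continuous_invR.
    * eapply is_derive_continuous. apply (Cder_Cmod_sqr _ _ _ H).
    * apply pow_nonzero. intros E. apply H0. now apply Cmod_eq_0.
  + apply continuous_invR.
    * apply (continuous_mult (fun _ => 2) (fun s => Cmod (g s - RtoC a)%C)); [apply continuous_const|].
      eapply Cder_continuous_Cmod. apply Cder_minus_const. exact H.
    * specialize (N _ Ha). lra.
- apply continuous_invR.
  + apply (continuous_mult (fun _ => 2) (fun s => Cmod (g s - RtoC b)%C)); [apply continuous_const|].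
    eapply Cder_continuous_Cmod. apply Cder_minus_const. exact H.
  + specialize (N _ Hb). lra.
Qed.

(** The argument [th s] of the flow line has the inverse of the weight as its
    derivative, so the flow time of [th s] has derivative 1: [flow_time] and [th]
    are inverse to each other. *)
Lemma angle_flow a b Phi x3 r :
  action_angle a b Phi x3 -> chamber a b (r, 0, 0) ->
  forall phi, cz (Phi (r, 0, 0) (flow_time a b r phi, 0, 0)) = pt r phi.
Proof.
intros HP Hch.
assert (Hr : Rabs b < r < Rabs a) by exact Hch.
assert (Reg := chamber_regular a b r Hr).
assert (Hr0 : 0 < r) by apply Reg.
assert (HB := chamber_Bsm _ _ _ Hch).
set (Z := fun s => cz (Phi (r, 0, 0) (s, 0, 0))).
set (tau := fun s => 2 * PI / (r * density a b (Z s))).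
assert (Mz : forall s, Cmod (Z s) = r).
{ intros s. apply (rho_r _ r 0 0). now apply (aa_rho _ _ _ _ HP). }
assert (NZ : forall s, Z s <> 0%C /\ Z s <> RtoC a /\ Z s <> RtoC b).
{ intros s. repeat split; intros E; generalize (Mz s); rewrite E ?Cmod_0 ?Cmod_R; lra. }
assert (Dpos : forall s, 0 < density a b (Z s)) by (intros s; apply density_pos; apply NZ).
assert (DZ : forall s, Cder Z s (Ci * RtoC (tau s) * Z s)%C).
{ intros s.
  assert (D := fiber_line a b Phi x3 cz r 0 0 0 1 0 0 s HP Hch (or_introl eq_refl)).
  rewrite (proj1 (vertical_dPhi a b Phi x3 r _ 1 0 0 HP Hch)) in D.
  assert (E : forall t, (0 + t * 1, 0 + t * 0, 0 + t * 0) = (t, 0, 0)) by (intros t; f_equal; [f_equal|]; ring).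
  rewrite E in D. fold (Z s) in D. rewrite Rmult_1_r in D.
  eapply Cder_ext; [|exact D]. intros t. cbv beta. rewrite E. reflexivity. }
assert (Ctau : forall s, continuous tau s).
{ intros s. unfold tau. apply (continuous_mult (fun _ => 2 * PI) (fun s => / (r * density a b (Z s)))).
  - apply continuous_const.
  - apply continuous_invR.
    + apply (continuous_mult (fun _ => r) (fun s => density a b (Z s))); [apply continuous_const|].
      destruct (NZ s) as [N0 [Na Nb]]. now apply (density_continuous a b Z s _ (DZ s)).
    + generalize (Dpos s); nra. }
set (th := fun s => RInt tau 0 s).
assert (Dth : forall s, is_derive th s (tau s)) by (intros s; now apply is_derive_primitive).
assert (th0 : th 0 = 0) by (unfold th; now rewrite RInt_point).
assert (Z0 : Z 0 = RtoC r).
{ destruct (aa_zero _ _ _ _ HP _ HB) as [_ [[P1 P2] _]]. fold (Z 0) in P1, P2.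
  assert (S := Cmod_sqr (Z 0)). rewrite Mz P2 in S.
  apply injective_projections; [|exact P2]. unfold Re in *. simpl. nra. }
assert (ZE : forall s, Z s = pt r (th s)).
{ intros s. rewrite (rotation_flow Z tau th DZ Dth th0 s) Z0. reflexivity. }
assert (BT : forall s, flow_time a b r (th s) = s).
{ intros s.
  assert (D : forall t, is_derive (fun s => flow_time a b r (th s) - s) t 0).
  { intros t. eapply is_derive_val.
    - apply is_derive_minR; [|apply is_derive_id].
      apply (is_derive_comp (flow_time a b r) th); [now apply is_derive_flow_time|apply Dth].
    - change (tau t * weight a b r (th t) - 1 = 0).
      rewrite weight_density; [|lra]. rewrite -ZE. unfold tau. field.
      generalize (Dpos t) PI_RGT_0; intros; repeat split; lra. }
  assert (E := is_derive_0_const _ D s 0). simpl in E. rewrite th0 flow_time_0 in E. lra. }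
intros phi. fold (Z (flow_time a b r phi)). rewrite ZE. f_equal.
apply (flow_time_inj a b r _ _ Reg). apply BT.
Qed.

Lemma flow_time_surj a b r v : regular a b r -> exists phi, flow_time a b r phi = v.
Proof.
intros Reg. assert (PT := period_pos a b r Reg). set (T := period a b r) in *.
set (N := up (Rabs v / T)).
destruct (IVT_gen (flow_time a b r) (- (2 * PI * IZR N)) (2 * PI * IZR N) v) as [x [_ Hx]].
- intros x. apply continuity_pt_filterlim.
  exact (is_derive_continuous _ _ _ (is_derive_flow_time a b r x Reg)).
- replace (- (2 * PI * IZR N)) with (0 + 2 * PI * IZR (- N)) by (rewrite opp_IZR; ring).
  replace (2 * PI * IZR N) with (0 + 2 * PI * IZR N) by ring.
  rewrite !flow_time_period // flow_time_0 opp_IZR. fold T.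
  assert (U := proj1 (archimed (Rabs v / T))). fold N in U.
  apply Rmult_lt_compat_r with (r := T) in U; [|exact PT].
  replace (Rabs v / T * T) with (Rabs v) in U by (field; lra).
  generalize (Rle_abs v) (Rle_abs (- v)). rewrite Rabs_Ropp. intros.
  unfold Rmin, Rmax; repeat destruct Rle_dec; lra.
- now exists x.
Qed.

(** * The slope of the action coordinate *)

Definition x3_slope (x3 : R3 -> R) (r : R) : R := fst (fst (grad x3 (r, 0, 0))).

(** The dr-coefficients of the period lattice are the multiples of [x3_slope]; by
    [angle_flow] and [fiber_orbit] they are also the multiples of [period].  Two
    generators of the same infinite cyclic group agree up to sign. *)
Lemma x3_slope_period a b Phi x3 r :
  action_angle a b Phi x3 -> chamber a b (r, 0, 0) ->
  x3_slope x3 r = period a b r \/ x3_slope x3 r = - period a b r.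
Proof.
intros HP Hch.
assert (Hr : Rabs b < r < Rabs a) by exact Hch.
assert (Reg := chamber_regular a b r Hr).
assert (Hr0 : 0 < r) by apply Reg.
assert (HB := chamber_Bsm _ _ _ Hch).
assert (Per := proj2 (aa_chamber _ _ _ _ HP) (r, 0, 0) Hch).
assert (AF := angle_flow a b Phi x3 r HP Hch).
set (T := period a b r). assert (PT : 0 < T) by now apply period_pos.
set (g := x3_slope x3 r).
(* dx_3 is a period of Phi, so its dr-coefficient brings z back to the positive axis *)
assert (H1 : exists k : Z, g = IZR k * T).
{ set (c := cov x3 (r, 0, 0) 0 0 1).
  assert (E : Phi (r, 0, 0) c = Phi (r, 0, 0) (0, 0, 0)).
  { apply Per. exists 0%Z, 0%Z, 1%Z. fold c. destruct c as [[c1 c2] c3].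
    apply injective_projections; [apply injective_projections|]; Rring. }
  assert (Ec : c = (g, snd (fst c), snd c)).
  { unfold c, cov; simpl. unfold g, x3_slope; simpl. f_equal. f_equal. ring. }
  assert (Z1 : cz (Phi (r, 0, 0) (g, 0, 0)) = pt r 0).
  { rewrite -AF flow_time_0 -E Ec. now rewrite (torus_orbit a b Phi x3 r g (snd (fst c)) (snd c) HP Hch). }
  assert (S := flow_time_surj a b r g Reg).
  destruct S as [phi Hphi]. rewrite -Hphi AF in Z1.
  destruct (pt_inj r _ _ Hr0 Z1) as [k Hk]. exists k.
  rewrite -Hphi Hk flow_time_period // flow_time_0. unfold T; ring. }
assert (H2 : exists m : Z, T = IZR m * g).
{ assert (Ez : cz (Phi (r, 0, 0) (0, 0, 0)) = cz (Phi (r, 0, 0) (T, 0, 0))).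
  { assert (A0 := AF 0). rewrite flow_time_0 in A0. rewrite A0. unfold T, period. rewrite AF.
    rewrite -(pt_period r 0 1). f_equal. ring. }
  apply (fiber_orbit a b Phi x3 r T _ HP Hch) in Ez.
  - destruct Ez as [c1 [c2 E]]. symmetry in E. apply Per in E.
    destruct E as [m1 [m2 [m3 E]]]. exists m3.
    apply (f_equal (fun q : R3 => fst (fst q))) in E. 
    change (T - 0 = IZR m3 * g) in E. lra.
  - now apply (aa_Y0 _ _ _ _ HP).
  - now apply (aa_rho _ _ _ _ HP). }
destruct H1 as [k Hk], H2 as [m Hm].
assert (E : (m * k = 1)%Z).
{ apply eq_IZR. rewrite mult_IZR. apply Rmult_eq_reg_r with T; [|lra].
  rewrite Rmult_assoc -Hk -Hm. ring. }
assert (K : (k = 1 \/ k = -1)%Z) by (apply Z.mul_eq_1 with m; lia).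
destruct K as [-> | ->]; [left|right]; rewrite Hk; ring.
Qed.

(** The directional derivative supplied by smoothness is itself continuous.
    As the slope has no zeros, its sign is then constant. *)
Lemma x3_derive a b Phi x3 r :
  action_angle a b Phi x3 -> chamber a b (r, 0, 0) ->
  is_derive (fun s => x3 (s, 0, 0)) r (x3_slope x3 r) /\ continuous (x3_slope x3) r.
Proof.
intros HP Hch.
destruct (proj1 (aa_chamber _ _ _ _ HP) 1%nat) as [_ H].
destruct (H ((1, 0, 0) : R3)) as [g [Hg Cg]].
assert (Line : forall s t, plus ((s, 0, 0) : R3) (scal t ((1, 0, 0) : R3)) = (s + t, 0, 0)).
{ intros s t. apply injective_projections; [apply injective_projections|]; Rring. }
assert (D : forall s, chamber a b (s, 0, 0) -> is_derive (fun t => x3 (t, 0, 0)) s (g (s, 0, 0)) /\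
   x3_slope x3 s = g (s, 0, 0)).
{ intros s Hs. specialize (Hg (s, 0, 0) Hs). split.
  - assert (D1 : is_derive (fun t => t - s) s 1) by (auto_derive; [exact I|Rring]).
    assert (E0 : s - s = 0) by ring. rewrite -E0 in Hg.
    assert (D := is_derive_comp _ (fun t => t - s) s _ 1 Hg D1).
    rewrite E0 in D. eapply is_derive_val; [eapply is_derive_ext; [|exact D]|].
    + intros t. cbv beta. rewrite Line. now rewrite Rplus_minus.
    + Rring.
  - unfold x3_slope, grad, dirR. simpl fst. apply is_derive_unique. exact Hg. }
split.
- destruct (D r Hch) as [D1 ->]. exact D1.
- apply (continuous_ext_loc _ (fun s => g (s, 0, 0))).
  + assert (Hr : Rabs b < r < Rabs a) by exact Hch.
    assert (P : 0 < Rmin (r - Rabs b) (Rabs a - r)) by (apply Rmin_pos; lra).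
    exists (mkposreal _ P). intros s Hs.
    change (Rabs (s - r) < Rmin (r - Rabs b) (Rabs a - r)) in Hs.
    apply Rabs_def2 in Hs.
    generalize (Rmin_l (r - Rabs b) (Rabs a - r)) (Rmin_r (r - Rabs b) (Rabs a - r)). intros.
    symmetry. apply D. unfold chamber; simpl. lra.
  + apply (continuous_comp (fun s : R => (s, 0, 0) : R3) g).
    * apply (continuous_comp_2 (fun s : R => (s, 0) : R * R) (fun _ => 0) (fun p q => (p, q) : R3)).
      -- apply (continuous_comp_2 (fun s : R => s) (fun _ => 0) (fun p q => (p, q) : R * R)).
         ++ apply continuous_id.
         ++ apply continuous_const.
         ++ apply continuous_ext with (f := fun x => x); [now intros [x y]|apply continuous_id].
      -- apply continuous_const.
      -- apply continuous_ext with (f := fun x => x); [now intros [x y]|apply continuous_id].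
    * apply Cg. exact Hch.
Qed.

(** * Continuous functions on an interval *)

Lemma continuous_eps (f : R -> R) x :
  continuous f x <-> forall eps, 0 < eps -> exists d, 0 < d /\
    forall y, Rabs (y - x) < d -> Rabs (f y - f x) < eps.
Proof.
split.
- intros H eps Heps. apply (filterlim_locally (F := locally x) f (f x)) with (eps := mkposreal eps Heps) in H.
  destruct H as [d Hd]. exists d; split; [apply cond_pos|]. intros y Hy. now apply Hd.
- intros H. apply (filterlim_locally (F := locally x) f (f x)). intros eps.
  destruct (H eps (cond_pos eps)) as [d [Hd Hy]]. exists (mkposreal d Hd). intros y B. now apply Hy.
Qed.

Definition clamp (p q x : R) : R := Rmax p (Rmin x q).

Lemma clamp_range p q x : p <= q -> p <= clamp p q x <= q.
Proof. intros H. unfold clamp, Rmax, Rmin; repeat destruct Rle_dec; lra. Qed.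

Lemma clamp_id p q x : p <= x <= q -> clamp p q x = x.
Proof. intros H. unfold clamp, Rmax, Rmin; repeat destruct Rle_dec; lra. Qed.

Lemma clamp_lip p q x y : Rabs (clamp p q x - clamp p q y) <= Rabs (x - y).
Proof.
unfold clamp, Rmax, Rmin; repeat destruct Rle_dec; unfold Rabs; repeat destruct Rcase_abs; lra.
Qed.

Lemma continuous_clamp p q x : continuous (clamp p q) x.
Proof.
apply continuous_eps. intros eps Heps. exists eps; split; [exact Heps|]. intros y Hy.
eapply Rle_lt_trans; [apply clamp_lip|exact Hy].
Qed.

(** Stating [M] on all of [R] and clamping the argument makes the inverse total,
    with the values [p] and [q] outside the range of [M]. *)
Lemma monotone_inverse (M : R -> R) p q : p < q -> (forall t, continuous M t) ->
  (forall x y, p <= x -> x < y -> y <= q -> M x < M y) ->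
  exists g : R -> R, (forall x, continuous g x) /\ (forall x, p <= g x <= q) /\
    (forall x, M (g x) = clamp (M p) (M q) x) /\ (forall t, p <= t <= q -> g (M t) = t).
Proof.
intros Hpq HM Inc.
assert (Hpq' : M p < M q) by (apply Inc; lra).
assert (Pf : forall x, Rmin (M p) (M q) <= clamp (M p) (M q) x <= Rmax (M p) (M q)).
{ intros x. rewrite Rmin_left ?Rmax_right; try lra. apply clamp_range; lra. }
assert (CM : continuity M) by (intros t; apply continuity_pt_filterlim, HM).
set (g := fun x => proj1_sig (IVT_gen M p q _ CM (Pf x))).
assert (Rg : forall x, p <= g x <= q).
{ intros x. unfold g. destruct (IVT_gen M p q _ CM (Pf x)) as [t [Ht E]]. simpl.
  rewrite -> Rmin_left, Rmax_right in Ht; lra. }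
assert (Eg : forall x, M (g x) = clamp (M p) (M q) x).
{ intros x. unfold g. now destruct (IVT_gen M p q _ CM (Pf x)) as [t [Ht E]]. }
assert (Le : forall x y, p <= x <= q -> p <= y <= q -> M x < M y -> x < y).
{ intros x y Hx Hy L. destruct (Rtotal_order x y) as [H|[H|H]]; [exact H| |].
  - rewrite H in L; lra.
  - assert (M y < M x) by (apply Inc; lra). lra. }
exists g. split; [|split; [exact Rg|split; [exact Eg|]]].
- intros x0. apply continuous_eps. intros eps Heps. set (t0 := g x0).
  assert (R0 : p <= t0 <= q) by apply Rg.
  assert (Up : exists d, 0 < d /\ forall x, Rabs (x - x0) < d -> g x < t0 + eps).
  { destruct (Rle_dec (t0 + eps) q) as [H|H].
    - exists (M (t0 + eps) - M t0). split.
      + assert (M t0 < M (t0 + eps)) by (apply Inc; lra). lra.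
      + intros x Hx. apply Le; [apply Rg|lra|]. rewrite Eg.
        assert (L := clamp_lip (M p) (M q) x x0). rewrite -!Eg in L |- *.
        fold t0 in L. apply Rabs_le_between in L. lra.
    - exists 1; split; [lra|]. intros x _. generalize (Rg x); lra. }
  assert (Dn : exists d, 0 < d /\ forall x, Rabs (x - x0) < d -> t0 - eps < g x).
  { destruct (Rle_dec p (t0 - eps)) as [H|H].
    - exists (M t0 - M (t0 - eps)). split.
      + assert (M (t0 - eps) < M t0) by (apply Inc; lra). lra.
      + intros x Hx. apply Le; [lra|apply Rg|]. 
        assert (L := clamp_lip (M p) (M q) x x0). rewrite -!Eg in L.
        fold t0 in L. apply Rabs_le_between in L. lra.
    - exists 1; split; [lra|]. intros x _. generalize (Rg x); lra. }
  destruct Up as [d1 [Hd1 U]], Dn as [d2 [Hd2 D]].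
  exists (Rmin d1 d2); split; [now apply Rmin_pos|]. intros x Hx.
  specialize (U x (Rlt_le_trans _ _ _ Hx (Rmin_l _ _))).
  specialize (D x (Rlt_le_trans _ _ _ Hx (Rmin_r _ _))).
  apply Rabs_def1; lra.
- intros t Ht.
  assert (B : M p <= M t <= M q).
  { split.
    - destruct (Req_dec p t) as [->|N]; [lra|]. left; apply Inc; lra.
    - destruct (Req_dec t q) as [->|N]; [lra|]. left; apply Inc; lra. }
  assert (E := Eg (M t)). rewrite clamp_id in E; [|exact B].
  destruct (Rtotal_order (g (M t)) t) as [H|[H|H]]; [|exact H|];
   [assert (M (g (M t)) < M t)|assert (M t < M (g (M t)))]; try (apply Inc; generalize (Rg (M t)); lra); lra.
Qed.

Definition lim_at_left_end (p q : R) (f : R -> R) (l : R) : Prop :=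
  forall eps, 0 < eps -> exists d, 0 < d /\
    forall x, p < x < q -> x < p + d -> Rabs (f x - l) < eps.

Definition lim_at_right_end (p q : R) (f : R -> R) (l : R) : Prop :=
  forall eps, 0 < eps -> exists d, 0 < d /\
    forall x, p < x < q -> q - d < x -> Rabs (f x - l) < eps.

Lemma extend_by_limits (p q l m : R) (f : R -> R) : p < q ->
  (forall x, p < x < q -> continuous f x) ->
  lim_at_left_end p q f l -> lim_at_right_end p q f m ->
  exists g : R -> R, (forall x, continuous g x) /\ (forall x, p < x < q -> g x = f x) /\
    g p = l /\ g q = m.
Proof.
intros Hpq Cf Ll Lr.
set (g := fun x => match Rle_dec x p with left _ => l | right _ =>
  match Rle_dec q x with left _ => m | right _ => f x end end).
assert (gl : forall x, x <= p -> g x = l) by (intros x Hx; unfold g; now destruct Rle_dec).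
assert (gr : forall x, q <= x -> g x = m).
{ intros x Hx; unfold g. destruct Rle_dec; [lra|]. now destruct Rle_dec. }
assert (gf : forall x, p < x < q -> g x = f x).
{ intros x Hx; unfold g. destruct Rle_dec; [lra|]. destruct Rle_dec; [lra|reflexivity]. }
exists g. split; [|split; [exact gf|split; [apply gl|apply gr]; lra]].
intros x. apply continuous_eps. intros eps Heps.
assert (Z : forall c, Rabs (c - c) < eps) by (intros c; rewrite Rminus_diag Rabs_R0; exact Heps).
destruct (Rtotal_order x p) as [H|[H|H]].
- exists (p - x); split; [lra|]. intros y Hy. apply Rabs_def2 in Hy.
  rewrite !gl; try lra. apply Z.
- subst x. destruct (Ll eps Heps) as [d [Hd Hl]]. exists (Rmin d (q - p)).
  split; [apply Rmin_pos; lra|]. intros y Hy.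
  assert (Y1 := Rlt_le_trans _ _ _ Hy (Rmin_l _ _)). assert (Y2 := Rlt_le_trans _ _ _ Hy (Rmin_r _ _)).
  apply Rabs_def2 in Y1. apply Rabs_def2 in Y2. rewrite (gl p); [|lra].
  destruct (Rle_dec y p) as [L|L]; [rewrite gl; [apply Z|exact L]|].
  rewrite gf; [|lra]. apply Hl; lra.
- destruct (Rtotal_order x q) as [K|[K|K]].
  + assert (C := Cf x (conj H K)). rewrite -> continuous_eps in C.
    destruct (C eps Heps) as [d [Hd Hc]].
    exists (Rmin d (Rmin (x - p) (q - x))). split; [repeat apply Rmin_pos; lra|]. intros y Hy.
    assert (Y : Rabs (y - x) < d /\ Rabs (y - x) < x - p /\ Rabs (y - x) < q - x).
    { revert Hy; unfold Rmin; repeat destruct Rle_dec; lra. }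
    destruct Y as [Y1 [Y2 Y3]]. apply Rabs_def2 in Y2. apply Rabs_def2 in Y3.
    rewrite !gf; try lra. now apply Hc.
  + subst x. destruct (Lr eps Heps) as [d [Hd Hl]]. exists (Rmin d (q - p)).
    split; [apply Rmin_pos; lra|]. intros y Hy.
    assert (Y1 := Rlt_le_trans _ _ _ Hy (Rmin_l _ _)). assert (Y2 := Rlt_le_trans _ _ _ Hy (Rmin_r _ _)).
    apply Rabs_def2 in Y1. apply Rabs_def2 in Y2. rewrite (gr q); [|lra].
    destruct (Rle_dec q y) as [L|L]; [rewrite gr; [apply Z|exact L]|].
    rewrite gf; [|lra]. apply Hl; lra.
  + exists (x - q); split; [lra|]. intros y Hy. apply Rabs_def2 in Hy.
    rewrite !gr; try lra. apply Z.
Qed.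

(** A bounded increasing function has limits at the two ends. *)
Lemma monotone_extension (f : R -> R) p q B : p < q ->
  (forall x, p < x < q -> continuous f x) ->
  (forall x y, p < x -> x < y -> y < q -> f x < f y) ->
  (forall x, p < x < q -> Rabs (f x) <= B) ->
  exists g : R -> R, (forall x, continuous g x) /\ (forall x, p < x < q -> g x = f x) /\
    (forall x y, p <= x -> x < y -> y <= q -> g x < g y).
Proof.
intros Hpq Cf Inc Bd.
set (c := (p + q) / 2).
assert (Hc : p < c < q) by (unfold c; lra).
destruct (completeness (fun v => exists x, p < x < q /\ v = f x)) as [m [Um Lm]].
{ exists B. intros v [x [Hx ->]]. generalize (Bd x Hx) (Rle_abs (f x)); lra. }
{ exists (f c), c; split; [exact Hc|reflexivity]. }
destruct (completeness (fun v => exists x, p < x < q /\ v = - f x)) as [l [Ul Ll]].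
{ exists B. intros v [x [Hx ->]]. generalize (Bd x Hx) (Rle_abs (- f x)); rewrite Rabs_Ropp; lra. }
{ exists (- f c), c; split; [exact Hc|reflexivity]. }
assert (Lim1 : lim_at_left_end p q f (- l)).
{ intros eps Heps.
  destruct (Classical_Prop.classic (exists x, p < x < q /\ l - eps < - f x)) as [[x [Hx H]]|N].
  - exists (x - p); split; [lra|]. intros y Hy Hyx.
    assert (f y < f x) by (apply Inc; lra). assert (- f y <= l) by (apply Ul; now exists y).
    apply Rabs_def1; lra.
  - exfalso. assert (l <= l - eps); [|lra]. apply Ll. intros v [x [Hx ->]].
    destruct (Rle_dec (- f x) (l - eps)) as [L|L]; [exact L|]. exfalso; apply N.
    exists x; split; [exact Hx|lra]. }
assert (Lim2 : lim_at_right_end p q f m).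
{ intros eps Heps.
  destruct (Classical_Prop.classic (exists x, p < x < q /\ m - eps < f x)) as [[x [Hx H]]|N].
  - exists (q - x); split; [lra|]. intros y Hy Hyx.
    assert (f x < f y) by (apply Inc; lra). assert (f y <= m) by (apply Um; now exists y).
    apply Rabs_def1; lra.
  - exfalso. assert (m <= m - eps); [|lra]. apply Lm. intros v [x [Hx ->]].
    destruct (Rle_dec (f x) (m - eps)) as [L|L]; [exact L|]. exfalso; apply N.
    exists x; split; [exact Hx|lra]. }
destruct (extend_by_limits p q (- l) m f Hpq Cf Lim1 Lim2) as [g [Cg [Eg [gp gq]]]].
exists g. split; [exact Cg|split; [exact Eg|]].
assert (Lo : forall x, p < x < q -> - l < f x).
{ intros x Hx. apply Rle_lt_trans with (f ((p + x) / 2)); [|apply Inc; lra].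
  assert (- f ((p + x) / 2) <= l); [|lra]. apply Ul. exists ((p + x) / 2); split; [lra|reflexivity]. }
assert (Hi : forall x, p < x < q -> f x < m).
{ intros x Hx. apply Rlt_le_trans with (f ((x + q) / 2)); [apply Inc; lra|].
  apply Um. exists ((x + q) / 2); split; [lra|reflexivity]. }
intros x y Hx Hxy Hy.
destruct (Req_dec x p) as [->|Nx], (Req_dec y q) as [->|Ny]; rewrite ?gp ?gq ?Eg; try lra.
- generalize (Lo c Hc) (Hi c Hc); lra.
- apply Lo; lra.
- apply Hi; lra.
- apply Inc; lra.
Qed.

Lemma eq_at_ends (f g : R -> R) p q : p < q ->
  (forall x, continuous f x) -> (forall x, continuous g x) ->
  (forall x, p < x < q -> f x = g x) -> f p = g p /\ f q = g q.
Proof.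
intros Hpq Cf Cg E.
assert (K : forall z, (forall d, 0 < d -> exists x, p < x < q /\ Rabs (x - z) < d) -> f z = g z).
{ intros z Hz. destruct (Req_dec (f z) (g z)) as [H|H]; [exact H|exfalso].
  set (e := Rabs (f z - g z) / 2).
  assert (He : 0 < e). { unfold e. assert (0 < Rabs (f z - g z)) by (apply Rabs_pos_lt; lra). lra. }
  destruct (proj1 (continuous_eps f z) (Cf z) e He) as [d1 [Hd1 H1]].
  destruct (proj1 (continuous_eps g z) (Cg z) e He) as [d2 [Hd2 H2]].
  destruct (Hz (Rmin d1 d2)) as [x [Hx Hxz]]; [now apply Rmin_pos|].
  specialize (H1 x (Rlt_le_trans _ _ _ Hxz (Rmin_l _ _))).
  specialize (H2 x (Rlt_le_trans _ _ _ Hxz (Rmin_r _ _))).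
  rewrite (E x Hx) in H1.
  assert (Rabs (f z - g z) <= Rabs (g x - f z) + Rabs (g x - g z)).
  { rewrite -(Rabs_Ropp (g x - f z)). eapply Rle_trans; [|apply Rabs_triang]. apply Req_le; f_equal; ring. }
  unfold e in *. lra. }
split; apply K; intros d Hd; set (d' := Rmin d (q - p)).
- assert (0 < d') by (apply Rmin_pos; lra).
  assert (d' <= d) by apply Rmin_l. assert (d' <= q - p) by apply Rmin_r.
  exists (p + d' / 2). split; [lra|]. rewrite Rabs_pos_eq; lra.
- assert (0 < d') by (apply Rmin_pos; lra).
  assert (d' <= d) by apply Rmin_l. assert (d' <= q - p) by apply Rmin_r.
  exists (q - d' / 2). split; [lra|]. rewrite Rabs_left; lra.
Qed.

Lemma continuous_no_sign_change (f : R -> R) p q :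
  (forall x, p < x < q -> continuous f x) -> (forall x, p < x < q -> f x <> 0) ->
  forall x y, p < x < q -> p < y < q -> 0 < f x -> 0 < f y.
Proof.
intros Cf Nz x y Hx Hy P.
destruct (Rlt_dec 0 (f y)) as [L|L]; [exact L|exfalso].
assert (Py : f y < 0). { destruct (Rtotal_order (f y) 0) as [H|[H|H]]; [exact H| |lra]. now apply Nz in H. }
destruct (Rtotal_order x y) as [H|[H|H]]; [|subst; lra|].
- destruct (IVT_interv (fun t => - f t) x y) as [z [Hz E]]; try lra.
  + intros t Ht. apply continuity_pt_opp, continuity_pt_filterlim, Cf; lra.
  + apply (Nz z); lra.
- destruct (IVT_interv f y x) as [z [Hz E]]; try lra.
  + intros t Ht. apply continuity_pt_filterlim, Cf; lra.
  + apply (Nz z); lra.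
Qed.

Lemma integer_valued_const (f : R -> R) p q : p < q ->
  (forall x, p < x < q -> continuous f x) -> (forall x, p < x < q -> exists k : Z, f x = IZR k) ->
  exists k : Z, forall x, p < x < q -> f x = IZR k.
Proof.
intros Hpq Cf Zf. set (c := (p + q) / 2). assert (Hc : p < c < q) by (unfold c; lra).
destruct (Zf c Hc) as [k Hk]. exists k. intros x Hx. destruct (Zf x Hx) as [n Hn].
assert (S : forall h : R, (h = / 2 \/ h = - / 2) -> forall u v, p < u < q -> p < v < q ->
   0 < f u - (IZR k + h) -> 0 < f v - (IZR k + h)).
{ intros h Hh. apply continuous_no_sign_change.
  - intros t Ht. apply (continuous_minus f (fun _ => IZR k + h)); [now apply Cf|apply continuous_const].
  - intros t Ht E. destruct (Zf t Ht) as [j Hj]. rewrite Hj in E.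
    assert (E2 : IZR (2 * j - 2 * k) = 2 * h) by (rewrite minus_IZR !mult_IZR; lra).
    destruct Hh as [-> | ->].
    + replace (2 * / 2) with 1 in E2 by field. apply eq_IZR in E2. lia.
    + replace (2 * - / 2) with (-1) in E2 by field. apply eq_IZR in E2. lia. }
assert (U := S (- / 2) (or_intror eq_refl) c x Hc Hx). 
assert (D : ~ 0 < f x - (IZR k + / 2)).
{ intros H. apply (S (/ 2) (or_introl eq_refl) x c Hx Hc) in H. rewrite Hk in H. lra. }
rewrite Hk in U. rewrite Hn in U, D |- *.
assert (L1 : (k < n + 1)%Z) by (apply lt_IZR; rewrite plus_IZR; lra).
assert (L2 : (n < k + 1)%Z) by (apply lt_IZR; rewrite plus_IZR; lra).
f_equal; lia.
Qed.

(** * Turning times near the ends of the chamber *)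

Lemma sqrt_dist2_ge c r phi : 0 <= r -> Rabs (r - Rabs c) <= sqrt (dist2 c r phi).
Proof.
intros H. rewrite -sqrt_Rsqr_abs. apply sqrt_le_1_alt.
replace ((r - Rabs c)²) with ((r - Rabs c) ^ 2) by (unfold Rsqr; ring). now apply dist2_ge.
Qed.

Lemma sqrt_dist2_lip c r s phi :
  Rabs (sqrt (dist2 c r phi) - sqrt (dist2 c s phi)) <= Rabs (r - s).
Proof.
rewrite -!Cmod_pt_minus.
assert (K : forall x y, Cmod (pt x phi - RtoC c)%C <= Cmod (pt y phi - RtoC c)%C + Rabs (x - y)).
{ intros x y.
  replace (pt x phi - RtoC c)%C with ((pt y phi - RtoC c) + RtoC (x - y) * cexp 0 phi)%C
    by (unfold pt; apply injective_projections; simpl; ring).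
  eapply Rle_trans; [apply Cmod_triangle|]. rewrite Cmod_mult Cmod_R Cmod_cexp exp_0. lra. }
generalize (K r s) (K s r). rewrite (Rabs_minus_sym s r). intros. apply Rabs_le; lra.
Qed.

Lemma weight_alt a b r phi : 0 < r ->
  weight a b r phi = / (2 * PI) * / r
    + / (4 * PI) * (r / sqrt (dist2 a r phi) + r / sqrt (dist2 b r phi)).
Proof.
intros Hr. unfold weight, Rdiv.
rewrite (Rinv_mult 2 (sqrt (dist2 a r phi))) (Rinv_mult 2 (sqrt (dist2 b r phi))).
set (x := / sqrt (dist2 a r phi)). set (y := / sqrt (dist2 b r phi)).
generalize PI_RGT_0; intros; field. lra.
Qed.

Lemma ratio_lip c r s phi d : 0 < d -> 0 < s -> d <= sqrt (dist2 c r phi) -> d <= sqrt (dist2 c s phi) ->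
  Rabs (r / sqrt (dist2 c r phi) - s / sqrt (dist2 c s phi)) <= Rabs (r - s) * (/ d + s * / d ^ 2).
Proof.
intros Hd Hs H1 H2. assert (L := sqrt_dist2_lip c s r phi).
rewrite (Rabs_minus_sym s r) in L.
set (x := sqrt (dist2 c r phi)) in *. set (y := sqrt (dist2 c s phi)) in *.
replace (r / x - s / y) with ((r - s) * / x + s * ((y - x) * (/ x * / y))) by (field; lra).
assert (Ix : / x <= / d) by (apply Rinv_le_contravar; lra).
assert (Iy : / y <= / d) by (apply Rinv_le_contravar; lra).
assert (Px : 0 < / x) by (apply Rinv_0_lt_compat; lra).
assert (Py : 0 < / y) by (apply Rinv_0_lt_compat; lra).
eapply Rle_trans; [apply Rabs_triang|]. rewrite !Rabs_mult.
rewrite (Rabs_pos_eq (/ x)); [|lra]. rewrite (Rabs_pos_eq (/ y)); [|lra]. rewrite (Rabs_pos_eq s); [|lra].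
rewrite Rmult_plus_distr_l.
assert (P := Rabs_pos (r - s)).
assert (Q : / x * / y <= / d ^ 2).
{ replace (/ d ^ 2) with (/ d * / d) by (field; lra). apply Rmult_le_compat; lra. }
apply Rplus_le_compat; [apply Rmult_le_compat_l; lra|].
replace (Rabs (r - s) * (s * / d ^ 2)) with (s * (Rabs (r - s) * / d ^ 2)) by ring.
apply Rmult_le_compat_l; [lra|]. apply Rmult_le_compat; try lra.
- apply Rabs_pos.
- assert (0 < / x * / y) by (apply Rmult_lt_0_compat; lra). lra.
Qed.

Lemma weight_locally_lip a b r0 : regular a b r0 ->
  exists d L, 0 < d /\ 0 < L /\ forall r phi, Rabs (r - r0) < d ->
    regular a b r /\ Rabs (weight a b r phi - weight a b r0 phi) <= L * Rabs (r - r0).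
Proof.
intros [H0 [Ha Hb]].
set (d := Rmin r0 (Rmin (Rabs (r0 - Rabs a)) (Rabs (r0 - Rabs b))) / 2).
assert (D1 : 2 * d <= r0) by (unfold d; generalize (Rmin_l r0 (Rmin (Rabs (r0 - Rabs a)) (Rabs (r0 - Rabs b)))); lra).
assert (D2 : 2 * d <= Rabs (r0 - Rabs a)).
{ unfold d. generalize (Rmin_r r0 (Rmin (Rabs (r0 - Rabs a)) (Rabs (r0 - Rabs b))))
    (Rmin_l (Rabs (r0 - Rabs a)) (Rabs (r0 - Rabs b))); lra. }
assert (D3 : 2 * d <= Rabs (r0 - Rabs b)).
{ unfold d. generalize (Rmin_r r0 (Rmin (Rabs (r0 - Rabs a)) (Rabs (r0 - Rabs b))))
    (Rmin_r (Rabs (r0 - Rabs a)) (Rabs (r0 - Rabs b))); lra. }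
assert (D0 : 0 < d).
{ unfold d. apply Rdiv_lt_0_compat; [|lra]. repeat apply Rmin_pos; try exact H0; apply Rabs_pos_lt; lra. }
assert (Ppi := PI_RGT_0).
set (L := / (2 * PI) * / d ^ 2 + / (4 * PI) * (2 * (/ d + r0 * / d ^ 2))).
assert (I1 : 0 < / d) by now apply Rinv_0_lt_compat.
assert (I2 : 0 < / d ^ 2) by (apply Rinv_0_lt_compat, pow_lt; lra).
assert (I3 : 0 < / (2 * PI)) by (apply Rinv_0_lt_compat; lra).
assert (I4 : 0 < / (4 * PI)) by (apply Rinv_0_lt_compat; lra).
assert (HL : 0 < L).
{ unfold L. apply Rplus_lt_0_compat; apply Rmult_lt_0_compat; try lra.
  assert (0 < r0 * / d ^ 2) by (apply Rmult_lt_0_compat; lra). lra. }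
exists d, L. split; [exact D0|split; [exact HL|]]. intros r phi Hr.
assert (Far : forall c, 2 * d <= Rabs (r0 - Rabs c) -> d <= Rabs (r - Rabs c)).
{ intros c Hc. assert (T := Rabs_triang (r0 - r) (r - Rabs c)).
  replace (r0 - r + (r - Rabs c)) with (r0 - Rabs c) in T by ring.
  rewrite (Rabs_minus_sym r0 r) in T. lra. }
assert (Rr := Rabs_def2 _ _ Hr).
assert (Reg : regular a b r).
{ split; [lra|]. split; intros E.
  - specialize (Far a D2). rewrite E Rminus_diag Rabs_R0 in Far. lra.
  - specialize (Far b D3). rewrite E Rminus_diag Rabs_R0 in Far. lra. }
split; [exact Reg|].
rewrite !weight_alt; try lra.
assert (Ba := ratio_lip a r r0 phi d D0 H0
  ltac:(eapply Rle_trans; [apply Far, D2|apply sqrt_dist2_ge; lra])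
  ltac:(apply Rle_trans with (2 * d); [lra|]; eapply Rle_trans; [exact D2|apply sqrt_dist2_ge; lra])).
assert (Bb := ratio_lip b r r0 phi d D0 H0
  ltac:(eapply Rle_trans; [apply Far, D3|apply sqrt_dist2_ge; lra])
  ltac:(apply Rle_trans with (2 * d); [lra|]; eapply Rle_trans; [exact D3|apply sqrt_dist2_ge; lra])).
set (qa := r / _) in Ba |- *. set (qa0 := r0 / sqrt (dist2 a r0 phi)) in *.
set (qb := r / sqrt (dist2 b r phi)) in *. set (qb0 := r0 / sqrt (dist2 b r0 phi)) in *.
assert (Br : Rabs (/ r - / r0) <= Rabs (r - r0) * / d ^ 2).
{ replace (/ r - / r0) with ((r0 - r) * (/ r * / r0)) by (field; lra).
  rewrite Rabs_mult (Rabs_minus_sym r0 r). apply Rmult_le_compat_l; [apply Rabs_pos|].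
  assert (0 < / r) by (apply Rinv_0_lt_compat; lra).
  assert (0 < / r0) by (apply Rinv_0_lt_compat; lra).
  rewrite Rabs_pos_eq; [|apply Rmult_le_pos; lra].
  replace (/ d ^ 2) with (/ d * / d) by (field; lra).
  apply Rmult_le_compat; try lra; apply Rinv_le_contravar; lra. }
replace (/ (2 * PI) * / r + / (4 * PI) * (qa + qb) - (/ (2 * PI) * / r0 + / (4 * PI) * (qa0 + qb0)))
  with (/ (2 * PI) * (/ r - / r0) + / (4 * PI) * ((qa - qa0) + (qb - qb0))) by ring.
eapply Rle_trans; [apply Rabs_triang|]. rewrite !Rabs_mult.
rewrite (Rabs_pos_eq (/ (2 * PI))); [|lra]. rewrite (Rabs_pos_eq (/ (4 * PI))); [|lra].
assert (T := Rabs_triang (qa - qa0) (qb - qb0)).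
unfold L. rewrite Rmult_plus_distr_r. apply Rplus_le_compat.
- rewrite Rmult_assoc. apply Rmult_le_compat_l; lra.
- rewrite Rmult_assoc. apply Rmult_le_compat_l; lra.
Qed.

Lemma flow_time_MVT a b r x y : regular a b r ->
  exists c, Rmin x y <= c <= Rmax x y /\
    flow_time a b r y - flow_time a b r x = weight a b r c * (y - x).
Proof.
intros H. apply (MVT_gen (flow_time a b r) x y (weight a b r)).
- intros t _. now apply is_derive_flow_time.
- intros t _. apply continuity_pt_filterlim.
  exact (is_derive_continuous _ _ _ (is_derive_flow_time a b r t H)).
Qed.

Lemma flow_time_continuous a b r0 phi0 : regular a b r0 ->
  forall eps, 0 < eps -> exists d, 0 < d /\ forall r phi,
    Rabs (r - r0) < d -> Rabs (phi - phi0) < d ->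
    Rabs (flow_time a b r phi - flow_time a b r0 phi0) < eps.
Proof.
intros Reg eps Heps.
destruct (weight_locally_lip a b r0 Reg) as [d1 [L [Hd1 [HL W]]]].
assert (C := is_derive_continuous _ _ _ (is_derive_flow_time a b r0 phi0 Reg)).
rewrite -> continuous_eps in C. destruct (C (eps / 2)) as [d2 [Hd2 C2]]; [lra|].
set (A := Rabs phi0 + 1). assert (HA : 0 < A) by (unfold A; generalize (Rabs_pos phi0); lra).
set (d3 := eps / 2 / (A * L)).
assert (Hd3 : 0 < d3). { unfold d3. repeat apply Rdiv_lt_0_compat; try lra. now apply Rmult_lt_0_compat. }
exists (Rmin 1 (Rmin d1 (Rmin d2 d3))). split; [repeat apply Rmin_pos; lra|].
intros r phi Hr Hphi.
assert (Br : Rabs (r - r0) < d1 /\ Rabs (r - r0) < d3).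
{ revert Hr; unfold Rmin; repeat destruct Rle_dec; lra. }
assert (Bp : Rabs (phi - phi0) < 1 /\ Rabs (phi - phi0) < d2).
{ revert Hphi; unfold Rmin; repeat destruct Rle_dec; lra. }
destruct Br as [Br1 Br3], Bp as [Bp1 Bp2].
assert (Reg' : regular a b r) by apply (W r 0 Br1).
assert (T : Rabs (flow_time a b r phi - flow_time a b r0 phi) <= A * (L * Rabs (r - r0))).
{ destruct (MVT_gen (fun t => flow_time a b r t - flow_time a b r0 t) 0 phi
    (fun t => weight a b r t - weight a b r0 t)) as [c [_ E]].
  - intros t _. apply is_derive_minR; now apply is_derive_flow_time.
  - intros t _. apply continuity_pt_filterlim.
    exact (is_derive_continuous _ _ _ (is_derive_minR _ _ _ _ _
      (is_derive_flow_time a b r t Reg') (is_derive_flow_time a b r0 t Reg))).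
  - rewrite !flow_time_0 !Rminus_0_r in E. rewrite E Rabs_mult Rmult_comm.
    apply Rmult_le_compat; try apply Rabs_pos.
    + unfold A. replace phi with (phi0 + (phi - phi0)) by ring.
      eapply Rle_trans; [apply Rabs_triang|]. lra.
    + apply (W r c Br1). }
assert (A * (L * Rabs (r - r0)) < eps / 2).
{ replace (eps / 2) with (A * L * d3) by (unfold d3; field; split; lra).
  rewrite -Rmult_assoc. apply Rmult_lt_compat_l; [now apply Rmult_lt_0_compat|exact Br3]. }
specialize (C2 phi Bp2).
replace (flow_time a b r phi - flow_time a b r0 phi0) with
  ((flow_time a b r phi - flow_time a b r0 phi) + (flow_time a b r0 phi - flow_time a b r0 phi0)) by ring.
eapply Rle_lt_trans; [apply Rabs_triang|]. lra.
Qed.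

Lemma flow_time_comp_continuous a b r0 (th : R -> R) : regular a b r0 -> continuous th r0 ->
  continuous (fun r => flow_time a b r (th r)) r0.
Proof.
intros Reg Ct. apply continuous_eps. intros eps Heps.
destruct (flow_time_continuous a b r0 (th r0) Reg eps Heps) as [d [Hd H]].
destruct (proj1 (continuous_eps th r0) Ct d Hd) as [d' [Hd' H']].
exists (Rmin d d'); split; [now apply Rmin_pos|]. intros r Hr. apply H.
- exact (Rlt_le_trans _ _ _ Hr (Rmin_l _ _)).
- apply H'. exact (Rlt_le_trans _ _ _ Hr (Rmin_r _ _)).
Qed.

(** Turning by [phi] measured as a fraction of the period: the coordinate
    [xi_3] of the point of the fiber with argument [phi], up to sign. *)
Definition turns (a b r phi : R) : R := flow_time a b r phi / period a b r.

Lemma turns_comp_continuous a b r0 (th : R -> R) : regular a b r0 -> continuous th r0 ->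
  continuous (fun r => turns a b r (th r)) r0.
Proof.
intros Reg Ct. apply (continuous_mult (fun r => flow_time a b r (th r)) (fun r => / period a b r)).
- now apply flow_time_comp_continuous.
- apply continuous_invR.
  + apply (flow_time_comp_continuous a b r0 (fun _ => 2 * PI) Reg), continuous_const.
  + generalize (period_pos a b r0 Reg); lra.
Qed.

Lemma weight_le a b r phi d : 0 < r -> 0 < d -> d <= Rabs (r - Rabs a) -> d <= Rabs (r - Rabs b) ->
  weight a b r phi <= / (2 * PI) * (/ r + r / d).
Proof.
intros Hr Hd Ha Hb. rewrite weight_alt; [|exact Hr].
assert (K : forall c, d <= Rabs (r - Rabs c) -> r / sqrt (dist2 c r phi) <= r / d).
{ intros c Hc. apply Rmult_le_compat_l; [lra|]. apply Rinv_le_contravar; [exact Hd|].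
  eapply Rle_trans; [exact Hc|apply sqrt_dist2_ge; lra]. }
assert (Ka := K a Ha). assert (Kb := K b Hb).
assert (Ppi := PI_RGT_0). assert (I4 : 0 < / (4 * PI)) by (apply Rinv_0_lt_compat; lra).
replace (/ (2 * PI) * (/ r + r / d)) with (/ (2 * PI) * / r + / (4 * PI) * (r / d + r / d)) by (field; lra).
apply Rplus_le_compat_l. apply Rmult_le_compat_l; lra.
Qed.

(** [turns] is exact at odd multiples of PI; elsewhere the error is the flow time
    of the deviation divided by the period. *)
Lemma turns_near_PI a b r phi d (m : Z) : regular a b r ->
  0 < d -> d <= Rabs (r - Rabs a) -> d <= Rabs (r - Rabs b) ->
  Rabs (turns a b r phi - (IZR m + / 2)) <=
    Rabs (phi - (PI + 2 * PI * IZR m)) * (/ (2 * PI) * (/ r + r / d)) / period a b r.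
Proof.
intros Reg Hd Ha Hb. assert (PT := period_pos a b r Reg).
destruct (flow_time_MVT a b r (PI + 2 * PI * IZR m) phi Reg) as [c [_ E]].
rewrite flow_time_PI in E; [|exact Reg].
replace (turns a b r phi - (IZR m + / 2)) with
  (weight a b r c * (phi - (PI + 2 * PI * IZR m)) / period a b r).
2: { unfold turns. rewrite -E. field. lra. }
assert (PW := weight_pos a b r c Reg).
assert (LW := weight_le a b r c d (proj1 Reg) Hd Ha Hb).
assert (IT : 0 < / period a b r) by now apply Rinv_0_lt_compat.
set (w := weight a b r c) in *. set (T := / (2 * PI) * (/ r + r / d)) in *. clearbody w T. clear E.
unfold Rdiv. rewrite !Rabs_mult (Rabs_pos_eq w); [|lra].
rewrite (Rabs_pos_eq (/ period a b r)); [|lra].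
apply Rmult_le_compat_r; [lra|].
rewrite Rmult_comm. apply Rmult_le_compat_l; [apply Rabs_pos|exact LW].
Qed.

Lemma one_minus_cos_le u : 1 - cos u <= u ^ 2 / 2.
Proof.
assert (E := cos_2a_sin (u / 2)). replace (2 * (u / 2)) with u in E by field.
assert (S : Rabs (sin (u / 2)) <= Rabs (u / 2)).
{ destruct (MVT_gen sin 0 (u / 2) cos) as [c [_ H]].
  - intros t _. apply is_derive_sin.
  - intros t _. apply continuity_sin.
  - rewrite sin_0 !Rminus_0_r in H. rewrite H Rabs_mult.
    assert (Rabs (cos c) <= 1) by (apply Rabs_le; generalize (COS_bound c); lra).
    generalize (Rabs_pos (u / 2)) (Rabs_pos (cos c)); nra. }
apply Rsqr_le_abs_1 in S. unfold Rsqr in S. simpl. nra.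
Qed.

(** The constant 18 comes from [sin x >= x / 3] on the interval from 0 to 2, which
    contains PI / 2. *)
Lemma one_minus_cos_ge u : 0 <= u <= PI -> u ^ 2 / 18 <= 1 - cos u.
Proof.
intros Hu. assert (E := cos_2a_sin (u / 2)). replace (2 * (u / 2)) with u in E by field.
assert (P4 := PI_4).
assert (S : u / 6 <= sin (u / 2)).
{ destruct (pre_sin_bound (u / 2) 0) as [L _]; try lra.
  unfold sin_approx, sin_term in L. simpl in L.
  assert (L' : u / 2 - (u / 2) ^ 3 / 6 <= sin (u / 2)).
  { eapply Rle_trans; [|exact L]. right. simpl. field. }
  assert ((u / 2) ^ 3 <= 4 * (u / 2)); [|lra].
  replace ((u / 2) ^ 3) with ((u / 2) ^ 2 * (u / 2)) by ring.
  apply Rmult_le_compat_r; [lra|]. nra. }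
nra.
Qed.

Lemma cos_PI_minus u : cos (PI - u) = - cos u.
Proof. rewrite cos_minus cos_PI sin_PI. ring. Qed.

Lemma dist2_PI_minus c r u : c < 0 ->
  dist2 c r (PI - u) = (r - Rabs c) ^ 2 + 2 * r * Rabs c * (1 - cos u).
Proof. intros Hc. unfold dist2. rewrite cos_PI_minus Rabs_left //. ring. Qed.

Lemma flow_time_PI_half a b r : regular a b r -> period a b r = 2 * flow_time a b r PI.
Proof. intros H. assert (E := flow_time_PI a b r 0 H). rewrite Rmult_0_r Rplus_0_r in E. lra. Qed.

Lemma weight_ge_ratio a b r phi : regular a b r ->
  r / (4 * PI) / sqrt (dist2 a r phi) <= weight a b r phi /\
  r / (4 * PI) / sqrt (dist2 b r phi) <= weight a b r phi.
Proof.
intros [Hr [Ha Hb]]. rewrite weight_alt; [|exact Hr].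
assert (Pa := sqrt_lt_R0 _ (dist2_pos a r phi (Rlt_le _ _ Hr) Ha)).
assert (Pb := sqrt_lt_R0 _ (dist2_pos b r phi (Rlt_le _ _ Hr) Hb)).
set (x := sqrt (dist2 a r phi)) in *. set (y := sqrt (dist2 b r phi)) in *.
assert (Ppi := PI_RGT_0).
assert (0 < / (4 * PI)) by (apply Rinv_0_lt_compat; lra).
assert (0 < / (2 * PI) * / r) by (apply Rmult_lt_0_compat; apply Rinv_0_lt_compat; lra).
assert (0 < / (4 * PI) * (r / x)) by (apply Rmult_lt_0_compat; [lra|now apply Rdiv_lt_0_compat]).
assert (0 < / (4 * PI) * (r / y)) by (apply Rmult_lt_0_compat; [lra|now apply Rdiv_lt_0_compat]).
replace (r / (4 * PI) / x) with (/ (4 * PI) * (r / x)) by (field; lra).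
replace (r / (4 * PI) / y) with (/ (4 * PI) * (r / y)) by (field; lra).
rewrite Rmult_plus_distr_l. lra.
Qed.

(** Near the angle PI the weight is at least a multiple of [1 / (d + m u)], where
    [u] is the distance to PI and [d] the distance of [r] to the end [Rabs c]; its
    primitive is a logarithm. *)
Lemma period_lower a b r c m : regular a b r -> (c = a \/ c = b) -> c < 0 ->
  r <= m -> Rabs c <= m ->
  r / (2 * PI * m) * (ln (m * PI) - ln (Rabs (r - Rabs c))) <= period a b r.
Proof.
intros Reg Hc Cneg HrR HcR. assert (Ppi := PI_RGT_0).
assert (Hr : 0 < r) by apply Reg.
set (d := Rabs (r - Rabs c)).
assert (Hd : 0 < d).
{ apply Rabs_pos_lt. destruct Reg as [_ [Ha Hb]]. destruct Hc as [-> | ->]; lra. }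
set (k := r / (4 * PI * m)).
assert (Hk : 0 < k). { apply Rdiv_lt_0_compat; [lra|]. apply Rmult_lt_0_compat; lra. }
(* nondecreasing, as minus the logarithmic term is a primitive of a lower bound of the weight *)
set (Q := fun psi => flow_time a b r psi + k * ln (d + m * (PI - psi))).
destruct (MVT_gen Q 0 PI (fun psi => weight a b r psi + k * (- m / (d + m * (PI - psi))))) as [x [Hx E]].
- intros psi. rewrite Rmin_left ?Rmax_right; try lra. intros Hpsi. unfold Q.
  assert (0 < d + m * (PI - psi)) by (assert (0 <= m * (PI - psi)) by (apply Rmult_le_pos; lra); lra).
  apply is_derive_addR; [now apply is_derive_flow_time|].
  auto_derive; [lra|]. Rring || (field; lra).
- intros psi. rewrite Rmin_left ?Rmax_right; try lra. intros Hpsi. apply continuity_pt_filterlim.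
  assert (0 < d + m * (PI - psi)) by (assert (0 <= m * (PI - psi)) by (apply Rmult_le_pos; lra); lra).
  apply (is_derive_continuous Q psi (weight a b r psi + k * (- m / (d + m * (PI - psi))))).
  apply is_derive_addR; [now apply is_derive_flow_time|].
  auto_derive; [lra|]. Rring || (field; lra).
- rewrite -> Rmin_left, Rmax_right in Hx by lra.
  set (u := PI - x) in *. assert (Hu : 0 <= u <= PI) by (unfold u; lra).
  assert (Pos : 0 < d + m * u) by (assert (0 <= m * u) by (apply Rmult_le_pos; lra); lra).
  assert (Wd : k * (m / (d + m * u)) <= weight a b r x).
  { apply Rle_trans with (r / (4 * PI) / sqrt (dist2 c r x)).
    - replace (k * (m / (d + m * u))) with (r / (4 * PI) * / (d + m * u)) by (unfold k; field; lra).
      apply Rmult_le_compat_l; [left; apply Rdiv_lt_0_compat; lra|].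
      assert (P : 0 < dist2 c r x).
      { apply dist2_pos; [lra|]. destruct Reg as [_ [Ha Hb]]. destruct Hc as [-> | ->]; lra. }
      apply Rinv_le_contravar; [now apply sqrt_lt_R0|].
      rewrite -(sqrt_pow2 (d + m * u)); [|lra]. apply sqrt_le_1_alt.
      replace x with (PI - u) by (unfold u; ring). rewrite dist2_PI_minus; [|exact Cneg].
      assert (Ed : (r - Rabs c) ^ 2 = d ^ 2) by (unfold d; now rewrite pow2_abs). rewrite Ed.
      assert (C := one_minus_cos_le u).
      assert (C0 : 0 <= 1 - cos u) by (generalize (COS_bound u); lra).
      assert (PR : r * Rabs c <= m * m) by (apply Rmult_le_compat; try lra; apply Rabs_pos).
      assert (r * Rabs c * (1 - cos u) <= m * m * (u ^ 2 / 2)).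
      { apply Rmult_le_compat; try lra. apply Rmult_le_pos; [lra|apply Rabs_pos]. }
      assert (0 <= d * (m * u)) by (apply Rmult_le_pos; [lra|apply Rmult_le_pos; lra]).
      nra.
    - destruct (weight_ge_ratio a b r x Reg). now destruct Hc as [-> | ->]. }
  unfold Q in E. rewrite flow_time_0 !Rminus_0_r Rminus_diag Rmult_0_r Rplus_0_r in E.
  replace (- m / (d + m * u)) with (- (m / (d + m * u))) in E by (unfold Rdiv; ring).
  assert (G : 0 <= (weight a b r x + k * - (m / (d + m * u))) * PI) by (apply Rmult_le_pos; lra).
  assert (RP : 0 < m * PI) by (apply Rmult_lt_0_compat; lra).
  assert (LN : ln (m * PI) <= ln (d + m * PI)) by (apply Rlt_le, ln_increasing; lra).
  apply Rmult_le_compat_l with (r := k) in LN; [|lra].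
  rewrite flow_time_PI_half //.
  replace (r / (2 * PI * m)) with (2 * k) by (unfold k; field; lra).
  lra.
Qed.

(** The squared distance is at least [d^2 + (beta u / 3)^2], which the inequality
    between arithmetic and geometric means bounds below by a multiple of [d u].
    The point of this form is that both factors have integrable inverse square
    roots. *)
Lemma inv_sqrt_dist2_le c r u beta : c < 0 -> 0 < beta -> beta <= r -> beta <= Rabs c ->
  r <> Rabs c -> 0 < u <= PI ->
  / sqrt (dist2 c r (PI - u)) <= / sqrt (beta / 3) * (/ sqrt (Rabs (r - Rabs c)) * / sqrt u).
Proof.
intros Hc Hbeta Hr Hcb Hne Hu.
set (d := Rabs (r - Rabs c)). assert (Hd : 0 < d) by (apply Rabs_pos_lt; lra).
rewrite -!Rinv_mult -!sqrt_mult; try lra.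
2: { apply Rmult_le_pos; lra. }
assert (P : 0 < beta / 3 * (d * u)) by (repeat apply Rmult_lt_0_compat; lra).
apply Rinv_le_contravar; [now apply sqrt_lt_R0|]. apply sqrt_le_1_alt.
rewrite dist2_PI_minus; [|exact Hc].
assert (Ed : (r - Rabs c) ^ 2 = d ^ 2) by (unfold d; now rewrite pow2_abs). rewrite Ed.
assert (C := one_minus_cos_ge u ltac:(lra)).
assert (B : beta * beta <= r * Rabs c) by (apply Rmult_le_compat; lra).
assert (beta * beta * (u ^ 2 / 18) <= r * Rabs c * (1 - cos u)).
{ apply Rmult_le_compat; try lra; [apply Rmult_le_pos; lra|nra]. }
assert (0 <= (d - beta * u / 3) ^ 2) by apply pow2_ge_0.
nra.
Qed.

(** Integrating [inv_sqrt_dist2_le] in the angle [u] leaves the inverse square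
    roots of the distances of [r] to the ends, which are integrable in [r]. *)
Lemma period_upper a b : a < b -> b < 0 -> exists C0 C1, 0 <= C0 /\ 0 <= C1 /\
  forall r, Rabs b < r < Rabs a ->
  period a b r <= C0 + C1 * (/ sqrt (Rabs a - r) + / sqrt (r - Rabs b)).
Proof.
intros Hab Hb. assert (Ppi := PI_RGT_0).
assert (Pb : 0 < Rabs b) by (apply Rabs_pos_lt; lra).
assert (Lab : Rabs b < Rabs a) by (rewrite !Rabs_left; lra).
set (beta := Rabs b) in *. set (Ra := Rabs a) in *.
set (A0 := / (2 * PI) * / beta). set (K := Ra / (4 * PI) * / sqrt (beta / 3)).
assert (HA0 : 0 < A0) by (apply Rmult_lt_0_compat; apply Rinv_0_lt_compat; lra).
assert (HK : 0 < K).
{ apply Rmult_lt_0_compat; [apply Rdiv_lt_0_compat; lra|]. apply Rinv_0_lt_compat, sqrt_lt_R0; lra. }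
assert (Hsp := sqrt_lt_R0 _ Ppi).
exists (2 * A0 * PI), (4 * K * sqrt PI).
split; [apply Rmult_le_pos; lra|]. split; [apply Rmult_le_pos; lra|].
intros r Hr.
assert (Reg := chamber_regular a b r Hr).
set (S := / sqrt (Ra - r) + / sqrt (r - beta)).
set (Q := fun psi => flow_time a b r psi - (A0 * psi - 2 * (K * S) * sqrt (PI - psi))).
set (dQ := fun psi => weight a b r psi - (A0 + K * S * / sqrt (PI - psi))).
(* the square root has no derivative at PI; the value 0 keeps the slope nonpositive there *)
destruct (MVT_gen Q 0 PI (fun psi => match Rlt_dec psi PI with left _ => dQ psi | right _ => 0 end))
  as [x [Hx E]].
- intros psi. rewrite Rmin_left ?Rmax_right; try lra. intros Hpsi. unfold Q.
  destruct Rlt_dec as [_|N]; [|lra].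
  apply is_derive_minR; [now apply is_derive_flow_time|].
  assert (0 < sqrt (PI - psi)) by (apply sqrt_lt_R0; lra).
  auto_derive; [lra|]. unfold Rminus in *. simpl. field. lra.
- intros psi _. apply continuity_pt_filterlim. unfold Q.
  apply (continuous_minus (flow_time a b r) (fun t => A0 * t - 2 * (K * S) * sqrt (PI - t))).
  + exact (is_derive_continuous _ _ _ (is_derive_flow_time a b r psi Reg)).
  + apply (continuous_minus (fun t => A0 * t) (fun t => 2 * (K * S) * sqrt (PI - t))).
    * apply (is_derive_continuous _ _ A0). auto_derive; [exact I|Rring].
    * apply (continuous_mult (fun _ => 2 * (K * S)) (fun t => sqrt (PI - t))); [apply continuous_const|].
      apply (continuous_comp (fun t => PI - t) sqrt); [|apply continuous_sqrt].
      apply (is_derive_continuous _ _ (-1)). auto_derive; [exact I|Rring].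
- rewrite -> Rmin_left, Rmax_right in Hx by lra.
  unfold Q in E. rewrite flow_time_0 !Rminus_0_r Rminus_diag sqrt_0 in E.
  match type of E with _ = ?L * PI => assert (Ineq : L <= 0) end.
  2: { apply Rmult_le_compat_r with (r := PI) in Ineq; [|lra]. rewrite -E in Ineq.
       rewrite flow_time_PI_half //.
       replace (4 * K * sqrt PI * S) with (2 * (2 * (K * S) * sqrt PI)) by ring. lra. }
  destruct Rlt_dec as [L|L]; [|lra]. unfold dQ.
  assert (Hu : 0 < PI - x <= PI) by lra.
  rewrite weight_alt; [|lra].
  assert (Na : a < 0) by lra.
  assert (Ba := inv_sqrt_dist2_le a r (PI - x) beta Na Pb ltac:(lra) ltac:(fold Ra; lra) ltac:(fold Ra; lra) Hu).
  assert (Bb := inv_sqrt_dist2_le b r (PI - x) beta Hb Pb ltac:(lra) ltac:(fold beta; lra) ltac:(fold beta; lra) Hu).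
  fold Ra in Ba. fold beta in Bb.
  replace (PI - (PI - x)) with x in Ba, Bb by ring.
  rewrite (Rabs_left (r - Ra)) in Ba; [|lra]. rewrite (Rabs_pos_eq (r - beta)) in Bb; [|lra].
  replace (- (r - Ra)) with (Ra - r) in Ba by ring.
  assert (H1 : / (2 * PI) * / r <= A0).
  { apply Rmult_le_compat_l; [left; apply Rinv_0_lt_compat; lra|]. apply Rinv_le_contravar; lra. }
  assert (H2 : / (4 * PI) * (r / sqrt (dist2 a r x) + r / sqrt (dist2 b r x)) <= K * S * / sqrt (PI - x)); [|lra].
  assert (I4 : 0 < / (4 * PI)) by (apply Rinv_0_lt_compat; lra).
  replace (K * S * / sqrt (PI - x)) with (/ (4 * PI) * (Ra *
     (/ sqrt (beta / 3) * (/ sqrt (Ra - r) * / sqrt (PI - x)) +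
      / sqrt (beta / 3) * (/ sqrt (r - beta) * / sqrt (PI - x)))))
    by (unfold K, S, Rdiv; ring).
  apply Rmult_le_compat_l; [lra|]. unfold Rdiv. rewrite -Rmult_plus_distr_l.
  assert (Qa := Rinv_0_lt_compat _ (sqrt_lt_R0 _ (dist2_pos a r x ltac:(lra) ltac:(fold Ra; lra)))).
  assert (Qb := Rinv_0_lt_compat _ (sqrt_lt_R0 _ (dist2_pos b r x ltac:(lra) ltac:(fold beta; lra)))).
  apply Rmult_le_compat; lra.
Qed.

Lemma x3_slope_sign a b Phi x3 : action_angle a b Phi x3 -> Rabs b < Rabs a ->
  exists e, (e = 1 \/ e = -1) /\
    forall r, Rabs b < r < Rabs a -> x3_slope x3 r = e * period a b r.
Proof.
intros HP Hab. set (c := (Rabs b + Rabs a) / 2).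
assert (Hc : Rabs b < c < Rabs a) by (unfold c; lra).
assert (Alt := fun r H => x3_slope_period a b Phi x3 r HP H).
assert (Cs : forall r, Rabs b < r < Rabs a -> continuous (x3_slope x3) r).
{ intros r Hr. exact (proj2 (x3_derive a b Phi x3 r HP Hr)). }
assert (PP : forall r, Rabs b < r < Rabs a -> 0 < period a b r).
{ intros r Hr. now apply period_pos, chamber_regular. }
assert (Nz : forall r, Rabs b < r < Rabs a -> x3_slope x3 r <> 0).
{ intros r Hr. generalize (PP r Hr). destruct (Alt r Hr); lra. }
destruct (Alt c Hc) as [E|E].
- exists 1. split; [now left|]. intros r Hr.
  assert (0 < x3_slope x3 r).
  { apply (continuous_no_sign_change _ _ _ Cs Nz c r Hc Hr). rewrite E. now apply PP. }
  generalize (PP r Hr). destruct (Alt r Hr); lra.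
- exists (-1). split; [now right|]. intros r Hr.
  assert (0 < - x3_slope x3 r).
  { apply (continuous_no_sign_change (fun r => - x3_slope x3 r) (Rabs b) (Rabs a)) with (x := c); try assumption.
    - intros t Ht. now apply (continuous_opp (x3_slope x3)), Cs.
    - intros t Ht. generalize (Nz t Ht). lra.
    - rewrite E. generalize (PP c Hc). lra. }
  generalize (PP r Hr). destruct (Alt r Hr); lra.
Qed.

(** By [period_upper] the increments of [x3] are bounded by those of a bounded
    function, so [x3] has finite limits at both ends of the chamber. *)
Lemma x3_extends a b Phi x3 e : action_angle a b Phi x3 -> a < b -> b < 0 -> (e = 1 \/ e = -1) ->
  (forall r, Rabs b < r < Rabs a -> x3_slope x3 r = e * period a b r) ->
  exists X : R -> R, (forall r, continuous X r) /\
    (forall r, Rabs b < r < Rabs a -> X r = e * x3 (r, 0, 0)) /\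
    (forall x y, Rabs b <= x -> x < y -> y <= Rabs a -> X x < X y).
Proof.
intros HP Hab Hb He Sl.
assert (Lab : Rabs b < Rabs a) by (rewrite !Rabs_left; lra).
set (p := Rabs b) in *. set (q := Rabs a) in *.
set (f := fun r => e * x3 (r, 0, 0)).
assert (Df : forall r, p < r < q -> is_derive f r (period a b r)).
{ intros r Hr. eapply is_derive_val.
  - apply (is_derive_scal (fun s => x3 (s, 0, 0)) r e). apply (x3_derive a b Phi x3 r HP Hr).
  - rewrite Sl //. destruct He as [-> | ->]; Rring. }
assert (Inc : forall x y, p < x -> x < y -> y < q -> f x < f y).
{ intros x y Hx Hxy Hy. apply (incr_function f p q (period a b)); try assumption.
  - intros t H1 H2. apply Df. now split.
  - intros t H1 H2. apply period_pos, chamber_regular. now split. }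
destruct (period_upper a b Hab Hb) as [C0 [C1 [HC0 [HC1 Up]]]]. fold p q in Up.
(* a primitive of the bound of period_upper *)
set (g := fun r => C0 * r + C1 * (2 * sqrt (r - p) - 2 * sqrt (q - r))).
assert (Dg : forall r, p < r < q -> is_derive g r (C0 + C1 * (/ sqrt (q - r) + / sqrt (r - p)))).
{ intros r Hr. unfold g.
  assert (0 < sqrt (r - p)) by (apply sqrt_lt_R0; lra).
  assert (0 < sqrt (q - r)) by (apply sqrt_lt_R0; lra).
  auto_derive; [lra|]. unfold Rminus in *. simpl. field. lra. }
set (B := C0 * q + C1 * (4 * sqrt (q - p))).
assert (HB : forall r, p <= r <= q -> Rabs (g r) <= B).
{ intros r Hr. unfold g, B.
  assert (S1 : 0 <= sqrt (r - p) <= sqrt (q - p)) by (split; [apply sqrt_pos|apply sqrt_le_1_alt; lra]).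
  assert (S2 : 0 <= sqrt (q - r) <= sqrt (q - p)) by (split; [apply sqrt_pos|apply sqrt_le_1_alt; lra]).
  assert (Pp : 0 <= p) by apply Rabs_pos.
  eapply Rle_trans; [apply Rabs_triang|]. rewrite !Rabs_mult.
  rewrite (Rabs_pos_eq C0); [|lra]. rewrite (Rabs_pos_eq C1); [|lra]. rewrite (Rabs_pos_eq r); [|lra].
  apply Rplus_le_compat; apply Rmult_le_compat_l; try lra. apply Rabs_le; lra. }
set (c := (p + q) / 2). assert (Hc : p < c < q) by (unfold c; lra).
assert (Comp : forall x y, p < x -> x < y -> y < q -> f y - f x <= g y - g x).
{ intros x y Hx Hxy Hy.
  destruct (MVT_gen (fun t => f t - g t) x y (fun t => period a b t - (C0 + C1 * (/ sqrt (q - t) + / sqrt (t - p))))) as [z [Hz E]].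
  - intros t. rewrite Rmin_left ?Rmax_right; try lra. intros Ht.
    apply is_derive_minR; [apply Df|apply Dg]; lra.
  - intros t. rewrite Rmin_left ?Rmax_right; try lra. intros Ht. apply continuity_pt_filterlim.
    refine (is_derive_continuous _ _ _ (is_derive_minR _ _ _ _ _ (Df t _) (Dg t _))); lra.
  - rewrite -> Rmin_left, Rmax_right in Hz by lra.
    assert (U := Up z ltac:(lra)).
    assert (0 <= (C0 + C1 * (/ sqrt (q - z) + / sqrt (z - p)) - period a b z) * (y - x))
      by (apply Rmult_le_pos; lra).
    lra. }
apply (monotone_extension f p q (Rabs (f c) + 2 * B)); try assumption.
- intros r Hr. exact (is_derive_continuous _ _ _ (Df r Hr)).
- intros r Hr.
  assert (K : Rabs (f r - f c) <= 2 * B).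
  { assert (B1 := HB r ltac:(lra)). assert (B2 := HB c ltac:(lra)).
    apply Rabs_le_between in B1. apply Rabs_le_between in B2.
    destruct (Rtotal_order r c) as [L|[L|L]].
    - generalize (Comp r c ltac:(lra) L ltac:(lra)) (Inc r c ltac:(lra) L ltac:(lra)).
      intros; apply Rabs_le; lra.
    - rewrite L Rminus_diag Rabs_R0. lra.
    - generalize (Comp c r ltac:(lra) L ltac:(lra)) (Inc c r ltac:(lra) L ltac:(lra)).
      intros; apply Rabs_le; lra. }
  replace (f r) with (f c + (f r - f c)) by ring. eapply Rle_trans; [apply Rabs_triang|]. lra.
Qed.

Lemma period_diverges a b c : a < b -> b < 0 -> (c = a \/ c = b) ->
  forall N, exists d, 0 < d /\ forall r, Rabs b < r < Rabs a -> Rabs (r - Rabs c) < d ->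
    N < period a b r.
Proof.
intros Hab Hb Hc N. assert (Ppi := PI_RGT_0).
assert (Pb : 0 < Rabs b) by (apply Rabs_pos_lt; lra).
assert (Lab : Rabs b < Rabs a) by (rewrite !Rabs_left; lra).
assert (Cneg : c < 0) by (destruct Hc; lra).
assert (HcR : Rabs c <= Rabs a) by (destruct Hc as [-> | ->]; lra).
set (q := Rabs a) in *. set (p := Rabs b) in *.
set (k := p / (2 * PI * q)).
assert (Hk : 0 < k) by (apply Rdiv_lt_0_compat; [lra|]; apply Rmult_lt_0_compat; lra).
assert (Rabs N + 1 > 0) by (generalize (Rabs_pos N); lra).
set (L := (Rabs N + 1) / k).
exists (exp (ln (q * PI) - L)). split; [apply exp_pos|]. intros r Hr Hd.
assert (Reg := chamber_regular a b r Hr).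
assert (PL := period_lower a b r c q Reg Hc Cneg ltac:(lra) HcR).
assert (D0 : 0 < Rabs (r - Rabs c)).
{ apply Rabs_pos_lt. destruct Reg as [_ [Ra Rb]]. destruct Hc as [-> | ->]; lra. }
apply ln_increasing in Hd; [|exact D0]. rewrite ln_exp in Hd.
set (l := ln (Rabs (r - Rabs c))) in *.
assert (HL : 0 < L) by (apply Rdiv_lt_0_compat; lra).
assert (Kr : k <= r / (2 * PI * q)).
{ unfold k, Rdiv. apply Rmult_le_compat_r; [|lra]. left; apply Rinv_0_lt_compat, Rmult_lt_0_compat; lra. }
assert (K1 : k * L <= r / (2 * PI * q) * (ln (q * PI) - l)) by (apply Rmult_le_compat; lra).
assert (K2 : k * L = Rabs N + 1) by (unfold L; field; lra).
generalize (Rle_abs N). lra.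
Qed.

(** A deviation from the negative axis of the order of the distance to the end
    costs a bounded flow time, while the period diverges. *)
Lemma turns_at_end a b c K : a < b -> b < 0 -> (c = a \/ c = b) ->
  forall eps, 0 < eps -> exists d, 0 < d /\ forall r phi (m : Z),
    Rabs b < r < Rabs a -> Rabs (r - Rabs c) < d ->
    Rabs (phi - (PI + 2 * PI * IZR m)) <= K * Rabs (r - Rabs c) ->
    Rabs (turns a b r phi - (IZR m + / 2)) < eps.
Proof.
intros Hab Hb Hc eps Heps. assert (Ppi := PI_RGT_0).
assert (Pb : 0 < Rabs b) by (apply Rabs_pos_lt; lra).
assert (Lab : Rabs b < Rabs a) by (rewrite !Rabs_left; lra).
set (q := Rabs a) in *. set (p := Rabs b) in *.
set (C := Rabs K * (/ (2 * PI) * (q / p + q))).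
assert (I2 : 0 < / (2 * PI)) by (apply Rinv_0_lt_compat; lra).
assert (Qp : 0 < q / p) by (apply Rdiv_lt_0_compat; lra).
destruct (period_diverges a b c Hab Hb Hc (C / eps)) as [d [Hd PD]].
exists (Rmin d ((q - p) / 2)). split; [apply Rmin_pos; lra|].
intros r phi m Hr Hrc Hphi. fold p q in PD.
assert (Reg := chamber_regular a b r Hr).
assert (Hrc1 := Rlt_le_trans _ _ _ Hrc (Rmin_l _ _)).
assert (Hrc2 := Rlt_le_trans _ _ _ Hrc (Rmin_r _ _)).
specialize (PD r Hr Hrc1).
set (D := Rabs (r - Rabs c)) in *.
assert (D0 : 0 < D).
{ apply Rabs_pos_lt. destruct Reg as [_ [Ra Rb]]. destruct Hc as [-> | ->]; lra. }
assert (PT := period_pos a b r Reg).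
assert (Da : D <= Rabs (r - q) /\ D <= Rabs (r - p)).
{ rewrite (Rabs_left (r - q)); [|lra]. rewrite (Rabs_pos_eq (r - p)); [|lra].
  unfold D in Hrc2 |- *. destruct Hc as [-> | ->]; fold p q in Hrc2 |- *.
  - rewrite -> (Rabs_left (r - q)) in Hrc2 |- * by lra. lra.
  - rewrite -> (Rabs_pos_eq (r - p)) in Hrc2 |- * by lra. lra. }
eapply Rle_lt_trans; [apply (turns_near_PI a b r phi D m Reg D0); apply Da|].
apply Rle_lt_trans with (C / period a b r).
- apply Rmult_le_compat_r; [left; now apply Rinv_0_lt_compat|].
  apply Rle_trans with (Rabs K * D * (/ (2 * PI) * (/ r + r / D))).
  + apply Rmult_le_compat_r.
    * assert (0 < / r) by (apply Rinv_0_lt_compat; lra).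
      assert (0 < r / D) by (apply Rdiv_lt_0_compat; lra).
      apply Rmult_le_pos; lra.
    * eapply Rle_trans; [exact Hphi|]. apply Rmult_le_compat_r; [lra|apply Rle_abs].
  + replace (Rabs K * D * (/ (2 * PI) * (/ r + r / D))) with
      (Rabs K * (/ (2 * PI) * (D * / r + r))) by (field; lra).
    unfold C. apply Rmult_le_compat_l; [apply Rabs_pos|]. apply Rmult_le_compat_l; [lra|].
    apply Rplus_le_compat; [|lra]. apply Rmult_le_compat; try lra.
    * left; apply Rinv_0_lt_compat; lra.
    * apply Rinv_le_contravar; lra.
- apply Rmult_lt_reg_r with (period a b r); [exact PT|].
  replace (C / period a b r * period a b r) with C by (field; lra).
  apply Rmult_lt_compat_r with (r := eps) in PD; [|exact Heps].
  replace (C / eps * eps) with C in PD by (field; lra). lra.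
Qed.

(** * The angle coordinate along a strongly admissible path *)

Definition angle_along (s : R -> C) (th : R -> R) : Prop :=
  (forall t, 0 <= t <= 1 -> continuous th t) /\
  (forall t, 0 <= t <= 1 -> s t = pt (Cmod (s t)) (th t)).

Lemma smooth_path_Cder s t : smooth_path s ->
  Cder s t (Derive (fun t => Re (s t)) t, Derive (fun t => Im (s t)) t).
Proof.
intros H. destruct (H 1%nat t) as [H1 H2]. split; apply Derive_correct; assumption.
Qed.

Lemma is_derive_Cmod f t d : Cder f t d -> f t <> 0%C ->
  is_derive (fun s => Cmod (f s)) t (Re (Cconj (f t) * d)%C / Cmod (f t)).
Proof.
intros H Hf. assert (P := proj1 (Cmod_gt_0 _) Hf).
apply (is_derive_ext (fun s => sqrt (Cmod (f s) ^ 2))).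
{ intros s. apply sqrt_pow2, Cmod_ge_0. }
eapply is_derive_val.
- apply (is_derive_comp sqrt (fun s => Cmod (f s) ^ 2)).
  + apply is_derive_Reals, derivable_pt_lim_sqrt, pow_lt, P.
  + apply Cder_Cmod_sqr. exact H.
- rewrite sqrt_pow2; [|lra].
  change (2 * Re (Cconj (f t) * d)%C * / (2 * Cmod (f t)) = Re (Cconj (f t) * d)%C / Cmod (f t)).
  field. lra.
Qed.

Lemma path_modulus_derive a b s t : strongly_admissible a b s -> 0 <= t <= 1 ->
  is_derive (fun t => Cmod (s t)) t (Derive (fun t => Cmod (s t)) t).
Proof.
intros [[Sm [Nz _]] _] Ht. apply Derive_correct. eexists.
apply is_derive_Cmod; [now apply smooth_path_Cder|now apply Nz].
Qed.

Lemma path_modulus_incr a b s x y : strongly_admissible a b s ->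
  0 <= x -> x < y -> y <= 1 -> Cmod (s x) < Cmod (s y).
Proof.
intros SA Hx Hxy Hy.
apply (incr_function_le (fun t => Cmod (s t)) 0 1 (Derive (fun t => Cmod (s t)))); try assumption.
- intros t H1 H2. apply (path_modulus_derive a b s t SA). now split.
- intros t H1 H2. destruct SA as [_ [P _]]. apply P. now split.
Qed.

Lemma path_ends a b s : strongly_admissible a b s ->
  Cmod (s 0) = Rabs b /\ Cmod (s 1) = Rabs a.
Proof. intros [[_ [_ [-> ->]]] _]. now rewrite !Cmod_R. Qed.

Lemma path_modulus_inj a b s x y : strongly_admissible a b s -> 0 <= x <= 1 -> 0 <= y <= 1 ->
  Cmod (s x) = Cmod (s y) -> x = y.
Proof.
intros SA Hx Hy E. destruct (Rtotal_order x y) as [H|[H|H]]; [|exact H|].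
- assert (L := path_modulus_incr a b s x y SA ltac:(lra) H ltac:(lra)). lra.
- assert (L := path_modulus_incr a b s y x SA ltac:(lra) H ltac:(lra)). lra.
Qed.

Lemma path_modulus_ge a b s t : strongly_admissible a b s -> 0 <= t <= 1 -> Rabs b <= Cmod (s t).
Proof.
intros SA Ht. rewrite -(proj1 (path_ends a b s SA)).
destruct (Req_dec t 0) as [->|N]; [lra|]. left.
apply (path_modulus_incr a b s 0 t SA); lra.
Qed.

Lemma angle_of_negative r phi c : 0 < r -> pt r phi = RtoC c -> c < 0 ->
  exists m : Z, phi = PI + 2 * PI * IZR m.
Proof.
intros Hr E Hc.
assert (M := Cmod_pt r phi (Rlt_le _ _ Hr)). rewrite E Cmod_R Rabs_left // in M.
apply pt_inj with r; [exact Hr|]. rewrite E -M. unfold pt, cexp.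
rewrite exp_0 cos_PI sin_PI. apply injective_projections; simpl; ring.
Qed.

Lemma sin_ge_half x : Rabs x <= 1 -> Rabs x / 2 <= Rabs (sin x).
Proof.
assert (K : forall y, 0 <= y <= 1 -> y / 2 <= sin y).
{ intros y Hy. destruct (pre_sin_bound y 0) as [L _]; try lra.
  unfold sin_approx, sin_term in L. simpl in L.
  assert (L' : y - y ^ 3 / 6 <= sin y).
  { eapply Rle_trans; [|exact L]. right. simpl. field. }
  assert (y ^ 3 <= y); [|lra].
  replace (y ^ 3) with (y * (y * y)) by ring.
  assert (y * y <= 1 * 1) by (apply Rmult_le_compat; lra). nra. }
intros Hx. destruct (Rle_dec 0 x) as [P|P].
- rewrite (Rabs_pos_eq x) // in Hx |- *. specialize (K x ltac:(lra)). rewrite Rabs_pos_eq; lra.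
- rewrite -> (Rabs_left x) in Hx |- * by lra. specialize (K (- x) ltac:(lra)).
  rewrite sin_neg in K. rewrite Rabs_left; lra.
Qed.

(** At a time when the path crosses the negative axis, |Im s| is at
    most of first order in time, and the variation of |s| exactly of first order,
    as |s| has positive derivative. *)
Lemma angle_end_bound a b s th t1 m : b < 0 -> strongly_admissible a b s -> angle_along s th ->
  0 <= t1 <= 1 -> th t1 = PI + 2 * PI * IZR m ->
  exists K eta, 0 < eta /\ forall t, 0 <= t <= 1 -> Rabs (t - t1) < eta ->
    Rabs (th t - th t1) <= K * Rabs (Cmod (s t) - Cmod (s t1)).
Proof.
intros Hb SA [Cth Ath] Ht1 Hth.
assert (Pb : 0 < Rabs b) by (apply Rabs_pos_lt; lra).
assert (Trig : cos (th t1) = -1 /\ sin (th t1) = 0).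
{ rewrite Hth. assert (E := cexp_period 0 PI m). unfold cexp in E.
  rewrite exp_0 !Rmult_1_l cos_PI sin_PI in E. now injection E. }
destruct Trig as [Tc Ts].
assert (ImE : forall t, 0 <= t <= 1 -> Im (s t) = Cmod (s t) * sin (th t)).
{ intros t Ht. rewrite {1}(Ath t Ht). unfold pt, cexp. rewrite exp_0. unfold Im; simpl. ring. }
assert (Im1 : Im (s t1) = 0) by (rewrite ImE // Ts; ring).
assert (DI := proj2 (smooth_path_Cder s t1 (proj1 (proj1 SA)))).
assert (DM := path_modulus_derive a b s t1 SA Ht1).
set (l := Derive (fun t => Cmod (s t)) t1) in *.
assert (Hl : 0 < l) by (apply SA; exact Ht1).
simpl in DI. set (k := Derive (fun t => Im (s t)) t1) in *.
destruct (is_derive_eps _ _ _ DI 1 Rlt_0_1) as [d1 [Hd1 B1]].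
destruct (is_derive_eps _ _ _ DM (l / 2) ltac:(lra)) as [d2 [Hd2 B2]].
destruct (proj1 (continuous_eps th t1) (Cth t1 Ht1) 1 Rlt_0_1) as [d3 [Hd3 B3]].
set (K1 := Rabs k + 1). assert (HK1 : 0 < K1) by (unfold K1; generalize (Rabs_pos k); lra).
exists (4 * K1 / (Rabs b * l)), (Rmin d1 (Rmin d2 d3)).
split; [repeat apply Rmin_pos; assumption|]. intros t Ht Htt.
assert (T : Rabs (t - t1) < d1 /\ Rabs (t - t1) < d2 /\ Rabs (t - t1) < d3).
{ revert Htt; unfold Rmin; repeat destruct Rle_dec; lra. }
destruct T as [T1 [T2 T3]].
specialize (B1 _ T1). specialize (B2 _ T2). specialize (B3 _ T3).
replace (t1 + (t - t1)) with t in B1, B2 by ring.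
set (h := t - t1) in *. rewrite Im1 Rminus_0_r in B1.
assert (U1 : Rabs (Im (s t)) <= K1 * Rabs h).
{ assert (Tr := Rabs_triang (Im (s t) - h * k) (h * k)).
  replace (Im (s t) - h * k + h * k) with (Im (s t)) in Tr by ring.
  rewrite (Rabs_mult h k) in Tr. unfold K1. lra. }
assert (U2 : l / 2 * Rabs h <= Rabs (Cmod (s t) - Cmod (s t1))).
{ set (v := Cmod (s t) - Cmod (s t1)) in *.
  assert (Tr := Rabs_triang (- (v - h * l)) v). rewrite Rabs_Ropp in Tr.
  replace (- (v - h * l) + v) with (h * l) in Tr by ring.
  rewrite (Rabs_mult h l) (Rabs_pos_eq l) in Tr; lra. }
set (x := th t - th t1) in *.
assert (SE : sin (th t) = - sin x).
{ replace (th t) with (th t1 + x) by (unfold x; ring). rewrite sin_plus Tc Ts. ring. }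
assert (U3 : Rabs b * (Rabs x / 2) <= Rabs (Im (s t))).
{ rewrite ImE // SE Rabs_mult Rabs_Ropp (Rabs_pos_eq (Cmod _)); [|apply Cmod_ge_0].
  apply Rmult_le_compat; try lra.
  - generalize (Rabs_pos x); lra.
  - now apply (path_modulus_ge a b).
  - apply sin_ge_half. lra. }
apply Rmult_le_reg_l with (Rabs b * l / 4); [apply Rdiv_lt_0_compat; [now apply Rmult_lt_0_compat|lra]|].
replace (Rabs b * l / 4 * (4 * K1 / (Rabs b * l) * Rabs (Cmod (s t) - Cmod (s t1))))
  with (K1 * Rabs (Cmod (s t) - Cmod (s t1))) by (field; lra).
apply Rle_trans with (K1 * (l / 2 * Rabs h)); [|apply Rmult_le_compat_l; lra].
replace (Rabs b * l / 4 * Rabs x) with (l / 2 * (Rabs b * (Rabs x / 2))) by field.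
replace (K1 * (l / 2 * Rabs h)) with (l / 2 * (K1 * Rabs h)) by ring.
apply Rmult_le_compat_l; lra.
Qed.

Lemma path_lift a b s th : a < b -> b < 0 -> strongly_admissible a b s -> angle_along s th ->
  exists h : R -> R, (forall r, continuous h r) /\
    h (Rabs b) = th 0 / (2 * PI) /\ h (Rabs a) = th 1 / (2 * PI) /\
    forall r, Rabs b < r < Rabs a ->
      exists t, 0 <= t <= 1 /\ Cmod (s t) = r /\ h r = turns a b r (th t).
Proof.
intros Hab Hb SA An. assert (Ppi := PI_RGT_0).
assert (Pb : 0 < Rabs b) by (apply Rabs_pos_lt; lra).
assert (Lab : Rabs b < Rabs a) by (rewrite !Rabs_left; lra).
destruct (path_ends a b s SA) as [E0 E1].
set (M := fun t => Cmod (s (clamp 0 1 t))).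
assert (Mt : forall t, 0 <= t <= 1 -> M t = Cmod (s t)) by (intros t Ht; unfold M; now rewrite clamp_id).
assert (CM : forall t, continuous M t).
{ intros t. apply (continuous_comp (clamp 0 1) (fun t => Cmod (s t))); [apply continuous_clamp|].
  exact (is_derive_continuous _ _ _ (path_modulus_derive a b s _ SA (clamp_range 0 1 t Rle_0_1))). }
assert (IM : forall x y, 0 <= x -> x < y -> y <= 1 -> M x < M y).
{ intros x y Hx Hxy Hy. rewrite !Mt; try lra. now apply (path_modulus_incr a b). }
destruct (monotone_inverse M 0 1 Rlt_0_1 CM IM) as [g [Cg [Rg [Mg gM]]]].
assert (sg : forall r, Rabs b <= r <= Rabs a -> Cmod (s (g r)) = r).
{ intros r Hr. rewrite -Mt // Mg !Mt ?E0 ?E1; try lra. now apply clamp_id. }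
assert (g0 : g (Rabs b) = 0) by (rewrite -E0 -(Mt 0) ?gM; lra).
assert (g1 : g (Rabs a) = 1) by (rewrite -E1 -(Mt 1) ?gM; lra).
assert (End : forall c, (c = a \/ c = b) -> 0 <= g (Rabs c) <= 1 -> s (g (Rabs c)) = RtoC c ->
  exists l, l = th (g (Rabs c)) / (2 * PI) /\ forall eps, 0 < eps -> exists d, 0 < d /\
    forall r, Rabs b < r < Rabs a -> Rabs (r - Rabs c) < d ->
    Rabs (turns a b r (th (g r)) - l) < eps).
{ intros c Hc Hg Hs. set (t1 := g (Rabs c)) in *.
  assert (Mc : Cmod (s t1) = Rabs c) by (rewrite Hs Cmod_R; reflexivity).
  assert (Hth : exists m : Z, th t1 = PI + 2 * PI * IZR m).
  { apply (angle_of_negative (Cmod (s t1)) (th t1) c).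
    - rewrite Mc. apply Rabs_pos_lt. destruct Hc; lra.
    - rewrite -Hs. symmetry. apply (proj2 An). exact Hg.
    - destruct Hc; lra. }
  destruct Hth as [m Hth].
  destruct (angle_end_bound a b s th t1 m Hb SA An Hg Hth) as [K [eta [Heta B]]].
  exists (IZR m + / 2). split; [rewrite Hth; field; lra|]. intros eps Heps.
  destruct (proj1 (continuous_eps g (Rabs c)) (Cg _) eta Heta) as [d1 [Hd1 G]].
  destruct (turns_at_end a b c K Hab Hb Hc eps Heps) as [d2 [Hd2 T]].
  exists (Rmin d1 d2). split; [now apply Rmin_pos|]. intros r Hr Hrc.
  apply T; [exact Hr|exact (Rlt_le_trans _ _ _ Hrc (Rmin_r _ _))|].
  specialize (B (g r) (Rg r) (G r (Rlt_le_trans _ _ _ Hrc (Rmin_l _ _)))).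
  rewrite Hth Mc sg in B; [|lra]. exact B. }
assert (Sb : s (g (Rabs b)) = RtoC b) by (rewrite g0; apply SA).
assert (Sa : s (g (Rabs a)) = RtoC a) by (rewrite g1; apply SA).
destruct (End b (or_intror eq_refl) (Rg _) Sb) as [lb [Elb Lb]].
destruct (End a (or_introl eq_refl) (Rg _) Sa) as [la [Ela La]].
rewrite g0 in Elb. rewrite g1 in Ela.
destruct (extend_by_limits (Rabs b) (Rabs a) lb la (fun r => turns a b r (th (g r))) Lab)
  as [h [Ch [Eh [hb ha]]]].
- intros r Hr. apply (turns_comp_continuous a b r (fun r => th (g r))); [now apply chamber_regular|].
  apply (continuous_comp g th); [apply Cg|]. apply (proj1 An), Rg.
- intros eps Heps. destruct (Lb eps Heps) as [d [Hd H]]. exists d; split; [exact Hd|].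
  intros r Hr Hrd. apply H; [exact Hr|]. rewrite Rabs_pos_eq; lra.
- intros eps Heps. destruct (La eps Heps) as [d [Hd H]]. exists d; split; [exact Hd|].
  intros r Hr Hrd. apply H; [exact Hr|]. rewrite Rabs_left; lra.
- exists h. split; [exact Ch|]. split; [now rewrite hb|]. split; [now rewrite ha|].
  intros r Hr. exists (g r). split; [apply Rg|]. split; [apply sg; lra|]. now apply Eh.
Qed.

(** * The SYZ transform of the sphere over a path *)

(** The sphere meets the fiber over (r, 0, 0) where [z = s t]; the covectors of the
    translate reach the points with [z] at flow time [f r * x3_slope x3 r], whatever
    their dlambda_j-coefficients are.  Both sets are orbits of the 2-torus, and they
    agree when the two arguments of [z] differ by a multiple of 2 PI. *)
Lemma conormal_translate_lift a b Phi x3 e s th (h f : R -> R) :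
  action_angle a b Phi x3 -> (e = 1 \/ e = -1) ->
  (forall r, Rabs b < r < Rabs a -> x3_slope x3 r = e * period a b r) ->
  strongly_admissible a b s -> angle_along s th ->
  (forall r, Rabs b < r < Rabs a ->
     exists t, 0 <= t <= 1 /\ Cmod (s t) = r /\ h r = turns a b r (th t)) ->
  conormal_translate a b Phi x3 (Lsphere a b s) f <->
  (forall r, Rabs b < r < Rabs a -> continuous f r) /\
  (forall r, Rabs b < r < Rabs a -> exists k : Z, e * f r = h r + IZR k).
Proof.
intros HP He Sl SA An Hh.
assert (He2 : e * e = 1) by (destruct He as [-> | ->]; ring).
split; intros [Cf H]; (split; [exact Cf|]); intros r Hr; specialize (H r Hr).
- destruct (Hh r Hr) as [t [Ht [Et Eh]]]. rewrite Eh.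
  assert (Reg := chamber_regular a b r Hr). assert (PT := period_pos a b r Reg).
  assert (HB := chamber_Bsm a b (r, 0, 0) Hr).
  set (y := Phi (r, 0, 0) (flow_time a b r (th t), 0, 0)).
  assert (Ry : rho y = (r, 0, 0)) by now apply (aa_rho _ _ _ _ HP).
  assert (Hy : Y0 a b y) by now apply (aa_Y0 _ _ _ _ HP).
  assert (Zy : cz y = pt r (th t)) by now apply (angle_flow a b Phi x3).
  assert (Ly : Lsphere a b s y).
  { split; [exact Hy|split].
    - exists t. split; [exact Ht|]. rewrite Zy (proj2 An t Ht) Et. reflexivity.
    - destruct (fiber_moduli a b y r Hy Ry) as [M1 [M2 [M3 M4]]].
      assert (K : forall x z, 0 <= x -> 0 <= z -> x ^ 2 = z ^ 2 -> x = z) by (intros; nra).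
      split; apply K; try apply Cmod_ge_0; congruence. }
  apply (H y Ry) in Ly. destruct Ly as [xi1 [xi2 Ey]].
  assert (Zf : cz y = cz (Phi (r, 0, 0) (f r * x3_slope x3 r, 0, 0))).
  { apply (fiber_orbit a b Phi x3 r _ y HP Hr Hy Ry). rewrite Ey. unfold cov.
    do 2 eexists. reflexivity. }
  destruct (flow_time_surj a b r (f r * x3_slope x3 r) Reg) as [phi Hphi].
  rewrite -Hphi (angle_flow a b Phi x3 r HP Hr) Zy in Zf.
  destruct (pt_inj r _ _ (proj1 Reg) (eq_sym Zf)) as [k Hk]. exists k.
  rewrite Hk flow_time_period // Sl // in Hphi.
  unfold turns. apply Rmult_eq_reg_r with (period a b r); [|lra].
  transitivity (flow_time a b r (th t) + IZR k * period a b r); [lra|field; lra].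
- intros y Ry. destruct (Hh r Hr) as [t [Ht [Et Eh]]]. destruct H as [k Hk]. rewrite Eh in Hk.
  assert (Reg := chamber_regular a b r Hr). assert (PT := period_pos a b r Reg).
  assert (HB := chamber_Bsm a b (r, 0, 0) Hr).
  assert (Ef : f r * x3_slope x3 r = flow_time a b r (th t + 2 * PI * IZR k)).
  { rewrite flow_time_period // Sl //.
    replace (f r * (e * period a b r)) with (e * f r * period a b r) by ring.
    rewrite Hk. unfold turns. field. lra. }
  assert (Zt : cz (Phi (r, 0, 0) (f r * x3_slope x3 r, 0, 0)) = s t).
  { rewrite Ef (angle_flow a b Phi x3 r HP Hr) pt_period (proj2 An t Ht) Et. reflexivity. }
  split.
  + intros [Hy [[t' [Ht' Ez]] _]].
    assert (Ett : t' = t).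
    { apply (path_modulus_inj a b s t' t SA Ht' Ht). rewrite Et -Ez. now apply (rho_r y r 0 0). }
    subst t'. rewrite -Zt in Ez.
    apply (fiber_orbit a b Phi x3 r _ y HP Hr Hy Ry) in Ez. destruct Ez as [c1 [c2 Ey]].
    exists (f r * snd (fst (grad x3 (r, 0, 0))) - c1), (f r * snd (grad x3 (r, 0, 0)) - c2).
    rewrite Ey. unfold cov. f_equal. f_equal; [f_equal|]; ring.
  + intros [xi1 [xi2 Ey]].
    assert (Hy : Y0 a b y) by (rewrite Ey; now apply (aa_Y0 _ _ _ _ HP)).
    split; [exact Hy|split].
    * exists t. split; [exact Ht|]. rewrite -Zt.
      apply (fiber_orbit a b Phi x3 r _ y HP Hr Hy Ry). rewrite Ey. unfold cov.
      do 2 eexists. reflexivity.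
    * destruct (fiber_moduli a b y r Hy Ry) as [M1 [M2 [M3 M4]]].
      assert (K : forall x z, 0 <= x -> 0 <= z -> x ^ 2 = z ^ 2 -> x = z) by (intros; nra).
      split; apply K; try apply Cmod_ge_0; congruence.
Qed.

Lemma open_interval_ends a b c d : c < d ->
  (forall x, a < x < b <-> c < x < d) -> a = c /\ b = d.
Proof.
intros Hcd H.
assert (Hm := proj2 (H ((c + d) / 2)) ltac:(lra)).
split.
- destruct (Rtotal_order a c) as [L|[E|L]]; [|exact E|]; exfalso.
  + assert (K := proj1 (H ((a + c) / 2)) ltac:(lra)). lra.
  + assert (K := proj2 (H ((a + c) / 2)) ltac:(lra)). lra.
- destruct (Rtotal_order b d) as [L|[E|L]]; [|exact E|]; exfalso.
  + assert (K := proj2 (H ((b + d) / 2)) ltac:(lra)). lra.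
  + assert (K := proj1 (H ((b + d) / 2)) ltac:(lra)). lra.
Qed.

Lemma path_angle_ends a b s th : a < b -> b < 0 -> strongly_admissible a b s -> angle_along s th ->
  exists m0 m1 : Z, th 0 = PI + 2 * PI * IZR m0 /\ th 1 = PI + 2 * PI * IZR m1.
Proof.
intros Hab Hb SA An. destruct (path_ends a b s SA) as [M0 M1].
destruct (proj1 SA) as [_ [_ [S0 S1]]].
destruct (angle_of_negative (Rabs b) (th 0) b) as [m0 H0]; try assumption.
{ apply Rabs_pos_lt; lra. }
{ rewrite -S0 (proj2 An 0); [|lra]. now rewrite M0. }
destruct (angle_of_negative (Rabs a) (th 1) a) as [m1 H1]; try lra.
{ apply Rabs_pos_lt; lra. }
{ rewrite -S1 (proj2 An 1); [|lra]. now rewrite M1. }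
now exists m0, m1.
Qed.

(** The integer [w] is the winding number around 0 of [s] followed by the reverse
    of [s0].  A solution [f], [f0] of the two conormal conditions is determined up
    to integer constants, which cancel from the degree; this gives uniqueness.
    Existence uses the two lifts themselves and the inverse of [x3] along the
    segment of the base. *)
Theorem syz_transform_of_path a b Phi x3 s0 s th0 th (w : Z) :
  a < b -> b < 0 -> action_angle a b Phi x3 ->
  strongly_admissible a b s0 -> angle_along s0 th0 ->
  strongly_admissible a b s -> angle_along s th ->
  (th 1 - th 0) - (th0 1 - th0 0) = 2 * PI * IZR w ->
  syz_transform_is a b Phi x3 s0 (sphere_brane a b s) (OE (- w)).
Proof.
intros Hab Hb HP SA0 An0 SA An Hw. assert (Ppi := PI_RGT_0).
assert (Lab : Rabs b < Rabs a) by (rewrite !Rabs_left; lra).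
destruct (x3_slope_sign a b Phi x3 HP Lab) as [e [He Sl]].
assert (He2 : e * e = 1) by (destruct He as [-> | ->]; ring).
destruct (x3_extends a b Phi x3 e HP Hab Hb He Sl) as [X [CX [EX IX]]].
destruct (path_lift a b s th Hab Hb SA An) as [h [Ch [hb [ha Hh]]]].
destruct (path_lift a b s0 th0 Hab Hb SA0 An0) as [h0 [Ch0 [h0b [h0a Hh0]]]].
assert (CT := fun f => conormal_translate_lift a b Phi x3 e s th h f HP He Sl SA An Hh).
assert (CT0 := fun f => conormal_translate_lift a b Phi x3 e s0 th0 h0 f HP He Sl SA0 An0 Hh0).
assert (J : exists j : Z, h (Rabs b) - h0 (Rabs b) = IZR j /\ h (Rabs a) - h0 (Rabs a) = IZR (j + w)).
{ destruct (path_angle_ends a b s th Hab Hb SA An) as [m [m' [E E']]].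
  destruct (path_angle_ends a b s0 th0 Hab Hb SA0 An0) as [n [n' [F F']]].
  exists (m - n)%Z. rewrite hb ha h0b h0a plus_IZR minus_IZR. split.
  - rewrite E F. field. lra.
  - apply Rmult_eq_reg_l with (2 * PI); [|lra].
    transitivity (th 1 - th0 1); [field; lra|]. rewrite E F in Hw. lra. }
destruct J as [j [Jb Ja]].
set (p := Rabs b) in *. set (q := Rabs a) in *.
destruct (monotone_inverse X p q Lab CX IX) as [g [Cg [Rg [Xg gX]]]].
assert (X01 : X p < X q) by (apply IX; lra).
assert (Xx3 : forall r, p < r < q -> x3 (r, 0, 0) = e * X r).
{ intros r Hr. rewrite EX //. transitivity (e * e * x3 (r, 0, 0)); [rewrite He2|]; ring. }
assert (Range : forall x, (exists r, p < r < q /\ x = x3 (r, 0, 0)) <-> X p < e * x < X q).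
{ intros x. split.
  - intros [r [Hr ->]]. rewrite -(EX r Hr). split; apply IX; lra.
  - intros Hx. assert (Xr : X (g (e * x)) = e * x) by (rewrite Xg; apply clamp_id; lra).
    assert (Rr := Rg (e * x)).
    assert (Hr : p < g (e * x) < q).
    { split; (apply Rnot_le_lt; intros L); [replace (g (e * x)) with p in Xr by lra|
        replace (g (e * x)) with q in Xr by lra]; lra. }
    exists (g (e * x)). split; [exact Hr|]. rewrite Xx3 // Xr.
    transitivity (e * e * x); [rewrite He2|]; ring. }
assert (gp : forall x, x <= X p -> g x = p).
{ intros x Hx. rewrite -(gX (g x) (Rg x)) Xg. unfold clamp.
  rewrite (Rmin_left x); [|lra]. rewrite Rmax_left // gX; lra. }
assert (gq : forall x, X q <= x -> g x = q).
{ intros x Hx. rewrite -(gX (g x) (Rg x)) Xg. unfold clamp.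
  rewrite (Rmin_right x) // Rmax_right ?gX; lra. }
split.
- set (F := fun x => e * (h (g (e * x)) - h0 (g (e * x)))).
  assert (CF : forall x, continuous F x).
  { intros x. unfold F.
    assert (Cge : continuous (fun x => g (e * x)) x).
    { apply (continuous_comp (fun x => e * x) g); [|apply Cg].
      apply (continuous_mult (fun _ => e) (fun x => x)); [apply continuous_const|apply continuous_id]. }
    apply (continuous_mult (fun _ => e) (fun x => h (g (e * x)) - h0 (g (e * x)))); [apply continuous_const|].
    apply (continuous_minus (fun x => h (g (e * x))) (fun x => h0 (g (e * x)))).
    - apply (continuous_comp (fun x => g (e * x)) h); [exact Cge|apply Ch].
    - apply (continuous_comp (fun x => g (e * x)) h0); [exact Cge|apply Ch0]. }
  assert (Lift : forall (k : R -> R), (forall r, continuous k r) ->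
    (forall r, p < r < q -> continuous (fun r => e * k r) r) /\
    forall r, p < r < q -> exists n : Z, e * (e * k r) = k r + IZR n).
  { intros k Ck. split.
    - intros r _. apply (continuous_mult (fun _ => e) k); [apply continuous_const|apply Ck].
    - intros r _. exists 0%Z. rewrite -Rmult_assoc He2. ring. }
  assert (Ends : exists xm xM n0 ninf, (forall x, xm < x < xM <-> X p < e * x < X q) /\
    (forall x, x <= xm -> F x = IZR n0) /\ (forall x, xM <= x -> F x = IZR ninf)).
  { unfold F. destruct He as [-> | ->].
    - exists (X p), (X q), j, (j + w)%Z. split; [|split].
      + intros x. rewrite Rmult_1_l. tauto.
      + intros x Hx. rewrite (gp (1 * x)); lra.
      + intros x Hx. rewrite (gq (1 * x)); lra.
    - exists (- X q), (- X p), (- (j + w))%Z, (- j)%Z. split; [|split].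
      + intros x. split; intros; lra.
      + intros x Hx. rewrite (gq (-1 * x)) ?opp_IZR; lra.
      + intros x Hx. rewrite (gp (-1 * x)) ?opp_IZR; lra. }
  destruct Ends as [xm [xM [n0 [ninf [HI [F0 Finf]]]]]].
  exists (mkTransform
    (fun q => inX0 q /\ closureX (continuation (syz_piece a b x3 (sphere_brane a b s))) q)
    (nabla_bundle F n0 ninf)).
  split; [intros y; simpl; tauto|].
  exists (fun r => e * h r), (fun r => e * h0 r), xm, xM, F, n0, ninf.
  split; [now apply CT, Lift|]. split; [now apply CT0, Lift|].
  split; [intros x; rewrite HI Range; tauto|].
  split; [|split; [exact CF|split; [exact F0|split; [exact Finf|reflexivity]]]].
  intros r Hr. change (p < r < q) in Hr. unfold F. rewrite -(EX r Hr) gX; lra.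
- intros T [Supp [f [f0 [xm [xM [F [n0 [ninf [Cf [Cf0 [HI [HF [CF [F0 [Finf EB]]]]]]]]]]]]]]].
  split.
  { intros y. rewrite Supp. now apply syz_support. }
  rewrite EB.
  assert (Deg : (n0 - ninf = - w)%Z).
  2: { rewrite -Deg. now apply (nabla_bundle_OE F xm xM). }
  apply CT in Cf. apply CT0 in Cf0. destruct Cf as [Cf Zf]. destruct Cf0 as [Cf0 Zf0].
  fold p q in HI, HF.
  destruct (integer_valued_const (fun r => e * (f r - f0 r) - (h r - h0 r)) p q Lab) as [k Hk].
  { intros r Hr.
    apply (continuous_minus (fun r => e * (f r - f0 r)) (fun r => h r - h0 r)).
    - apply (continuous_mult (fun _ => e) (fun r => f r - f0 r)); [apply continuous_const|].
      apply (continuous_minus f f0); [apply Cf|apply Cf0]; exact Hr.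
    - apply (continuous_minus h h0); [apply Ch|apply Ch0]. }
  { intros r Hr. destruct (Zf r Hr) as [k1 H1]. destruct (Zf0 r Hr) as [k2 H2].
    exists (k1 - k2)%Z. rewrite minus_IZR. lra. }
  destruct (eq_at_ends (fun r => F (e * X r)) (fun r => e * (h r - h0 r + IZR k)) p q Lab) as [Ep Eq].
  { intros r. apply (continuous_comp (fun r => e * X r) F); [|apply CF].
    apply (continuous_mult (fun _ => e) X); [apply continuous_const|apply CX]. }
  { intros r. apply (continuous_mult (fun _ => e) (fun r => h r - h0 r + IZR k)); [apply continuous_const|].
    apply (continuous_plus (fun r => h r - h0 r) (fun _ => IZR k)); [|apply continuous_const].
    apply (continuous_minus h h0); [apply Ch|apply Ch0]. }
  { intros r Hr. rewrite -(Xx3 r Hr) HF // -(Hk r Hr).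
    transitivity (e * e * (f r - f0 r)); [rewrite He2|]; ring. }
  simpl in Ep, Eq. rewrite Jb in Ep. rewrite Ja plus_IZR in Eq.
  apply eq_IZR. rewrite minus_IZR opp_IZR.
  assert (HI' : forall x, xm < x < xM <-> X p < e * x < X q) by (intros x; now rewrite HI Range).
  destruct He as [-> | ->].
  + destruct (open_interval_ends xm xM (X p) (X q) X01) as [E1 E2].
    { intros x. rewrite HI' Rmult_1_l. tauto. }
    rewrite -(F0 xm (Rle_refl _)) -(Finf xM (Rle_refl _)) E1 E2.
    rewrite !Rmult_1_l in Ep, Eq. lra.
  + destruct (open_interval_ends xm xM (- X q) (- X p)) as [E1 E2]; [lra| |].
    { intros x. rewrite HI'. split; intros; lra. }
    rewrite -(F0 xm (Rle_refl _)) -(Finf xM (Rle_refl _)) E1 E2.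
    replace (- X q) with (-1 * X q) by ring. replace (- X p) with (-1 * X p) by ring. lra.
Qed.

Lemma Cder_segment p q t : Cder (segment p q) t (RtoC (q - p)).
Proof.
split; unfold segment; simpl.
- auto_derive; [exact I|Rring].
- apply @is_derive_const.
Qed.

Lemma ex_derive_n_affine c d n t : ex_derive_n (fun t => c + t * d) n t.
Proof.
destruct n as [|[|n]]; [exact I| |].
- simpl. auto_derive. exact I.
- simpl. apply (ex_derive_ext (Derive_n (fun _ => d) n)).
  + intros s. rewrite -(Derive_n_ext (Derive (fun t => c + t * d))).
    * change (Derive (fun t => c + t * d)) with (Derive_n (fun t => c + t * d) 1).
      rewrite Derive_n_comp Nat.add_1_r. reflexivity.
    * intros x. apply is_derive_unique. auto_derive; [exact I|Rring].
  + apply (ex_derive_n_const d (S n)).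
Qed.

(** The segment stays on the negative axis, so the transversality condition to
    the interval from [-b] to [-a] is vacuous. *)
Lemma segment_strongly_admissible a b : a < b -> b < 0 -> strongly_admissible a b (segment b a).
Proof.
intros Hab Hb.
assert (Neg : forall t, 0 <= t <= 1 -> b + t * (a - b) < 0) by (intros; nra).
assert (Nz : forall t, 0 <= t <= 1 -> segment b a t <> 0%C).
{ intros t Ht E. injection E. generalize (Neg t Ht). lra. }
split; [split; [|split; [exact Nz|split]]|split].
- intros n t. split; [apply ex_derive_n_affine|]. apply (ex_derive_n_const 0 n).
- unfold segment. f_equal. ring.
- unfold segment. f_equal. ring.
- intros t Ht.
  rewrite (is_derive_unique _ _ _ (is_derive_Cmod _ _ _ (Cder_segment b a t) (Nz t Ht))).
  apply Rdiv_lt_0_compat; [|now apply Cmod_gt_0, Nz].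
  unfold segment; simpl. generalize (Neg t Ht). nra.
- intros t Ht _ [H _]. unfold segment in H; simpl in H. generalize (Neg t Ht). lra.
Qed.

Lemma segment_angle a b : a < b -> b < 0 -> angle_along (segment b a) (fun _ => PI).
Proof.
intros Hab Hb. split.
- intros t _. apply continuous_const.
- intros t Ht. assert (Neg : b + t * (a - b) < 0) by nra.
  unfold segment. rewrite Cmod_R Rabs_left; [|exact Neg]. unfold pt, cexp.
  rewrite exp_0 cos_PI sin_PI. apply injective_projections; simpl; ring.
Qed.

Theorem theorem1p3 (a b : R) (Hab : a < b) (Hb : b < 0)
  (Phi : R * R * R -> R * R * R -> amb) (x3 : R * R * R -> R)
  (HPhi : action_angle a b Phi x3)
  (sigma0 : R -> C) (Hsigma0 : reference_path a b sigma0) :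
  syz_transform_is a b Phi x3 sigma0 (sphere_brane a b sigma0) (OE 0) /\
  syz_transform_is a b Phi x3 sigma0 (sphere_brane a b (segment b a)) (OE (-1)).
Proof.
destruct Hsigma0 as [SA0 [[th0 [Cth [Ath Turn]]] _]].
assert (An0 : angle_along sigma0 th0) by exact (conj Cth Ath).
split.
- apply (syz_transform_of_path a b Phi x3 sigma0 sigma0 th0 th0 0); try assumption. ring.
- apply (syz_transform_of_path a b Phi x3 sigma0 (segment b a) th0 (fun _ => PI) 1); try assumption.
  + now apply segment_strongly_admissible.
  + now apply segment_angle.
  + rewrite Turn. ring.
Qed.
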